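(* Let $u$ be the mild solution of the stochastic linear Schr\''odinger equation $du=\bm{i}\Delta u\,dt+\bm{i}\alpha\,dW(t)$, $t>0$, $u(0)=u_0\in H^1_0(0,\pi)$, described in the context, and put $B_T=\frac{u(T)}{T}$ for $T>0$. Then $\{B_T\}_{T>0}$ satisfies a large deviations principle (as $T\to\infty$, with speed $T$) on $H^0=L^2(0,\pi;\mathbb C)$ with the good rate function $$I(x)=\begin{cases}\frac{1}{\alpha^2}\left\|Q^{-\frac12}x\right\|_{H^0}^2, & \text{if } x\in Q^{\frac12}(H^0),\\ +\infty, & \text{otherwise,}\end{cases}$$ where $Q^{-\frac12}$ is the pseudo inverse of $Q^{\frac12}$.
   Context: Notation: $\bm{i}$ is the imaginary unit; $H^0=L^2(0,\pi;\mathbb C)$, $U^0=L^2(0,\pi;\mathbb R)$, $U^1=H^1(0,\pi;\mathbb R)$, $H^1_0(0,\pi)=\{f\in H^1(0,\pi;\mathbb C): f(0)=f(\pi)=0\}$. $H^0$ is regarded as a real Hilbert space with $\langle f,g\rangle_{\mathbb R}=\Re\int_0^\pi f\bar g\,dx$. Setting: $\alpha>0$; $\Delta$ is the Dirichlet Laplacian on $(0,\pi)$; $e_k(x)=\sqrt{2/\pi}\,\sin(kx)$, so $\Delta e_k=-k^2e_k$. $Q$ is a nonnegative symmetric operator on $U^0$ with $Qe_k=\eta_ke_k$ for a non-increasing sequence $\{\eta_k\}_{k\in\mathbb N}$ of nonnegative reals, and $Q^{1/2}$ is a Hilbert--Schmidt operator from $U^0$ to $U^1$. $Q$ is extended to $H^0$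 by $Qf=Q(\Re f)+\bm{i}Q(\Im f)$. $W(t)=\sum_{k\ge1}\sqrt{\eta_k}\,\beta_k(t)e_k$ is a $U^0$-valued $Q$-Wiener process, with $\beta_k$ independent standard real Brownian motions on a complete filtered probability space satisfying the usual conditions. $u_0\in H^1_0(0,\pi)$ is deterministic. With $S(t)=e^{\bm{i}t\Delta}$, the mild solution is $u(t)=S(t)u_0+\bm{i}\alpha\int_0^tS(t-s)\,dW(s)$. The pseudo inverse: for $x\in Q^{1/2}(H^0)$, $Q^{-1/2}x$ is the element $z\in H^0$ of minimal norm with $Q^{1/2}z=x$. LDP: a function $I:\mathcal X\to[0,\infty]$ on a Hausdorff topological space is a rate function if it is lower semicontinuous, and a good rate function if all level sets $\{I\le a\}$, $a\in[0,\infty)$, are compact. A family $\{Z_T\}_{T>0}$ of $\mathcal X$-valued random variables satisfies an LDP with rate function $I$ if $\liminf_{T\to\infty}\frac1T\ln \mathbf P(Z_T\in G)\ge-\inf_G I$ for every open $G$ and $\limsup_{T\to\infty}\frac1T\ln \mathbf P(Z_T\in C)\le-\inf_C I$ for every closed $C$. *)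

(* Defs.v *)
From HB Require Import structures.
From mathcomp Require Import all_boot all_order all_algebra ring_quotient finmap.
From mathcomp Require Import all_classical all_reals all_analysis.
From mathcomp Require Import measurable_realfun.

Set Implicit Arguments.
Unset Strict Implicit.
Unset Printing Implicit Defensive.

Import Order.TTheory GRing.Theory Num.Theory.
Import numFieldNormedType.Exports.

Local Open Scope classical_set_scope.
Local Open Scope ring_scope.

(* The library provides the p-norms and the module of p-integrable functions;
   the quotient by almost everywhere equality, with its norm, is built here. *)
Lemma le1_2 (R : realType) : (1 <= 2%:E :> \bar R)%E.
Proof. by rewrite lee_fin ler1n. Qed.

Section L2_bounded.
Context d (T : measurableType d) (R : realType).

Lemma measurable_sqr_abse (f : T -> R) : measurable_fun setT f ->
  measurable_fun setT (fun x => `|(f x)%:E| `^ 2)%E.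
Proof.
move=> mf; apply: (measurableT_comp (measurable_poweR _)) => //.
by apply: measurableT_comp => //; exact/measurable_EFinP.
Qed.

Lemma bounded_Lfun2 (mu : {finite_measure set T -> \bar R}) (f : T -> R) (c : R) :
  measurable_fun setT f -> (forall x, `|f x| <= c) -> f \in Lfun mu 2%:E.
Proof.
move=> mf fc; rewrite inE; apply/andP; split; rewrite inE//=.
rewrite /finite_norm unlock poweR_lty//.
apply: (@le_lt_trans _ _ (\int[mu]_x (cst (c `^ 2)%:E x))%E); last first.
  exact/integrable_lty/finite_measure_integrable_cst.
apply: ge0_le_integral => //.
- by move=> x _; rewrite poweR_ge0.
- exact: measurable_sqr_abse.
move=> x _; rewrite /= lee_fin ge0_ler_powR ?nnegrE//.
exact: le_trans (fc x).
Qed.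

End L2_bounded.

Section L2space.
Context d (T : measurableType d) (R : realType).
Variable mu : {measure set T -> \bar R}.

Local Notation preL2 := (LfunType mu (le1_2 R)).

Definition null_fun : {pred preL2} :=
  fun f => `[< (f : T -> R) = cst 0 %[ae mu] >].

Lemma null_fun_zmod_closed : zmod_closed null_fun.
Proof.
split; first by apply/asboolP; exact: ae_eq_refl.
move=> f g /asboolP f0 /asboolP g0; apply/asboolP.
apply: filterS2 f0 g0 => x /= /(_ I) fx /(_ I) gx _.
by rewrite -[LHS]/(f x - g x) [f x]fx [g x]gx subrr.
Qed.

HB.instance Definition _ :=
  GRing.isZmodClosed.Build preL2 null_fun null_fun_zmod_closed.

Definition L2 : Type := @Quotient.quot preL2 null_fun.
HB.instance Definition _ := EqQuotient.on L2.
HB.instance Definition _ := Choice.on L2.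
HB.instance Definition _ := GRing.Zmodule.on L2.

Definition L2class (f : preL2) : L2 := \pi_L2%qT f.

Definition L2fun (f : L2) : T -> R := (repr f : preL2).
Coercion L2fun : L2 >-> Funclass.

Lemma L2classP (f g : preL2) :
  L2class f = L2class g <-> (f : T -> R) = g %[ae mu].
Proof.
split=> [/eqP|fg].
  rewrite /L2class -Quotient.idealrBE => /asboolP.
  by apply: filterS => x /= /(_ I) + _ => /eqP; rewrite subr_eq0 => /eqP.
apply/eqP; rewrite -Quotient.idealrBE; apply/asboolP.
apply: filterS fg => x /= /(_ I) fgx _.
by rewrite -[LHS]/(f x - g x) [f x]fgx subrr.
Qed.

Lemma L2funK (f : L2) : L2class (repr f) = f.
Proof. exact: reprK. Qed.

Lemma L2class_fun (f : preL2) : (L2class f : T -> R) = f %[ae mu].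
Proof. by apply/L2classP; rewrite L2funK. Qed.

Lemma L2P (f g : L2) : f = g <-> (f : T -> R) = g %[ae mu].
Proof. by rewrite -{1}[f]L2funK -{1}[g]L2funK; exact: L2classP. Qed.

Lemma L2classD : {morph L2class : f g / f + g}.
Proof. by move=> f g; rewrite /L2class !piE. Qed.

Definition L2scale (a : R) (f : L2) : L2 := L2class (a *: repr f).

Lemma L2classZ a f : L2class (a *: f) = L2scale a (L2class f).
Proof.
apply/L2classP; have := L2class_fun f.
apply: filterS => x /= /(_ I) fx _.
by rewrite -[LHS]/(a * f x) -fx.
Qed.

Lemma L2scaleA a b f : L2scale a (L2scale b f) = L2scale (a * b) f.
Proof. by rewrite -[f]L2funK -!L2classZ scalerA. Qed.

Lemma L2scale1 : left_id 1 L2scale.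
Proof. by move=> f; rewrite -[f]L2funK -L2classZ scale1r. Qed.

Lemma L2scaleDr : right_distributive L2scale +%R.
Proof.
move=> a f g; rewrite -[f]L2funK -[g]L2funK -L2classD -!L2classZ.
by rewrite scalerDr L2classD.
Qed.

Lemma L2scaleDl f : {morph L2scale^~ f : a b / a + b}.
Proof. by move=> a b; rewrite -[f]L2funK -!L2classZ scalerDl L2classD. Qed.

HB.instance Definition _ := GRing.Zmodule_isLmodule.Build R L2
  L2scaleA L2scale1 L2scaleDr L2scaleDl.

Definition L2norm (f : L2) : R := fine ('N[mu]_2%:E[EFin \o f])%E.

Lemma L2normE (f : preL2) :
  (L2norm (L2class f))%:E = 'N[mu]_2%:E[EFin \o (f : T -> R)]%E.
Proof.
rewrite /L2norm (finite_norm_fine (repr (L2class f))) unlock; congr poweR.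
apply: ae_eq_integral => //; [exact: measurable_sqr_abse|exact: measurable_sqr_abse|].
by have := L2class_fun f; apply: filterS => x /= /(_ I) fx _; rewrite -fx.
Qed.

Lemma ler_L2normD f g : L2norm (f + g) <= L2norm f + L2norm g.
Proof.
rewrite -[f]L2funK -[g]L2funK -L2classD -lee_fin.
rewrite (EFinD (L2norm _) (L2norm _)) !L2normE.
by apply: (@eminkowski _ _ _ mu (repr f) (repr g)) => //; exact: le1_2.
Qed.

Lemma L2normZ (a : R) f : L2norm (a *: f) = `|a| * L2norm f.
Proof.
rewrite -[f]L2funK -[a *: _]/(L2scale a _) -L2classZ.
by apply: EFin_inj; rewrite (EFinM _ (L2norm _)) !L2normE LnormZ.
Qed.

Lemma L2norm0_eq0 f : L2norm f = 0 -> f = 0.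
Proof.
rewrite -[f]L2funK => f0; have /fine_Lnormr_eq0 : fine 'N[mu]_2%:E[EFin \o (repr f : T -> R)] = 0.
  by rewrite -L2normE f0.
move=> {}f0; rewrite -[RHS](_ : L2class 0 = 0) ?L2classP//.
by rewrite /L2class piE.
Qed.

HB.instance Definition _ := Lmodule_isNormed.Build R L2
  ler_L2normD L2normZ L2norm0_eq0.

End L2space.

Section interval.
Variable R : realType.

Definition itv0pi : set (measurableTypeR R) := [set` `]0, (pi : R)[ ].

Lemma measurable_itv0pi : measurable itv0pi.
Proof. exact: measurable_itv. Qed.

Lemma lebesgue_itv0pi_fin : (lebesgue_measure itv0pi < +oo)%E.
Proof.
by rewrite lebesgue_measure_itv/=; case: ifP => _ //; rewrite -EFinD ltry.
Qed.

(* A measure on the whole line, null outside (0, pi). *)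
Definition mu0pi : set (measurableTypeR R) -> \bar R :=
  mfrestr measurable_itv0pi lebesgue_itv0pi_fin.
HB.instance Definition _ := FiniteMeasure.on mu0pi.

Definition U0 : Type := L2 [the {measure set _ -> \bar R} of mu0pi].
HB.instance Definition _ := NormedModule.on U0.

Definition U0fun (f : U0) : R -> R := L2fun f.
Coercion U0fun : U0 >-> Funclass.

(* L^2(0, pi; C), a complex function being the pair of its real and imaginary
   parts.  The topology is that of the library's product of normed modules;
   the library's norm on pairs is the maximum, the equivalent Hilbert norm is
   Hnorm below. *)
Definition H0 : Type := (U0 * U0)%type.
HB.instance Definition _ := NormedModule.on H0.

End interval.
Section function_spaces.
Variable R : realType.
Local Notation mu := (@mu0pi R).
Local Notation U0 := (U0 R).
Local Notation H0 := (H0 R).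
Implicit Types (f g h : U0) (z w : H0).

Definition inner f g : R := \int[mu]_x (f x * g x).

Definition Hnorm z : R := Num.sqrt (`|z.1| ^+ 2 + `|z.2| ^+ 2).

(* multiplication by the imaginary unit *)
Definition imul z : H0 := (- z.2, z.1).

Definition realpart_embed f : H0 := (f, 0).

Definition sine (k : nat) (x : R) : R := Num.sqrt (2 / pi) * sin (k.+1%:R * x).

Lemma sine_Lfun k : sine k \in Lfun mu 2%:E.
Proof.
have sE : sine k = *%R (Num.sqrt (2 / pi)) \o (sin \o *%R k.+1%:R) by [].
have ms : measurable_fun setT (sine k : measurableTypeR R -> R).
  apply: continuous_measurable_fun => x; rewrite sE.
  apply: continuous_comp; last exact: mulrl_continuous.
  by apply: continuous_comp; [exact: mulrl_continuous|exact: continuous_sin].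
apply: (@bounded_Lfun2 _ _ _ mu _ (Num.sqrt (2 / pi)) ms) => x.
rewrite normrM ger0_norm ?sqrtr_ge0// ler_piMr ?sqrtr_ge0//.
by rewrite ler_norml sin_geN1 sin_le1.
Qed.

(* Indexed from 0: e k is the eigenfunction for the frequency k + 1. *)
Definition e (k : nat) : U0 := L2class (Lfun_Sub (le1_2 R) (sine_Lfun k)).

Definition test_fun (phi : R -> R) : Prop :=
  (forall n x, derivable (derive1n n phi) x 1) /\
  exists a b : R, [/\ 0 < a, b < pi & forall x, x \notin `[a, b] -> phi x = 0].

Definition weak_deriv f g : Prop := forall phi, test_fun phi ->
  \int[mu]_x (f x * derive1 phi x) = - \int[mu]_x (g x * phi x).

Definition inH1 : set (U0) := [set f | exists g, weak_deriv f g].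

Definition wderiv f : U0 := xget 0 [set g | weak_deriv f g].

Definition H1norm f : R := Num.sqrt (`|f| ^+ 2 + `|wderiv f| ^+ 2).

(* The boundary values are those of the continuous representative. *)
Definition inH10 : set (U0) := [set f | inH1 f /\
  exists c : R -> R, [/\ {within `[0, pi], continuous c}, c 0 = 0, c pi = 0
    & (f : R -> R) = c %[ae mu] ]].

Definition inH10C : set (H0) := [set z | inH10 z.1 /\ inH10 z.2].

(* The graph of the Dirichlet Laplacian, with domain H^2 /\ H^1_0. *)
Definition laplacian f h : Prop :=
  inH10 f /\ exists2 g, weak_deriv f g & weak_deriv g h.

Definition laplacianC z w : Prop := laplacian z.1 w.1 /\ laplacian z.2 w.2.

End function_spaces.

Section operators.
Variable R : realType.

Definition bounded_op (V W : normedModType R) (A : V -> W) : Prop :=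
  linear A /\ continuous A.

Definition nonneg_sym_op (Q : U0 R -> U0 R) : Prop :=
  [/\ bounded_op Q, forall f g, inner (Q f) g = inner f (Q g)
    & forall f, 0 <= inner (Q f) f].

Definition sqrt_op (Qhalf Q : U0 R -> U0 R) : Prop :=
  nonneg_sym_op Qhalf /\ forall f, Qhalf (Qhalf f) = Q f.

(* The sum of squares does not depend on the orthonormal basis. *)
Definition hilbert_schmidt_U1 (A : U0 R -> U0 R) : Prop :=
  [/\ linear A, forall f, inH1 (A f),
      exists C : R, forall f, H1norm (A f) <= C * `|f|
    & (\sum_(k <oo) (H1norm (A (e R k)) ^+ 2)%:E < +oo)%E].

Definition hs_norm2 (A : U0 R -> H0 R) : \bar R :=
  \sum_(k <oo) (Hnorm (A (e R k)) ^+ 2)%:E.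

Definition complexify (A : U0 R -> U0 R) (z : H0 R) : H0 R := (A z.1, A z.2).

Definition pseudo_inverse (A : H0 R -> H0 R) (x : H0 R) : H0 R :=
  xget 0 [set z | A z = x /\ forall z', A z' = x -> Hnorm z <= Hnorm z'].

Definition C0_group (V : normedModType R) (G : R -> V -> V) : Prop :=
  [/\ forall t, bounded_op (G t), forall x, G 0 x = x,
      forall s t x, G (s + t) x = G s (G t x)
    & forall x, continuous (G ^~ x)].

Definition generator (V : normedModType R) (G : R -> V -> V) (x y : V) : Prop :=
  (fun h : R => h^-1 *: (G h x - x)) @ 0^' --> y.

(* S t = exp (i t Delta): the group generated by i times the Dirichlet Laplacian. *)
Definition schrodinger_group (S : R -> H0 R -> H0 R) : Prop :=
  C0_group S /\ forall x y,
    generator S x y <-> exists2 w, laplacianC x w & y = imul w.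

Definition rate (alpha : R) (Qhalf : U0 R -> U0 R) (x : H0 R) : \bar R :=
  if `[< range (complexify Qhalf) x >] then
    (alpha ^- 2 * Hnorm (pseudo_inverse (complexify Qhalf) x) ^+ 2)%:E
  else +oo%E.

End operators.

Section probability.
Context d (Omega : measurableType d) (R : realType).
Variable P : probability Omega R.

Definition random_element (V : normedModType R) (X : Omega -> V) : Prop :=
  measurable_fun setT (X : Omega -> g_sigma_algebraType (@open V)).

Definition mean_square (X : Omega -> R) : \bar R :=
  (\int[P]_w (X w ^+ 2)%:E)%E.

Definition is_sub_sigma_algebra (G : set (set Omega)) : Prop :=
  sigma_algebra setT G /\ G `<=` measurable.

Definition usual_filtration (F : R -> set (set Omega)) : Prop :=
  [/\ measure_is_complete P,
      forall t, 0 <= t -> is_sub_sigma_algebra (F t),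
      forall s t, 0 <= s -> s <= t -> F s `<=` F t,
      forall t, 0 <= t -> F t = \bigcap_(s in [set s | t < s]) F s
    & forall A, P.-negligible A -> F 0 A].

Definition incr (b : R -> Omega -> R) (s t : R) (w : Omega) : R := b t w - b s w.

Definition brownian (F : R -> set (set Omega)) (b : R -> Omega -> R) : Prop :=
  [/\ {ae P, forall w, b 0 w = 0},
      {ae P, forall w, {within `[0, +oo[, continuous (b ^~ w)}},
      forall t B, 0 <= t -> measurable B -> F t (b t @^-1` B),
      forall s t B, 0 <= s -> s < t -> measurable B ->
        P (incr b s t @^-1` B) =
        normal_prob 0 (Num.sqrt (t - s)) B
    & forall s t A B, 0 <= s -> s < t -> F s A -> measurable B ->
        P (A `&` incr b s t @^-1` B) =
        (P A * P (incr b s t @^-1` B))%E].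

Definition sigma_process (b : R -> Omega -> R) : set (set Omega) :=
  <<s [set A | exists t B, [/\ 0 <= t, measurable B & A = b t @^-1` B]] >>.

Definition independent_processes (b : nat -> R -> Omega -> R) : Prop :=
  forall (J : {fset nat}) (A : nat -> set Omega),
    (forall k, k \in J -> sigma_process (b k) (A k)) ->
    P (\bigcap_(k in [set` J]) A k) = (\prod_(k <- J) P (A k))%E.

(* W t = \sum_k sqrt (eta k) * b k t * e k, in L^2(Omega; U^0). *)
Definition wiener_process (F : R -> set (set Omega)) (eta : nat -> R)
    (b : nat -> R -> Omega -> R) (W : R -> Omega -> U0 R) : Prop :=
  [/\ forall k, brownian F (b k),
      independent_processes b,
      forall t, 0 <= t -> random_element (W t),
      {ae P, forall w, {within `[0, +oo[, continuous (W ^~ w)}}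
    & forall t, 0 <= t ->
      mean_square (fun w =>
        `| \sum_(k < n) (Num.sqrt (eta k) * b k t w) *: e R k - W t w |)
        @[n --> \oo] --> 0%E].

(* The deterministic step integrand taking the value A j on (s_j, s_(j+1)]. *)
Definition step_integrand (t : R) (s : seq R) (A : nat -> U0 R -> H0 R) : Prop :=
  [/\ sorted <=%R s, all (fun r => 0 <= r <= t) s & forall j, bounded_op (A j)].

Definition step_value (s : seq R) (A : nat -> U0 R -> H0 R) (r : R) (v : U0 R) :
    H0 R :=
  \sum_(j < (size s).-1) (\1_(`]s`_j, s`_j.+1]%classic) r : R) *: A j v.

Definition step_integral (s : seq R) (A : nat -> U0 R -> H0 R)
    (W : R -> Omega -> U0 R) (w : Omega) : H0 R :=
  \sum_(j < (size s).-1) A j (W s`_j.+1 w - W s`_j w).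

(* Y = \int_0^t Phi dW for a deterministic operator-valued Phi: Y is the limit
   in L^2(Omega; H^0) of the integrals of step integrands which approximate Phi
   for the norm of L^2(0, t; L_2(Q^(1/2) U^0; H^0)). *)
Definition stochastic_integral (Qhalf : U0 R -> U0 R) (W : R -> Omega -> U0 R)
    (t : R) (Phi : R -> U0 R -> H0 R) (Y : Omega -> H0 R) : Prop :=
  random_element Y /\
  exists (s : nat -> seq R) (A : nat -> nat -> U0 R -> H0 R),
    [/\ forall n, step_integrand t (s n) (A n),
        (\int[lebesgue_measure]_(r in `[0%R, t])
          hs_norm2 (fun v => step_value (s n) (A n) r (Qhalf v) - Phi r (Qhalf v))%R)%E
          @[n --> \oo] --> 0%E
      & mean_square (fun w => Hnorm (step_integral (s n) (A n) W w - Y w))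
          @[n --> \oo] --> 0%E].

Definition mild_solution (alpha : R) (Qhalf : U0 R -> U0 R)
    (S : R -> H0 R -> H0 R) (W : R -> Omega -> U0 R) (u0 : H0 R)
    (u : R -> Omega -> H0 R) : Prop :=
  forall t, 0 <= t -> random_element (u t) /\
    exists2 Y, stochastic_integral Qhalf W t
                 (fun s v => S (t - s) (realpart_embed v)) Y
      & {ae P, forall w, u t w = S t u0 + alpha *: imul (Y w)}.

Definition good_rate_function (X : topologicalType) (I : X -> \bar R) : Prop :=
  [/\ forall x, (0 <= I x)%E, lower_semicontinuous I
    & forall a : R, 0 <= a -> compact [set x | (I x <= a%:E)%E]].

Definition satisfies_LDP (X : topologicalType) (Z : R -> Omega -> X)
    (I : X -> \bar R) : Prop :=
  (forall G, open G ->
    (- ereal_inf (I @` G) <=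
     limf_einf (fun T : R => (T^-1)%:E * lne (P (Z T @^-1` G))) (pinfty_nbhs R))%E)
  /\
  (forall C, closed C ->
    (limf_esup (fun T : R => (T^-1)%:E * lne (P (Z T @^-1` C))) (pinfty_nbhs R)
     <= - ereal_inf (I @` C))%E).

End probability.

(* Main.v *)
(* Over the reals, H^0 has the orthonormal basis formed by the e_k and the
   i e_k.  S(t) rotates the plane of e_k and i e_k by the angle - (k + 1)^2 t,
   and u(T) - S(T) u_0 is an L^2-limit of linear combinations of Brownian
   increments.  Hence <z, u(T)> is Gaussian, and as the rotations average out
   with a bounded error,
     E exp <z, u(T)> = exp (<z, S(T) u_0> + alpha^2 T / 4 <Q z, z> + w)
   with |w| <= alpha^2 / 2 <Q z, z> for every T.  The rate function is the
   convex conjugate of Lam z = alpha^2 / 4 <Q z, z>.  The upper bound follows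
   from Chernoff's inequality on half-spaces together with exponential
   tightness on compact ellipsoids; the lower bound follows from a change of
   measure by exp <xi, u(T)>, where xi is a finite combination of basis vectors
   such that the gradient of Lam at xi is close to the given point. *)
Require Import Defs.
From HB Require Import structures.
From mathcomp Require Import all_boot all_order all_algebra finmap ring lra.
From mathcomp Require Import all_classical all_reals all_analysis.
From mathcomp Require Import measurable_realfun.

Set Implicit Arguments.
Unset Strict Implicit.
Unset Printing Implicit Defensive.

Import Order.TTheory GRing.Theory Num.Theory.
Import numFieldNormedType.Exports.

Local Open Scope classical_set_scope.
Local Open Scope ring_scope.

(** * The space L^2(0, pi) *)

Section inner_product.
Variable R : realType.
Local Notation mu := (@mu0pi R).
Implicit Types (f g h : U0 R).

Lemma measurable_U0 f : measurable_fun setT (f : measurableTypeR R -> R).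
Proof. by have := LfunP (repr f); rewrite inE => /andP[/[!inE]]. Qed.

Lemma Lfun_U0 f : (f : R -> R) \in Lfun mu 2%:E.
Proof. exact: (LfunP (repr f)). Qed.

Lemma integrable_mulU0 f g : mu.-integrable setT (EFin \o (fun x => f x * g x)).
Proof. apply/Lfun1_integrable; apply: Lfun2_mul_Lfun1; exact: Lfun_U0. Qed.

Lemma U0addE f g : ae_eq mu setT (f + g : U0 R) (fun x => f x + g x).
Proof.
rewrite -[X in ae_eq _ _ X _]/(L2fun _).
rewrite -{1}[f]L2funK -{1}[g]L2funK -L2classD.
exact: L2class_fun.
Qed.

Lemma U0scaleE (a : R) f : ae_eq mu setT (a *: f : U0 R) (fun x => a * f x).
Proof.
rewrite -{1}[f]L2funK -[a *: _]/(L2scale a _) -L2classZ.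
exact: L2class_fun.
Qed.

Lemma eq_ae_Rintegral (f g : R -> R) :
  measurable_fun setT (f : measurableTypeR R -> R) ->
  measurable_fun setT (g : measurableTypeR R -> R) ->
  ae_eq mu setT f g -> \int[mu]_x f x = \int[mu]_x g x.
Proof.
move=> mf mg fg; rewrite /Rintegral; congr fine.
apply: ae_eq_integral => //; [exact/measurable_EFinP|exact/measurable_EFinP|].
by apply: filterS fg => x /(_ I)/= fgx _; rewrite fgx.
Qed.

Lemma innerC f g : inner f g = inner g f.
Proof. by apply: eq_Rintegral => x _; rewrite mulrC. Qed.

Lemma measurable_mulU0 f g :
  measurable_fun setT ((fun x => f x * g x) : measurableTypeR R -> R).
Proof. by apply: measurable_funM; exact: measurable_U0. Qed.

Lemma innerDl f g h : inner (f + g) h = inner f h + inner g h.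
Proof.
rewrite /inner -RintegralD //; try exact: integrable_mulU0.
apply: eq_ae_Rintegral; first exact: measurable_mulU0.
  by apply: measurable_funD; exact: measurable_mulU0.
by apply: filterS (U0addE f g) => x /(_ I)/= -> _; rewrite mulrDl.
Qed.

Lemma innerZl a f h : inner (a *: f) h = a * inner f h.
Proof.
rewrite /inner -RintegralZl //; try exact: integrable_mulU0.
apply: eq_ae_Rintegral; first exact: measurable_mulU0.
  by apply: measurable_funM => //; exact: measurable_mulU0.
by apply: filterS (U0scaleE a f) => x /(_ I)/= -> _; rewrite mulrA.
Qed.

Lemma norm_inner f : `|f| ^+ 2 = inner f f.
Proof.
apply: EFin_inj; rewrite (_ : `|f| = L2norm f) // /inner /Rintegral fineK; last first.
  exact: integrable_fin_num (integrable_mulU0 f f).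
rewrite -powR_mulrn ?fine_ge0 ?Lnorm_ge0 // -poweR_EFin.
rewrite /L2norm (finite_norm_fine (repr f : LfunType mu (le1_2 R))) poweR_Lnorm //.
apply: eq_integral => x _ /=.
by rewrite /= powR_mulrn // real_normK ?num_real // expr2.
Qed.

End inner_product.

Lemma limn_einf_le (R : realType) (u : (\bar R)^nat) (c : \bar R) (N : nat) :
  (forall n, (N <= n)%N -> u n <= c)%E -> (limn_einf u <= c)%E.
Proof.
move=> uc; rewrite limn_einf_lim; apply: lime_le; first exact: is_cvg_einfs.
apply: nearW => n; apply: (@le_trans _ _ (u (maxn n N))); last first.
  by apply: uc; exact: leq_maxr.
by apply: ereal_inf_lbound; exists (maxn n N) => //=; exact: leq_maxl.
Qed.

Lemma ae_fatou d (T : measurableType d) (R : realType)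
    (nu : {measure set T -> \bar R}) (f_ : nat -> T -> \bar R) (f : T -> \bar R)
    (c : \bar R) (N : nat) :
  (forall n, measurable_fun setT (f_ n)) -> (forall n x, 0 <= f_ n x)%E ->
  measurable_fun setT f -> (forall x, 0 <= f x)%E ->
  {ae nu, forall x, f_ n x @[n --> \oo] --> f x} ->
  (forall n, (N <= n)%N -> \int[nu]_x f_ n x <= c)%E ->
  (\int[nu]_x f x <= c)%E.
Proof.
move=> mf_ f0_ mf f0 f_f f_c.
have -> : (\int[nu]_x f x = \int[nu]_x limn_einf (f_ ^~ x))%E.
  apply: ae_eq_integral => //.
    under eq_fun => x do rewrite -[limn_einf _]oppeK -limn_esupN.
    apply: measurableT_comp => //.
    apply: (measurable_fun_limn_esup (f := fun n x => - f_ n x)%E) => n.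
    exact: measurableT_comp.
  by apply: filterS f_f => x f_fx _; rewrite (cvg_limn_einf_sup f_fx).1.
apply: le_trans (limn_einf_le f_c).
by apply: fatou => // n x _; exact: f0_.
Qed.

Lemma normr_lee_limn_ae d (T : measurableType d) (R : realType)
    (nu : {measure set T -> \bar R}) (D : nat -> T -> R) :
  (forall n, measurable_fun setT (D n)) ->
  (\sum_(n <oo) \int[nu]_x `|D n x|%:E < +oo)%E ->
  {ae nu, forall x, cvgn (fun n => \sum_(j < n) D j x)}.
Proof.
move=> mD Dfin.
have : nu.-integrable setT (fun x => \sum_(n <oo) `|D n x|%:E)%E.
  apply/integrableP; split.
    apply: ge0_emeasurable_sum => // n _; apply/measurable_EFinP.
    exact: measurableT_comp.
  under eq_integral => x _.
    rewrite gee0_abs; last by apply: nneseries_ge0 => *; rewrite lee_fin.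
    over.
  rewrite integral_nneseries // => n; apply/measurable_EFinP.
  exact: measurableT_comp.
move/(integrable_ae measurableT); apply: filterS => x /(_ I) xfin.
have /nnseries_is_cvg : forall i, 0 <= `|D i x| by [].
move=> /(_ _)/wrap[|]; first by rewrite ltey_eq xfin.
move=> /normed_cvg; rewrite /series /=.
by under eq_fun do rewrite big_mkord.
Qed.

Section hilbert.
Variable R : realType.
Local Notation mu := (@mu0pi R).
Implicit Types (f g h : U0 R).

Lemma innerDr f g h : inner h (f + g) = inner h f + inner h g.
Proof. by rewrite innerC innerDl !(innerC h). Qed.

Lemma innerZr a f h : inner h (a *: f) = a * inner h f.
Proof. by rewrite innerC innerZl (innerC h). Qed.

Lemma inner0l f : inner 0 f = 0.
Proof. by rewrite -[0 in LHS](scale0r 0) innerZl mul0r. Qed.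

Lemma inner0r f : inner f 0 = 0.
Proof. by rewrite innerC inner0l. Qed.

Lemma innerNl f g : inner (- f) g = - inner f g.
Proof. by rewrite -scaleN1r innerZl mulN1r. Qed.

Lemma innerNr f g : inner f (- g) = - inner f g.
Proof. by rewrite innerC innerNl innerC. Qed.

Lemma innerBl f g h : inner (f - g) h = inner f h - inner g h.
Proof. by rewrite innerDl innerNl. Qed.

Lemma innerBr f g h : inner h (f - g) = inner h f - inner h g.
Proof. by rewrite innerDr innerNr. Qed.

Lemma cauchy_schwarz f g : `|inner f g| <= `|f| * `|g|.
Proof.
have [->|g0] := eqVneq g 0; first by rewrite inner0r normr0 normr0 mulr0.
have gg : 0 < `|g| by rewrite normr_gt0.
rewrite -(@ler_pXn2r _ 2) ?nnegrE // ?mulr_ge0 // real_normK ?num_real //.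
have := sqr_ge0 `|(`|g| ^+ 2) *: f - inner f g *: g|.
rewrite (norm_inner (_ - _)) innerBl !innerBr !innerZl !innerZr -!norm_inner (innerC g f).
move=> H.
have {H} : 0 <= `|g| ^+ 2 * (`|f| ^+ 2 * `|g| ^+ 2 - inner f g ^+ 2).
  by apply: le_trans H _; rewrite le_eqVlt; apply/orP; left; apply/eqP; ring.
by rewrite pmulr_rge0 ?exprn_gt0 // subr_ge0 exprMn.
Qed.

Lemma inner_continuousl g : continuous (fun f => inner f g).
Proof.
move=> f; apply/(@cvgrPdist_le _ _ _ (nbhs f) (nbhs_filter f)) => e e0.
have d0 : 0 < e / (`|g| + 1) by rewrite divr_gt0 // ltr_wpDl.
have /(@cvgrPdist_le _ _ _ (nbhs f)
  (nbhs_filter f))/(_ _ d0) : (fun h : U0 R => h) @ f --> f by exact: cvg_id.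
apply: filterS => h /= fh; rewrite -innerBl; apply: le_trans (cauchy_schwarz _ _) _.
apply: (@le_trans _ _ (`|f - h| * (`|g| + 1))).
  by rewrite ler_wpM2l // lerDl.
by rewrite -ler_pdivlMr ?ltr_wpDl.
Qed.

Lemma EFin_sqr_norm f : ((`|f| ^+ 2)%:E = \int[mu]_x (f x ^+ 2)%:E)%E.
Proof.
rewrite norm_inner /inner /Rintegral fineK.
  by apply: eq_integral => x _; rewrite expr2.
exact: integrable_fin_num (integrable_mulU0 f f).
Qed.

Lemma Lfun2P (f : R -> R) :
  measurable_fun setT (f : measurableTypeR R -> R) ->
  (\int[mu]_x (f x ^+ 2)%:E < +oo)%E -> f \in Lfun mu 2%:E.
Proof.
move=> mf ffin; rewrite inE; apply/andP; split; rewrite inE //=.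
rewrite /finite_norm unlock poweR_lty // (le_lt_trans _ ffin) //.
rewrite le_eqVlt; apply/orP; left; apply/eqP; apply: eq_integral => x _ /=.
by rewrite powR_mulrn // real_normK ?num_real.
Qed.

Lemma integral_abs_U0 : exists2 C, 0 <= C &
  forall f, (\int[mu]_x `|f x|%:E <= (C * `|f|)%:E)%E.
Proof.
have oneP : cst 1 \in Lfun mu 2%:E.
  by apply: (@bounded_Lfun2 _ _ _ mu _ 1) => // x; rewrite normr1.
exists (fine 'N[mu]_2%:E[EFin \o cst 1%R]%E); first by rewrite fine_ge0 ?Lnorm_ge0.
move=> f; have := @hoelder _ _ _ mu (f : R -> R) (cst 1) 2 2 (measurable_U0 f).
have -> : (f : R -> R) \* cst 1 = f by apply/funext => x /=; rewrite mulr1.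
rewrite Lnorm1 => /(_ _ _ _ _)/wrap[//|//|//|//|]; first by rewrite [RHS]splitr !div1r.
move=> H; apply: le_trans H _.
rewrite EFinM muleC.
rewrite (finite_norm_fine (Lfun_Sub (le1_2 R) oneP)).
by rewrite (finite_norm_fine (repr f : LfunType mu (le1_2 R))).
Qed.

End hilbert.

Section completeness.
Variable R : realType.
Local Notation mu := (@mu0pi R).
Implicit Types (f g h : U0 R).

Lemma U0sumE (D : nat -> U0 R) n :
  ae_eq mu setT (\sum_(j < n) D j : U0 R) (fun x => \sum_(j < n) D j x).
Proof.
elim: n => [|n IHn].
  rewrite big_ord0 -(scale0r 0); apply: filterS (U0scaleE 0 0) => x /(_ I)/= -> _.
  by rewrite big_ord0 mul0r.
rewrite big_ord_recr /=.
apply: filterS2 IHn (U0addE (\sum_(j < n) D j) (D n)) => x /(_ I)/= H /(_ I)/= -> _.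
by rewrite big_ord_recr /= H.
Qed.

Lemma measurable_sumU0 (D : nat -> U0 R) n :
  measurable_fun setT ((fun x => \sum_(j < n) D j x) : measurableTypeR R -> R).
Proof. by apply: measurable_sum => j; exact: measurable_U0. Qed.

Lemma U0subE f g : ae_eq mu setT (f - g : U0 R) (fun x => f x - g x).
Proof.
apply: filterS2 (U0addE f (- g)) (U0scaleE (-1) g) => x /(_ I)/= -> /(_ I)/= H _.
by rewrite -scaleN1r H mulN1r.
Qed.

Lemma geometric_half_sum n m : (n <= m)%N ->
  \sum_(n <= j < m) (2^-1 : R) ^+ j <= 2 * 2^-1 ^+ n.
Proof.
move=> nm; rewrite -(subnKC nm); elim: (m - n)%N => [|k IH] /=.
  by rewrite addn0 big_geq // mulr_ge0 // exprn_ge0 // invr_ge0.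
suff : \sum_(n <= j < n + k.+1) (2^-1 : R) ^+ j <= 2 * 2^-1 ^+ n - 2 * 2^-1 ^+ (n + k.+1).
  move=> /le_trans; apply; rewrite lerBlDr lerDl mulr_ge0 // exprn_ge0 // invr_ge0 //.
elim: k.+1 => [|{IH}k IH]; first by rewrite addn0 big_geq // subrr.
rewrite addnS big_nat_recr ?leq_addr //=; apply: le_trans (lerD IH (lexx _)) _.
rewrite exprS; lra.
Qed.

Lemma fast_cauchy_cvg (D : nat -> U0 R) :
  (forall j, `|D j| <= 2^-1 ^+ j) ->
  exists f, forall n, `|f - \sum_(j < n) D j| <= 2 * 2^-1 ^+ n.
Proof.
move=> Dle.
have tail n m : (n <= m)%N -> `|\sum_(j < m) D j - \sum_(j < n) D j| <= 2 * 2^-1 ^+ n.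
  move=> nm; rewrite -!(big_mkord xpredT) (big_cat_nat (leq0n n) nm) //= addrAC subrr add0r.
  apply: le_trans (ler_norm_sum _ _ _) _.
  by apply: le_trans (geometric_half_sum nm); apply: ler_sum => j _; exact: Dle.
have [C C0 CP] := @integral_abs_U0 R.
have Dcvg : {ae mu, forall x, cvgn (fun n => \sum_(j < n) D j x)}.
  apply: (@normr_lee_limn_ae _ _ _ mu (fun n => (D n : measurableTypeR R -> R))) => [n|];
    first exact: measurable_U0.
  apply: (@le_lt_trans _ _ (\sum_(n <oo) (C * 2^-1 ^+ n)%:E)%E).
    apply: lee_nneseries => [n _ _|n _].
      by apply: integral_ge0 => x _; rewrite lee_fin.
    by apply: le_trans (CP _) _; rewrite lee_fin ler_wpM2l.
  apply: (@le_lt_trans _ _ (C * 2)%:E); last exact: ltry.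
  apply: lime_le; first by apply: is_cvg_nneseries => n _ _;
    rewrite lee_fin mulr_ge0 // exprn_ge0 // invr_ge0.
  apply: nearW => n; rewrite sumEFin lee_fin -mulr_sumr ler_wpM2l //.
  by have := @geometric_half_sum 0 n (leq0n n); rewrite expr0 mulr1.
pose S n x := \sum_(j < n) D j x.
have mS n : measurable_fun setT (S n : measurableTypeR R -> R).
  exact: measurable_sumU0.
pose F (x : measurableTypeR R) : R := fine (limn_esup (fun n => (S n x)%:E)).
have mF : measurable_fun setT F.
  apply: measurableT_comp => //.
  apply: (measurable_fun_limn_esup (f := fun n x => (S n x)%:E)) => n.
  by apply/measurable_EFinP; exact: mS.
have FS : {ae mu, forall x, S n x @[n --> \oo] --> F x}.
  move: Dcvg; apply: (@filterS _ (almost_everywhere mu)) => x Sx.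
  have SE : (S n x)%:E @[n --> \oo] --> (limn (S ^~ x))%:E by apply: cvg_EFin => //; exact: nearW.
  by rewrite /F (cvg_limn_einf_sup SE).2.
have FSn n : (\int[mu]_x ((F x - S n x) ^+ 2)%:E <= ((2 * 2^-1 ^+ n) ^+ 2)%:E)%E.
  apply: (@ae_fatou _ _ _ mu (fun m x => ((S m x - S n x) ^+ 2)%:E) _ _ n).
  - move=> m; apply/measurable_EFinP.
    by apply: measurable_funX; exact: measurable_funB.
  - by move=> m x; rewrite lee_fin sqr_ge0.
  - by apply/measurable_EFinP; apply: measurable_funX; exact: measurable_funB.
  - by move=> x; rewrite lee_fin sqr_ge0.
  - move: FS; apply: (@filterS _ (almost_everywhere mu)) => x Fx; apply: cvg_EFin;
    first exact: nearW.
    have H : S m x - S n x @[m --> \oo] --> F x - S n x.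
      by apply: cvgB => //; exact: cvg_cst.
    exact: (cvgM H H).
  move=> m nm; rewrite -[leLHS](_ : (`|\sum_(j < m) D j - \sum_(j < n) D j| ^+ 2)%:E = _)%E.
    by rewrite lee_fin lerXn2r ?nnegrE ?mulr_ge0 ?exprn_ge0 ?invr_ge0 //; exact: tail.
  rewrite EFin_sqr_norm; apply: ae_eq_integral => //.
  - by apply/measurable_EFinP; apply: measurable_funX; exact: measurable_U0.
  - by apply/measurable_EFinP; apply: measurable_funX; exact: measurable_funB.
  apply: filterS3 (U0sumE D m) (U0sumE D n) (U0subE (\sum_(j < m) D j) (\sum_(j < n) D j)).
  by move=> x /(_ I)/= -> /(_ I)/= -> /(_ I)/= -> _.
have FL : F \in Lfun mu 2%:E.
  apply: Lfun2P => //; apply: le_lt_trans (ltry ((2 * 2^-1 ^+ 0) ^+ 2)).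
  apply: le_trans (FSn 0%N); rewrite le_eqVlt; apply/orP; left; apply/eqP.
  by apply: eq_integral => x _; rewrite /S big_ord0 subr0.
pose f : U0 R := L2class (Lfun_Sub (le1_2 R) FL).
exists f => n.
rewrite -(@ler_pXn2r _ 2) ?nnegrE ?mulr_ge0 ?exprn_ge0 ?invr_ge0 //.
rewrite -lee_fin EFin_sqr_norm; apply: le_trans (FSn n).
rewrite le_eqVlt; apply/orP; left; apply/eqP.
apply: ae_eq_integral => //.
- by apply/measurable_EFinP; apply: measurable_funX; exact: measurable_U0.
- by apply/measurable_EFinP; apply: measurable_funX; exact: measurable_funB.
have fF : ae_eq mu setT (f : R -> R) F by exact: L2class_fun.
apply: filterS3 fF (U0sumE D n) (U0subE f (\sum_(j < n) D j)).
by move=> x /(_ I)/= fx /(_ I)/= Sx /(_ I)/= -> _; rewrite fx Sx.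
Qed.

End completeness.

Section transfer.
Local Open Scope ereal_scope.
Context d d' (T : measurableType d) (T' : measurableType d') (R : realType).
Variables (P : {measure set T -> \bar R}) (nu : {measure set T' -> \bar R}).

Import HBNNSimple.

Lemma ge0_integral_transfer (X : T -> T') (h : T -> R) (f : T' -> \bar R) :
  measurable_fun setT X -> measurable_fun setT h -> (forall w, 0 <= h w)%R ->
  (forall B, measurable B -> \int[P]_w (\1_B (X w) * h w)%:E = nu B) ->
  measurable_fun setT f -> (forall x, 0 <= f x) ->
  \int[P]_w (f (X w) * (h w)%:E) = \int[nu]_x f x.
Proof.
move=> mX mh h0 hnu mf f0.
pose f_ := nnsfun_approx measurableT mf.
have f_f x : (f_ n x)%:E @[n --> \oo] --> f x.
  by apply: cvg_nnsfun_approx => // y _; exact: f0.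
have f_nd x : {homo (fun n => (f_ n x)%:E) : m n / (m <= n)%N >-> m <= n}.
  by move=> m n mn; rewrite lee_fin; exact/lefP/nd_nnsfun_approx.
transitivity (limn (fun n => \int[P]_w ((f_ n (X w))%:E * (h w)%:E))).
  rewrite -monotone_convergence //=.
  - apply: eq_integral => w _; apply/esym/cvg_lim => //.
    by apply: cvgeMr => //.
  - move=> n; apply: emeasurable_funM; last exact/measurable_EFinP.
    by apply/measurable_EFinP; exact: measurableT_comp.
  - by move=> n w _; rewrite mule_ge0 // lee_fin.
  - move=> w _ m n mn; apply: lee_wpmul2r; first by rewrite lee_fin.
    exact: f_nd.
transitivity (limn (fun n => \int[nu]_x (f_ n x)%:E)); last first.
  rewrite -monotone_convergence //=.
  - by apply: eq_integral => x _; apply/cvg_lim.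
  - by move=> n; exact/measurable_EFinP.
  - by move=> n x _; rewrite lee_fin.
congr (limn _); apply/funext => n.
have mf1 r : measurable (f_ n @^-1` [set r]).
  by rewrite -[_ @^-1` _]setTI; exact: (measurable_funP (f_ n)).
have m1X r : measurable_fun setT (fun w => \1_(f_ n @^-1` [set r]) (X w) : R).
  apply: (@measurableT_comp _ _ _ _ _ _ (\1_(f_ n @^-1` [set r]) : T' -> R) _ X) => //.
have fE x : (f_ n x)%:E = \sum_(k \in range (f_ n)) (k * \1_(f_ n @^-1` [set k]) x)%:E.
  by rewrite fimfunE -fsumEFin.
under [LHS]eq_integral => w _.
  rewrite fE ge0_mule_fsuml; last by move=> r; exact: nnfun_muleindic_ge0.
  over.
rewrite [LHS]ge0_integral_fsum //; first last.
- by move=> r w _; rewrite mule_ge0 ?lee_fin //; exact: nnfun_muleindic_ge0.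
- move=> r; apply: emeasurable_funM; last exact/measurable_EFinP.
  apply/measurable_EFinP; apply: measurable_funM => //.
under [RHS]eq_integral do rewrite fE.
rewrite [RHS]ge0_integral_fsum //; first last.
- by move=> r x _; exact: nnfun_muleindic_ge0.
- by move=> r; apply/measurable_EFinP; exact/measurable_funM.
apply: eq_fsbigr => r; rewrite inE => -[y _ <-].
rewrite integralZl_indic_nnsfun // integral_indic // setIT -hnu //.
rewrite -ge0_integralZl //=.
- by apply: eq_integral => w _; rewrite -!EFinM mulrA.
- by apply/measurable_EFinP; exact: measurable_funM.
- by move=> w _; rewrite lee_fin mulr_ge0.
- by rewrite lee_fin.
Qed.

End transfer.

Section restricted_measure.
Context (R : realType).
Local Notation mu := (@mu0pi R).
Local Notation leb := (@lebesgue_measure R).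

Lemma ge0_integral_mu0pi (f : R -> \bar R) :
  measurable_fun setT f -> (forall x, 0 <= f x)%E ->
  (\int[mu]_x f x = \int[leb]_(x in `]0%R, (pi : R)[) f x)%E.
Proof.
move=> mf f0.
have := @ge0_integral_transfer _ _ _ _ R leb mu (@idfun R) (\1_(`]0%R, (pi : R)[ : set R)) f.
move=> <- //.
- rewrite [RHS]integral_mkcond; apply: eq_integral => x _.
  by rewrite /patch /indic; case: ifPn => _; rewrite ?mule1 ?mule0.
- exact: measurable_id.
- move=> B mB; transitivity (\int[leb]_w (\1_(B `&` `]0%R, (pi : R)[) w)%:E)%E.
    by apply: eq_integral => x _; rewrite /indic in_setI -natrM mulnb.
  by rewrite integral_indic ?setIT //; apply: measurableI.
Qed.

End restricted_measure.

Section sines.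
Variable R : realType.
Local Notation mu := (@mu0pi R).
Local Notation leb := (@lebesgue_measure R).
Implicit Types (f g h : U0 R).

Lemma integrable_mu0pi (f : measurableTypeR R -> R) :
  measurable_fun setT f -> (exists C, forall x, `|f x| <= C) ->
  mu.-integrable setT (EFin \o f).
Proof.
move=> mf [C fC]; apply: measurable_bounded_integrable => //.
  exact: fin_num_fun_lty.
by exists C; split; rewrite ?num_real // => y Cy x _; exact: le_trans (fC x) (ltW Cy).
Qed.

Lemma Rintegral_mu0pi (f : R -> R) : continuous f ->
  \int[mu]_x f x = \int[leb]_(x in `[0, pi]) f x.
Proof.
move=> cf.
have mf : measurable_fun setT (f : measurableTypeR R -> R) by exact: continuous_measurable_fun.
have mfE : measurable_fun setT (EFin \o f : measurableTypeR R -> \bar R) by exact/measurable_EFinP.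
have fI : leb.-integrable `[0, pi] (EFin \o f).
  apply: continuous_compact_integrable; first exact: segment_compact.
  exact: continuous_subspaceT.
rewrite -Rintegral_itv_obnd_cbnd; last first.
  by apply: integrableS fI => //; exact: subset_itv_oc_cc.
rewrite -Rintegral_itv_bndo_bndc; last first.
  by apply: integrableS fI => //; exact: subset_itv_oo_cc.
rewrite /Rintegral; congr fine; rewrite integralE [in RHS]integralE.
rewrite !ge0_integral_mu0pi //; first exact/measurable_funeneg.
exact/measurable_funepos.
Qed.

Lemma Rintegral_derive (f F : R -> R) : continuous f ->
  (forall x : R, is_derive x 1 F (f x)) ->
  \int[mu]_x f x = F pi - F 0.
Proof.
move=> cf dF; rewrite Rintegral_mu0pi // /Rintegral.
rewrite (@continuous_FTC2 _ f F) //.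
- exact: pi_gt0.
- exact: continuous_subspaceT.
- split.
  + by move=> x _; exact: ex_derive.
  + by apply: cvg_at_right_filter; apply: differentiable_continuous; apply/derivable1_diffP;
    exact: ex_derive.
  + by apply: cvg_at_left_filter; apply: differentiable_continuous; apply/derivable1_diffP;
    exact: ex_derive.
- by move=> x _; rewrite derive1E; exact: derive_val.
Qed.

Lemma sin_natpi n : sin (n%:R * pi : R) = 0.
Proof.
elim: n => [|n IHn]; first by rewrite mul0r sin0.
by rewrite -natr1 mulrDl mul1r sinDpi IHn oppr0.
Qed.

Lemma continuous_cos_scale (a : R) : continuous (fun x : R => cos (a * x)).
Proof.
move=> x; apply: (@continuous_comp _ _ _ ( *%R a) cos); first exact: mulrl_continuous.
exact: continuous_cos.
Qed.

Lemma continuous_sin_scale (a : R) : continuous (fun x : R => sin (a * x)).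
Proof.
move=> x; apply: (@continuous_comp _ _ _ ( *%R a) sin); first exact: mulrl_continuous.
exact: continuous_sin.
Qed.

Lemma is_derive_sin_scale (a x : R) : is_derive x 1 (fun y : R => sin (a * y)) (a * cos (a * x)).
Proof.
apply: is_derive_eq (is_derive1_comp (f := sin) (g := *%R a) _ _) _.
  by rewrite -[a%:A]/(a * 1) mulr1 ?mulNr mulrC.
Qed.

Lemma is_derive_cos_scale (a x : R) : is_derive x 1 (fun y : R => cos (a * y))
  (- (a * sin (a * x))).
Proof.
apply: is_derive_eq (is_derive1_comp (f := cos) (g := *%R a) _ _) _.
  by rewrite -[a%:A]/(a * 1) mulr1 ?mulNr mulrC.
Qed.

Lemma integral_cos_nat n : \int[mu]_x cos (n%:R * x) = (n == 0%N)%:R * pi :> R.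
Proof.
have [->|n0] := eqVneq n 0%N.
  have d (x : R) : is_derive x 1 (@idfun R) (cos (0%:R * x)).
    by rewrite mul0r cos0; exact: is_derive_id.
  by rewrite mul1r (Rintegral_derive (@continuous_cos_scale _) d) /= subr0.
have nR : n%:R != 0 :> R by rewrite pnatr_eq0.
have d (x : R) : is_derive x 1 (fun x => n%:R^-1 * sin (n%:R * x)) (cos (n%:R * x)).
  have := is_deriveZ n%:R^-1 (is_derive_sin_scale n%:R x).
  by move/is_derive_eq; apply; rewrite -[_ *: _]/(_ * _) mulKf.
rewrite mul0r (Rintegral_derive (@continuous_cos_scale _) d).
by rewrite sin_natpi (mulr0 n%:R) sin0 !mulr0 subr0.
Qed.

Lemma sin_mul_sin (x y : R) : sin x * sin y = 2^-1 * (cos (x - y) - cos (x + y)).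
Proof. rewrite cosB cosD; lra. Qed.

Lemma eU0E k : ae_eq mu setT (e R k : R -> R) (sine k).
Proof. exact: L2class_fun. Qed.

Lemma measurable_sine k : measurable_fun setT (@sine R k : measurableTypeR R -> R).
Proof. by have := sine_Lfun R k; rewrite inE => /andP[/[!inE]]. Qed.

Lemma inner_eU0 f k : inner f (e R k) = \int[mu]_x (f x * sine k x).
Proof.
apply: eq_ae_Rintegral; first exact: measurable_mulU0.
  by apply: measurable_funM; [exact: measurable_U0|exact: measurable_sine].
by apply: filterS (eU0E k) => x /(_ I)/= -> _.
Qed.

Lemma inner_ee j k : inner (e R j) (e R k) = (j == k)%:R.
Proof.
rewrite inner_eU0.
rewrite (_ : \int[mu]_x _ = \int[mu]_x (sine j x * sine k x)); last first.
  apply: eq_ae_Rintegral.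
    by apply: measurable_funM; [exact: measurable_U0|exact: measurable_sine].
    by apply: measurable_funM; exact: measurable_sine.
  by apply: filterS (eU0E j) => x /(_ I)/= -> _.
wlog jk : j k / (k <= j)%N.
  move=> H; have [/H//|/ltnW/H] := leqP k j.
  by rewrite eq_sym => <-; apply: eq_Rintegral => x _; rewrite mulrC.
have icos n : mu.-integrable setT (EFin \o (fun x => cos (n%:R * x))).
  apply: integrable_mu0pi.
    by apply: continuous_measurable_fun; exact: continuous_cos_scale.
  by exists 1 => x; rewrite ler_norml cos_geN1 cos_le1.
rewrite (_ : \int[mu]_x _ = \int[mu]_x (pi^-1 * cos ((j - k)%:R * x) - pi^-1 * cos ((j
  + k).+2%:R * x))).
  rewrite RintegralB ?RintegralZl ?integral_cos_nat //=;
    try exact: (integrableZl measurableT _ (icos _)).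
  rewrite mul0r mulr0 subr0 subn_eq0 eqn_leq jk andbT mulrCA mulVf ?mulr1 //.
  by rewrite gt_eqF // pi_gt0.
apply: eq_Rintegral => x _; rewrite /sine mulrACA -expr2 sqr_sqrtr; last first.
  by rewrite divr_ge0 // pi_ge0.
rewrite sin_mul_sin -mulrBl -mulrDl -natrB ?subSS // -natrD addSn addnS.
by rewrite mulrA -mulrBr; congr *%R; rewrite mulrAC divff ?mul1r.
Qed.

Lemma norm_e k : `|e R k| = 1.
Proof.
by apply/eqP; rewrite -(@eqrXn2 _ 2) // norm_inner inner_ee eqxx expr1n.
Qed.

End sines.

(** * Totality of the sines *)

Section bernoulli_steps.
Variable R : realType.

Lemma bernoulli_le (z : R) m : 0 <= z <= 1 -> 1 - m%:R * z <= (1 - z) ^+ m.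
Proof.
move=> /andP[z0 z1]; elim: m => [|m IH]; first by rewrite mul0r subr0 expr0.
rewrite exprS; apply: (@le_trans _ _ ((1 - z) * (1 - m%:R * z))).
  rewrite -natr1; have : 0 <= m%:R * (z * z) by rewrite mulr_ge0 // mulr_ge0.
  by move=> H; rewrite -subr_ge0 (_ : _ - _ = m%:R * (z * z)) //; ring.
by apply: ler_wpM2l => //; rewrite subr_ge0.
Qed.

Lemma bernoulli_ge (z : R) m : 0 <= z <= 1 -> (1 - z) ^+ m * (1 + m%:R * z) <= 1.
Proof.
move=> /andP[z0 z1]; elim: m => [|m IH]; first by rewrite mul0r addr0 expr0 mulr1.
have h0 : 0 <= (1 - z) ^+ m by rewrite exprn_ge0 // subr_ge0.
apply: le_trans IH; rewrite exprSr -mulrA; apply: ler_wpM2l => //.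
rewrite -natr1 -subr_ge0 (_ : _ - _ = (m%:R + 1) * (z * z)); last by ring.
by rewrite mulr_ge0 // ?addr_ge0 // mulr_ge0.
Qed.

(* On [0, 1] the polynomials [(1 - y ^ n) ^ (2 ^ n)] tend boundedly to the
   indicator of [y < 1/2]; for y affine in [cos x] this yields the indicator of
   the interval from [a] to [pi], and no density theorem is needed. *)
Lemma cvg_step_lt (y : R) : 0 <= y < 2^-1 ->
  (1 - y ^+ n) ^+ (2 ^ n)%N @[n --> \oo] --> (1 : R).
Proof.
move=> /andP[y0 y2].
have yn n : 0 <= y ^+ n <= 1.
  by rewrite exprn_ge0 // exprn_ile1 // (le_trans (ltW y2)) // invf_le1 // ler1n.
apply: (@squeeze_cvgr _ _ _ _ (fun n => 1 - (2 * y) ^+ n) (cst 1)).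
- apply: nearW => n; rewrite exprMn -natrX bernoulli_le //=.
  have /andP[a b] := yn n; rewrite exprn_ile1 ?subr_ge0 //.
  by rewrite lerBlDr lerDl.
- rewrite -[X in _ --> X]subr0; apply: cvgB; first exact: cvg_cst.
  by apply: cvg_expr; rewrite ger0_norm; lra.
- exact: cvg_cst.
Qed.

Lemma cvg_step_gt (y : R) : 2^-1 < y <= 1 ->
  (1 - y ^+ n) ^+ (2 ^ n)%N @[n --> \oo] --> (0 : R).
Proof.
move=> /andP[y2 y1].
have y0 : 0 < y by apply: lt_trans y2; rewrite invr_gt0.
have yn n : 0 <= y ^+ n <= 1 by rewrite exprn_ge0 ?exprn_ile1 // ltW.
apply: (@squeeze_cvgr _ _ _ _ (cst 0) (fun n => ((2 * y)^-1) ^+ n)).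
- apply: nearW => n; rewrite /= exprn_ge0 /=; last first.
    by rewrite subr_ge0; case/andP: (yn n).
  rewrite exprVn -[leRHS]mul1r ler_pdivlMr; last by rewrite exprn_gt0 // mulr_gt0.
  apply: le_trans (bernoulli_ge (2 ^ n) (yn n)); apply: ler_wpM2l.
    by rewrite exprn_ge0 // subr_ge0; case/andP: (yn n).
  by rewrite exprMn -natrX lerDr.
- exact: cvg_cst.
- apply: cvg_expr; rewrite ger0_norm ?invr_ge0 ?mulr_ge0 // ?ltW //.
  by rewrite invf_lt1; lra.
Qed.

Lemma step_bounded (y : R) n : 0 <= y <= 1 -> `|(1 - y ^+ n) ^+ (2 ^ n)%N| <= 1.
Proof.
move=> /andP[y0 y1].
have /andP[a b] : 0 <= y ^+ n <= 1 by rewrite exprn_ge0 ?exprn_ile1.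
rewrite ger0_norm ?exprn_ge0 ?subr_ge0 // exprn_ile1 ?subr_ge0 //.
by rewrite lerBlDr lerDl.
Qed.

End bernoulli_steps.

Section totality.
Variable R : realType.
Local Notation mu := (@mu0pi R).
Local Notation leb := (@lebesgue_measure R).
Implicit Types (f g h : U0 R).

Lemma integral_mu0pi (f : R -> \bar R) : measurable_fun setT f ->
  (\int[mu]_x f x = \int[leb]_(x in `]0%R, (pi : R)[) f x)%E.
Proof.
move=> mf; rewrite integralE [in RHS]integralE.
rewrite !ge0_integral_mu0pi //; first exact/measurable_funeneg.
exact/measurable_funepos.
Qed.

Lemma ae_mu0pi (A : R -> Prop) :
  {ae leb, forall x : R, 0 < x < pi -> A x} -> {ae mu, forall x : R, A x}.
Proof.
move=> [N [mN N0 AN]]; exists (N `|` ~` @itv0pi R); split.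
- by apply: measurableU => //; apply: measurableC; exact: measurable_itv0pi.
- rewrite /mu0pi /mfrestr /mrestr /= setIUl setICl setU0.
  apply/eqP; rewrite eq_le measure_ge0 andbT -N0; apply: le_measure.
  + by rewrite inE; apply: measurableI => //; exact: measurable_itv0pi.
  + by rewrite inE.
  + exact: subIsetl.
- move=> x /= nAx; have [xI|xI] := pselect (@itv0pi R x); last by right.
  left; apply: AN => /=; apply: contra_not nAx; apply.
  by move: xI; rewrite /itv0pi /= in_itv.
Qed.

Lemma ae_in_0pi : {ae mu, forall x : R, 0 < x < pi}.
Proof. by apply: ae_mu0pi; apply: aeW => x. Qed.

Lemma integrable_mul_bounded f (phi : R -> R) (C : R) :
  measurable_fun setT (phi : measurableTypeR R -> R) -> (forall x, `|phi x| <= C) ->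
  mu.-integrable setT (EFin \o (fun x => f x * phi x)).
Proof.
move=> mphi phiC; apply/Lfun1_integrable; apply: Lfun2_mul_Lfun1; first exact: Lfun_U0.
exact: (@bounded_Lfun2 _ _ _ mu _ C mphi phiC).
Qed.

Lemma measurable_trig (p : {poly R}) n k :
  measurable_fun setT ((fun x => p.[cos x] * cos x ^+ n * sin (k%:R * x)) : measurableTypeR R -> R).
Proof.
apply: continuous_measurable_fun => x; apply: cvgM; last exact: continuous_sin_scale.
apply: cvgM.
  apply: (@continuous_comp _ _ _ cos (horner p)); first exact: continuous_cos.
  exact: continuous_horner.
apply: (@continuous_comp _ _ _ cos (fun y => y ^+ n)); first exact: continuous_cos.
exact: exprn_continuous.
Qed.

Lemma trig_bounded (p : {poly R}) : exists2 C, 0 <= C &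
  forall n k (x : R), `|p.[cos x] * cos x ^+ n * sin (k%:R * x)| <= C.
Proof.
exists (\sum_(i < size p) `|p`_i|) => [|n k x]; first by rewrite sumr_ge0.
have c1 : `|cos x| <= 1 by rewrite ler_norml cos_geN1 cos_le1.
have s1 : `|sin (k%:R * x)| <= 1 by rewrite ler_norml sin_geN1 sin_le1.
rewrite !normrM -[leRHS]mulr1 ler_pM // ?mulr_ge0 // -[leRHS]mulr1 ler_pM //; last first.
  by rewrite normrX exprn_ile1.
rewrite horner_coef; apply: le_trans (ler_norm_sum _ _ _) _; apply: ler_sum => i _.
by rewrite normrM normrX ler_piMr // exprn_ile1.
Qed.

Lemma integrable_trig f p n k : mu.-integrable setT
  (EFin \o (fun x => f x * (p.[cos x] * cos x ^+ n * sin (k%:R * x)))).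
Proof.
have [C _ CP] := trig_bounded p.
apply: integrable_mul_bounded; first exact: measurable_trig.
by move=> x; exact: CP.
Qed.

Lemma orthogonal_cos_sin f : (forall k, inner f (e R k) = 0) ->
  forall n k, \int[mu]_x (f x * (1 * cos x ^+ n * sin (k%:R * x))) = 0.
Proof.
move=> fe; elim=> [|n IH] [|k].
- by rewrite (@eq_Rintegral _ _ _ mu _ (cst 0)) ?Rintegral_cst ?mul0r // => x _;
  rewrite mul0r sin0 !mulr0.
- have := fe k; rewrite inner_eU0.
  rewrite (@eq_Rintegral _ _ _ mu _ (fun x => Num.sqrt (2 / pi) * (f x * (1%:P.[cos x] * cos x ^+
    0 * sin (k.+1%:R * x))))).
    rewrite RintegralZl //; last exact: integrable_trig.
    move=> /eqP; rewrite mulf_eq0 sqrtr_eq0 leNgt divr_gt0 ?pi_gt0 //= => /eqP.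
    by under eq_Rintegral do rewrite hornerC.
  by move=> x _; rewrite hornerC expr0 !mul1r /sine mulrCA.
- by rewrite (@eq_Rintegral _ _ _ mu _ (cst 0)) ?Rintegral_cst ?mul0r // => x _;
  rewrite mul0r sin0 !mulr0.
rewrite (@eq_Rintegral _ _ _ mu _ (fun x => 2^-1 * (f x * (1%:P.[cos x] * cos x ^+ n * sin (k%:R
  * x)))
   + 2^-1 * (f x * (1%:P.[cos x] * cos x ^+ n * sin (k.+2%:R * x))))).
  have i1 := integrable_trig f 1%:P n.
  rewrite RintegralD ?RintegralZl //; [|exact: (integrableZl measurableT _ (i1 _))..].
  under eq_Rintegral do rewrite hornerC.
  rewrite IH; under eq_Rintegral do rewrite hornerC.
  by rewrite IH mulr0 addr0.
move=> x _; rewrite !hornerC !mul1r exprSr.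
have -> : k%:R * x = k.+1%:R * x - x by rewrite -natr1; ring.
have -> : k.+2%:R * x = k.+1%:R * x + x by rewrite -natr1; ring.
rewrite sinB sinD; set a := sin _; set b := cos (_ * x); set s := sin x; set c := cos x.
by field.
Qed.

Lemma orthogonal_poly_sin f (p : {poly R}) : (forall k, inner f (e R k) = 0) ->
  forall n, \int[mu]_x (f x * (p.[cos x] * cos x ^+ n * sin (1%:R * x))) = 0.
Proof.
move=> fe; elim/poly_ind: p => [|p c IH] n.
  by rewrite (@eq_Rintegral _ _ _ mu _ (cst 0)) ?Rintegral_cst ?mul0r // => x _;
    rewrite horner0 !mul0r mulr0.
rewrite (@eq_Rintegral _ _ _ mu _ (fun x => f x * (p.[cos x] * cos x ^+ n.+1 * sin (1%:R * x)) +
   c * (f x * (1%:P.[cos x] * cos x ^+ n * sin (1%:R * x))))); last first.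
  by move=> x _; rewrite hornerMXaddC hornerC exprS; ring.
rewrite RintegralD ?RintegralZl //; first last.
- exact: (integrableZl measurableT _ (integrable_trig _ _ _ _)).
- exact: integrable_trig.
- exact: integrable_trig.
rewrite IH; under eq_Rintegral do rewrite hornerC.
by rewrite orthogonal_cos_sin // mulr0 addr0.
Qed.

Lemma step_integral0 f (a : R) : (forall k, inner f (e R k) = 0) -> 0 < a < pi ->
  \int[mu]_x (f x * (sin x * \1_(`]a, +oo[ : set R) x)) = 0.
Proof.
move=> fe /andP[a0 api].
pose c := cos a.
pose y (x : R) := 4^-1 * (cos x - c + 2).
have ylt x : 0 < x < pi -> (a < x -> 0 <= y x < 2^-1) * (x < a -> 2^-1 < y x <= 1).
  move=> /andP[x0 xpi]; rewrite /y.
  have /andP[c1 c2] : -1 <= c <= 1 by rewrite cos_geN1 cos_le1.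
  have /andP[c3 c4] : -1 <= cos x <= 1 by rewrite cos_geN1 cos_le1.
  have aI : a \in `[0, pi] by rewrite in_itv /= !ltW.
  have xI : x \in `[0, pi] by rewrite in_itv /= !ltW.
  split => xa.
    have : cos x < c by rewrite ltr_cos.
    by move=> H; apply/andP; split; lra.
  have : c < cos x by rewrite ltr_cos.
  by move=> H; apply/andP; split; lra.
have y01 x : 0 <= y x <= 1.
  rewrite /y.
  have /andP[c1 c2] : -1 <= c <= 1 by rewrite cos_geN1 cos_le1.
  have /andP[c3 c4] : -1 <= cos x <= 1 by rewrite cos_geN1 cos_le1.
  by apply/andP; split; lra.
pose p n : {poly R} := (1 - ((4^-1)%:P * ('X - c%:P + 2%:P)) ^+ n) ^+ (2 ^ n)%N.
have pE n x : (p n).[cos x] = (1 - y x ^+ n) ^+ (2 ^ n)%N.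
  by rewrite /p /y !hornerE.
pose g n (x : R) := f x * ((1 - y x ^+ n) ^+ (2 ^ n)%N * cos x ^+ 0 * sin (1%:R * x)).
have mg n : measurable_fun setT (g n : measurableTypeR R -> R).
  apply: measurable_funM; first exact: measurable_U0.
  by have := measurable_trig (p n) 0 1; apply: eq_measurable_fun => x _; rewrite pE.
have mlim : measurable_fun setT ((fun x => f x * (sin x * \1_(`]a,
  +oo[ : set R) x)) : measurableTypeR R -> R).
  apply: measurable_funM; first exact: measurable_U0.
  apply: measurable_funM; last by apply: measurable_indic; exact: measurable_itv.
  by apply: continuous_measurable_fun; exact: continuous_sin.
have g0 n : (\int[mu]_x (g n x)%:E = 0)%E.
  have H := orthogonal_poly_sin (p n) fe 0.
  have I := integrable_trig f (p n) 0 1.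
  rewrite -[LHS]fineK; last by have := integrable_fin_num _ I;
    under eq_integral do rewrite /= pE; apply.
  congr EFin; rewrite -H; congr fine; apply: eq_integral => x _.
  by rewrite /g pE.
have gI : mu.-integrable setT (fun x => `|f x|%:E).
  have := integrable_mul_bounded f (phi := cst 1) (C := 1).
  move=> /(_ _ _)/wrap[//|x|]; first by rewrite normr1.
  move/integrable_abse; apply: eq_integrable => // x _.
  by rewrite /= mulr1.
have ae_a : {ae mu, forall x : R, x != a}.
  exists [set a]; split => //.
    rewrite /mu0pi /mfrestr /mrestr /=; apply/eqP; rewrite eq_le measure_ge0 andbT.
    rewrite -(@lebesgue_measure_set1 R a); apply: le_measure.
    + by rewrite inE; apply: measurableI => //; exact: measurable_itv0pi.
    + by rewrite inE.
    + exact: subIsetl.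
  by move=> x /= /negP; rewrite negbK => /eqP.
have cvg_g : {ae mu, forall x : R, setT x -> (g n x)%:E @[n --> \oo] -->
    (f x * (sin x * \1_(`]a, +oo[ : set R) x))%:E}.
  apply: (@filterS2 _ (almost_everywhere mu) _ _ _ _ _ ae_a ae_in_0pi) => x xa xI _.
  apply: cvg_EFin; first exact: nearW.
  rewrite /g; apply: cvgM; first exact: cvg_cst.
  rewrite mul1r mulrC; under eq_fun do rewrite expr0 mulr1.
  apply: cvgM; last exact: cvg_cst.
  rewrite indicE; case: ltgtP xa => // xa _.
    rewrite memNset; last by rewrite /= in_itv /= andbT; apply/negP; rewrite -leNgt ltW.
    by apply: cvg_step_gt; exact: (ylt x xI).2.
  rewrite mem_set; last by rewrite /= in_itv /= andbT.
  by apply: cvg_step_lt; exact: (ylt x xI).1.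
have bnd_g : {ae mu, forall x : R, forall n, setT x -> (`|(g n x)%:E| <= `|f x|%:E)%E}.
  apply: aeW => x n _; rewrite /= lee_fin /g expr0 mulr1 normrM ler_piMr //.
  rewrite normrM mulr_ile1 //; first exact: step_bounded.
  by rewrite ler_norml sin_geN1 sin_le1.
have mgE n : measurable_fun setT (fun x : measurableTypeR R => (g n x)%:E).
  by apply/measurable_EFinP; exact: mg.
have [_ _] := dominated_convergence measurableT mgE ((measurable_EFinP _ _).2 mlim) cvg_g gI bnd_g.
rewrite /=; under eq_fun do rewrite g0.
move=> /cvg_unique /(_ (cvg_cst _)) H.
by rewrite /Rintegral H.
Qed.

Lemma sines_total f : (forall k, inner f (e R k) = 0) -> f = 0.
Proof.
move=> fe.
pose g (x : measurableTypeR R) : R := f x * sin x * \1_(itv0pi (R:=R)) x.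
have mI : measurable (itv0pi (R:=R)) by exact: measurable_itv0pi.
have mfs : measurable_fun setT ((fun x => f x * sin x) : measurableTypeR R -> R).
  apply: measurable_funM; first exact: measurable_U0.
  by apply: continuous_measurable_fun; exact: continuous_sin.
have mg : measurable_fun setT g.
  by apply: measurable_funM => //; exact: measurable_indic.
have muleb (h : R -> R) : measurable_fun setT (h : measurableTypeR R -> R) ->
    (\int[mu]_x (h x)%:E = \int[leb]_x (h x * \1_(itv0pi (R:=R)) x)%:E)%E.
  move=> mh; rewrite integral_mu0pi; last exact/measurable_EFinP.
  rewrite integral_mkcond; apply: eq_integral => x _.
  by rewrite /patch /indic; case: ifPn => _; rewrite ?mulr1 ?mulr0.
have ifs : mu.-integrable setT (EFin \o (fun x => f x * sin x)).
  apply: (@integrable_mul_bounded _ _ 1).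
    by apply: continuous_measurable_fun; exact: continuous_sin.
  by move=> x; rewrite ler_norml sin_geN1 sin_le1.
have ig : leb.-integrable setT (EFin \o g).
  apply/integrableP; split; first exact/measurable_EFinP.
  move/integrableP: ifs => [_]; rewrite /= muleb; last exact: measurableT_comp.
  move=> H; apply: le_lt_trans H; rewrite le_eqVlt; apply/orP; left; apply/eqP.
  by apply: eq_integral => x _; rewrite /g /indic [in LHS]normrM (ger0_norm (ler0n _ _)).
have tot : \int[leb]_x g x = 0.
  have := orthogonal_cos_sin fe 0 1; rewrite /Rintegral => H; rewrite -[RHS]H.
  congr fine; transitivity (\int[mu]_x (f x * sin x)%:E)%E; first by rewrite muleb.
  by apply: eq_integral => x _; rewrite expr0 !mul1r.
have half (a : R) : 0 < a < pi -> \int[leb]_(x in `]a, +oo[) g x = 0.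
  move=> aI; have H := step_integral0 fe aI; rewrite -[RHS]H /Rintegral.
  congr fine; rewrite muleb.
    rewrite integral_mkcond; apply: eq_integral => x _.
    by rewrite /patch /g (mulrA (f x)) [\1_(_ : set R) x in RHS]/indic; case: ifPn => _;
      rewrite ?mulr1 ?mulr0 ?mul0r.
  apply: measurable_funM; first exact: measurable_U0.
  apply: measurable_funM; first exact: continuous_measurable_fun (@continuous_sin R).
  by apply: measurable_indic; exact: measurable_itv.
have F0 (a : R) : 0 < a < pi -> \int[leb]_(x in `]-oo, a]) g x = 0.
  move=> aI; have := half a aI; have := tot.
  rewrite -(setUv [set` `]-oo, a]]) Rintegral_setU //; first last.
  - by apply/disj_set2P; rewrite setICr.
  - by rewrite setUv.
  - by apply: measurableC; exact: measurable_itv.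
  move=> + B; rewrite [X in _ + X](_ : _ = 0) ?addr0 //.
  by rewrite -[RHS]B; congr Rintegral; exact: setCitvl.
pose F (x : R) := \int[leb]_(t in `]-oo, x]) g t.
have gNy (y : R) : leb.-integrable `]-oo, y] (EFin \o g).
  by apply: integrableS ig => //.
have gloc : locally_integrable setT g by apply: open_integrable_locally => //; exact: openT.
have g0 : {ae leb, forall x : R, 0 < x < pi -> f x = 0}.
  have := FTC1Ny gNy gloc; apply: (@filterS _ (almost_everywhere leb)) => x [dF Fg] xI.
  have Fx : F^`()%classic x = 0.
    rewrite derive1E; transitivity ('D_1 (cst (0 : R) : R -> R) (x : R)); last exact: derive_cst.
    apply: near_eq_derive.
    have : x \in `]0, pi[ by rewrite in_itv.
    move/near_in_itvoo; apply: filterS => y; rewrite in_itv /= => yI.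
    by rewrite /F F0.
  have := Fg; rewrite -/F Fx /g indicE mem_set; last by rewrite /itv0pi /= in_itv.
  rewrite mulr1 => /esym/eqP; rewrite mulf_eq0 => /orP[/eqP//|/eqP sx].
  by have := sin_gt0_pi xI; rewrite sx ltxx.
apply/L2P; apply: (@filterS2 _ (almost_everywhere mu) _ _ _ _ _ (ae_mu0pi g0)
  (U0scaleE 0 (0 : U0 R))) => x fx /(_ I) zx _.
by rewrite [LHS]fx -[in RHS](scale0r (0 : U0 R)) [RHS]zx mul0r.
Qed.

End totality.

(** * The real Hilbert space H^0 *)

Section hilbert_H0.
Variable R : realType.
Implicit Types (z w : H0 R).

Definition innerH z w : R := inner z.1 w.1 + inner z.2 w.2.

Lemma innerHC z w : innerH z w = innerH w z.
Proof. by rewrite /innerH innerC (innerC z.2). Qed.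

Lemma innerHDl z z' w : innerH (z + z') w = innerH z w + innerH z' w.
Proof. by rewrite /innerH !innerDl addrACA. Qed.

Lemma innerHZl a z w : innerH (a *: z) w = a * innerH z w.
Proof. by rewrite /innerH !innerZl mulrDr. Qed.

Lemma innerHDr z z' w : innerH w (z + z') = innerH w z + innerH w z'.
Proof. by rewrite innerHC innerHDl !(innerHC w). Qed.

Lemma innerHZr a z w : innerH w (a *: z) = a * innerH w z.
Proof. by rewrite innerHC innerHZl (innerHC w). Qed.

Lemma innerHNl z w : innerH (- z) w = - innerH z w.
Proof. by rewrite -scaleN1r innerHZl mulN1r. Qed.

Lemma innerHNr z w : innerH w (- z) = - innerH w z.
Proof. by rewrite innerHC innerHNl innerHC. Qed.

Lemma innerHBl z z' w : innerH (z - z') w = innerH z w - innerH z' w.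
Proof. by rewrite innerHDl innerHNl. Qed.

Lemma innerHBr z z' w : innerH w (z - z') = innerH w z - innerH w z'.
Proof. by rewrite innerHDr innerHNr. Qed.

Lemma innerH0l w : innerH 0 w = 0.
Proof. by rewrite /innerH !inner0l addr0. Qed.

Lemma innerH0r w : innerH w 0 = 0.
Proof. by rewrite innerHC innerH0l. Qed.

Lemma innerH_suml (I : Type) (s : seq I) (F : I -> H0 R) w :
  innerH (\sum_(i <- s) F i) w = \sum_(i <- s) innerH (F i) w.
Proof.
by apply: (big_morph (fun z => innerH z w) _ (innerH0l w)) => z z'; exact: innerHDl.
Qed.

Lemma Hnorm_ge0 z : 0 <= Hnorm z. Proof. exact: sqrtr_ge0. Qed.

Lemma Hnorm2 z : Hnorm z ^+ 2 = innerH z z.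
Proof.
by rewrite /Hnorm sqr_sqrtr ?addr_ge0 ?sqr_ge0 // !norm_inner.
Qed.

Lemma Hnorm2E z : Hnorm z ^+ 2 = `|z.1| ^+ 2 + `|z.2| ^+ 2.
Proof. by rewrite Hnorm2 !norm_inner. Qed.

Lemma Hnorm0_eq0 z : Hnorm z = 0 -> z = 0.
Proof.
move=> z0; have : Hnorm z ^+ 2 = 0 by rewrite z0 expr0n.
rewrite Hnorm2E => /eqP; rewrite paddr_eq0 ?sqr_ge0 // !sqrf_eq0 !normr_eq0.
by case: z {z0} => z1 z2 /= /andP[/eqP -> /eqP ->].
Qed.

Lemma HnormZ a z : Hnorm (a *: z) = `|a| * Hnorm z.
Proof.
apply/eqP; rewrite -(@eqrXn2 _ 2) ?Hnorm_ge0 ?mulr_ge0 ?Hnorm_ge0 //.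
by rewrite exprMn !Hnorm2 innerHZl innerHZr real_normK ?num_real // mulrA expr2.
Qed.

Lemma cauchy_schwarzH z w : `|innerH z w| <= Hnorm z * Hnorm w.
Proof.
have [w0|w0] := eqVneq (Hnorm w) 0.
  by rewrite w0 mulr0 (Hnorm0_eq0 w0) innerH0r normr0.
have gg : 0 < Hnorm w by rewrite lt_neqAle eq_sym w0 Hnorm_ge0.
rewrite -(@ler_pXn2r _ 2) ?nnegrE // ?mulr_ge0 ?Hnorm_ge0 // real_normK ?num_real //.
have := sqr_ge0 (Hnorm ((Hnorm w ^+ 2) *: z - innerH z w *: w)).
rewrite (Hnorm2 (_ - _)) innerHBl !innerHBr !innerHZl !innerHZr -!Hnorm2 (innerHC w z).
move=> H.
have {H} : 0 <= Hnorm w ^+ 2 * (Hnorm z ^+ 2 * Hnorm w ^+ 2 - innerH z w ^+ 2).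
  by apply: le_trans H _; rewrite le_eqVlt; apply/orP; left; apply/eqP; ring.
by rewrite pmulr_rge0 ?exprn_gt0 // subr_ge0 exprMn.
Qed.

Lemma normH z : `|z| = Num.max `|z.1| `|z.2|.
Proof. by []. Qed.

Lemma norm_le_Hnorm z : `|z| <= Hnorm z.
Proof.
rewrite -(@ler_pXn2r _ 2) ?nnegrE ?Hnorm_ge0 // Hnorm2E normH.
by rewrite /Order.max; case: ifP => _; rewrite ?lerDr ?lerDl sqr_ge0.
Qed.

Lemma Hnorm_le_norm z : Hnorm z <= 2 * `|z|.
Proof.
rewrite -(@ler_pXn2r _ 2) ?nnegrE ?Hnorm_ge0 ?mulr_ge0 // Hnorm2E exprMn.
have a : `|z.1| ^+ 2 <= `|z| ^+ 2.
  by rewrite lerXn2r ?nnegrE // normH le_max lexx.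
have b : `|z.2| ^+ 2 <= `|z| ^+ 2.
  by rewrite lerXn2r ?nnegrE // normH le_max lexx orbT.
have c := sqr_ge0 `|z|.
by apply: le_trans (lerD a b) _; rewrite expr2; lra.
Qed.

Lemma innerH_continuous w : continuous (fun z => innerH z w).
Proof.
move=> z; apply: cvgD.
  apply: (@continuous_comp _ _ _ (fst : H0 R -> U0 R) (fun f => inner f w.1)).
    exact: cvg_fst.
  exact: inner_continuousl.
apply: (@continuous_comp _ _ _ (snd : H0 R -> U0 R) (fun f => inner f w.2)).
  exact: cvg_snd.
exact: inner_continuousl.
Qed.

(* [e k] and [i * e k], at the indices 2k and 2k + 1: an orthonormal basis of
   [H0] over the reals. *)
Definition EH (n : nat) : H0 R := if odd n then (0, e R n./2) else (e R n./2, 0).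

Definition cH (n : nat) z : R := innerH z (EH n).

Lemma EH_orthonormal m n : innerH (EH m) (EH n) = (m == n)%:R.
Proof.
have -> : (m == n) = (odd m == odd n) && (m./2 == n./2).
  apply/eqP/andP => [->//|[/eqP o /eqP h]].
  by rewrite -(odd_double_half m) o h odd_double_half.
rewrite /innerH /EH.
by case: (odd m); case: (odd n) => /=; rewrite ?inner0l ?inner0r ?inner_ee ?addr0 ?add0r.
Qed.

Lemma cH_even n z : cH n.*2 z = inner z.1 (e R n).
Proof. by rewrite /cH /EH odd_double doubleK /innerH /= inner0r addr0. Qed.

Lemma cH_odd n z : cH n.*2.+1 z = inner z.2 (e R n).
Proof. by rewrite /cH /EH /= odd_double /= uphalf_double /innerH /= inner0r add0r. Qed.

Lemma cH_total z : (forall n, cH n z = 0) -> z = 0.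
Proof.
move=> zc; case: z zc => z1 z2 zc.
have -> : z1 = 0 by apply: sines_total => k; have := zc k.*2; rewrite cH_even.
have -> // : z2 = 0.
by apply: sines_total => k; have := zc k.*2.+1; rewrite cH_odd.
Qed.

Lemma EHsum_coord (c : nat -> R) N n :
  cH n (\sum_(i < N) c i *: EH i) = if (n < N)%N then c n else 0.
Proof.
rewrite /cH innerH_suml; under eq_bigr do rewrite innerHZl EH_orthonormal.
case: ifPn => [nN|]; last first.
  rewrite -leqNgt => Nn; apply: big1 => i _.
  by rewrite ltn_eqF ?mulr0 // (leq_trans (ltn_ord i)).
rewrite (bigD1 (Ordinal nN)) //= eqxx mulr1 big1 ?addr0 // => i /eqP/val_eqP/= iN.
by rewrite (negbTE iN) mulr0.
Qed.

Lemma pythagoras z N :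
  Hnorm (z - \sum_(i < N) cH i z *: EH i) ^+ 2 = Hnorm z ^+ 2 - \sum_(i < N) cH i z ^+ 2.
Proof.
set S := \sum_(i < N) _ *: _.
have zS : innerH z S = \sum_(i < N) cH i z ^+ 2.
  rewrite innerHC innerH_suml; apply: eq_bigr => i _.
  by rewrite innerHZl innerHC expr2.
have SS : innerH S S = \sum_(i < N) cH i z ^+ 2.
  rewrite {1}/S innerH_suml; apply: eq_bigr => i _.
  rewrite innerHZl innerHC -/(cH i S) /S (EHsum_coord (fun i => cH i z)) ltn_ord.
  by rewrite expr2.
rewrite !Hnorm2 innerHBl !innerHBr (innerHC S z) zS SS; ring.
Qed.

Lemma bessel z N : \sum_(i < N) cH i z ^+ 2 <= Hnorm z ^+ 2.
Proof. by rewrite -subr_ge0 -pythagoras sqr_ge0. Qed.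

Lemma Hnorm2_sum (c : nat -> R) n m : (n <= m)%N ->
  Hnorm (\sum_(i < m) c i *: EH i - \sum_(i < n) c i *: EH i) ^+ 2 =
  \sum_(i < m) c i ^+ 2 - \sum_(i < n) c i ^+ 2.
Proof.
move=> nm; have := pythagoras (\sum_(i < m) c i *: EH i) n.
have cE i : (i < m)%N -> cH i (\sum_(i < m) c i *: EH i) = c i.
  by move=> im; rewrite EHsum_coord im.
rewrite (eq_bigr (fun i : 'I_n => c i *: EH i)); last first.
  by move=> i _; rewrite cE // (leq_trans (ltn_ord i)).
rewrite [in RHS](eq_bigr (fun i : 'I_n => c i ^+ 2)); last first.
  by move=> i _; rewrite cE // (leq_trans (ltn_ord i)).
move=> ->; congr (_ - _).
rewrite Hnorm2 innerH_suml; apply: eq_bigr => i _.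
by rewrite innerHZl innerHC -/(cH i _) cE // expr2.
Qed.

Lemma fast_cauchy_H0 (D : nat -> H0 R) : (forall j, `|D j| <= 2^-1 ^+ j) ->
  exists z, forall n, `|z - \sum_(j < n) D j| <= 2 * 2^-1 ^+ n.
Proof.
move=> Dle.
have [j|z1 z1P] := @fast_cauchy_cvg R (fun j => (D j).1).
  by apply: le_trans (Dle j); rewrite normH le_max lexx.
have [j|z2 z2P] := @fast_cauchy_cvg R (fun j => (D j).2).
  by apply: le_trans (Dle j); rewrite normH le_max lexx orbT.
exists (z1, z2) => n; rewrite normH ge_max.
have s1 : (\sum_(j < n) D j).1 = \sum_(j < n) (D j).1.
  by elim/big_ind2 : _ => // x1 x2 y1 y2 <- <-.
have s2 : (\sum_(j < n) D j).2 = \sum_(j < n) (D j).2.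
  by elim/big_ind2 : _ => // x1 x2 y1 y2 <- <-.
have -> : ((z1, z2) - \sum_(j < n) D j : H0 R).1 = z1 - (\sum_(j < n) D j).1 by [].
have -> : ((z1, z2) - \sum_(j < n) D j : H0 R).2 = z2 - (\sum_(j < n) D j).2 by [].
by rewrite s1 s2 z1P z2P.
Qed.

Lemma riesz_fischer (c : nat -> R) (C : R) :
  (forall N, \sum_(i < N) c i ^+ 2 <= C) -> 
  exists z, (forall n, cH n z = c n) /\
  forall eps, 0 < eps -> exists M, Hnorm (z - \sum_(i < M) c i *: EH i) <= eps.
Proof.
move=> cC.
pose s N := \sum_(i < N) c i ^+ 2.
have s_nd : nondecreasing_seq s.
  apply/nondecreasing_seqP => n; rewrite /s big_ord_recr /= lerDl sqr_ge0 //.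
have s_cvg : cvgn s.
  apply: nondecreasing_is_cvgn => //; exists C => _ [n _ <-]; exact: cC.
have tail j : exists N, forall m n, (N <= n)%N -> (n <= m)%N -> s m - s n <= (2^-1 ^+ j) ^+ 2.
  have e0 : 0 < (2^-1 ^+ j) ^+ 2 :> R by rewrite !exprn_gt0 // invr_gt0.
  have /cvgrPdist_le/(_ _ e0)[N _ NP] := s_cvg.
  exists N => m n Nn nm; apply: le_trans (NP n Nn); rewrite ger0_norm.
    by rewrite lerD2r; exact: nondecreasing_cvgn_le.
  by rewrite subr_ge0; exact: nondecreasing_cvgn_le.
have {tail}[Nf NfP] := choice tail.
pose phi j := (\sum_(i < j.+1) (Nf i).+1)%N.
have phiN j : (Nf j <= phi j)%N.
  by rewrite /phi big_ord_recr /= (leq_trans (leqnSn _)) // leq_addl.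
have phiS j : (phi j < phi j.+1)%N.
  by rewrite /phi [X in (_ < X)%N]big_ord_recr /= addnS ltnS leq_addr.
have phij j : (j < phi j)%N by elim: j => [|j IH];
  [rewrite /phi big_ord1|apply: leq_ltn_trans IH _].
pose S N := \sum_(i < N) c i *: EH i.
pose D j := S (phi j.+1) - S (phi j).
have Dle j : `|D j| <= 2^-1 ^+ j.
  apply: le_trans (norm_le_Hnorm _) _.
  rewrite -(@ler_pXn2r _ 2) ?nnegrE ?Hnorm_ge0 ?exprn_ge0 ?invr_ge0 //.
  by rewrite /D Hnorm2_sum ?(ltnW (phiS j)) //; apply: NfP => //; exact: ltnW.
have [z zP] := fast_cauchy_H0 Dle.
have DS n : \sum_(j < n) D j = S (phi n) - S (phi 0%N).
  elim: n => [|n IH]; first by rewrite big_ord0 subrr.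
  by rewrite big_ord_recr /= IH /D addrC addrA subrK.
have cvgS n eps : 0 < eps ->
    exists2 M, (n < M)%N & Hnorm (z + S (phi 0%N) - S M) <= eps.
  move=> eps0.
  have h0 : 2^-1 ^+ j @[j --> \oo] --> (0 : R) by apply: cvg_expr; rewrite ger0_norm; lra.
  have e4 : 0 < eps / 4 by rewrite divr_gt0.
  have /cvgrPdist_le/(_ _ e4)[N _ NP] := h0.
  pose M := maxn N n.
  exists (phi M); first by rewrite (leq_trans _ (phij M)) // ltnS leq_maxr.
  apply: le_trans (Hnorm_le_norm _) _.
  have -> : z + S (phi 0%N) - S (phi M) = z - \sum_(j < M) D j by rewrite DS opprB addrA.
  have := zP M; have := NP M (leq_maxl _ _).
  rewrite /= sub0r normrN ger0_norm ?exprn_ge0 ?invr_ge0 // => H1 H2; lra.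
exists (z + S (phi 0%N)); split=> [n|eps eps0]; last first.
  by have [M _ MP] := cvgS 0%N eps eps0; exists M.
apply/eqP; rewrite -subr_eq0 -normr_le0; apply/ler_addgt0Pl => eps eps0; rewrite addr0.
have [M nM MP] := cvgS n eps eps0.
have := cauchy_schwarzH (z + S (phi 0%N) - S M) (EH n).
have -> : Hnorm (EH n) = 1.
  by apply/eqP; rewrite -(@eqrXn2 _ 2) ?Hnorm_ge0 // Hnorm2 EH_orthonormal eqxx expr1n.
by rewrite mulr1 innerHBl -!/(cH n _) EHsum_coord nM => /le_trans; apply.
Qed.

Lemma parseval z : \sum_(i < N) cH i z ^+ 2 @[N --> \oo] --> Hnorm z ^+ 2.
Proof.
have [z' [z'c z'cvg]] := riesz_fischer (c := fun i => cH i z) (bessel z).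
have zz' : z = z'.
  apply/eqP; rewrite -subr_eq0; apply/eqP/cH_total => n.
  by rewrite /cH innerHBl -!/(cH n _) z'c subrr.
apply/cvgrPdist_le => eps eps0.
have se0 : 0 < Num.sqrt eps by rewrite sqrtr_gt0.
have [M MP] := z'cvg _ se0.
exists M => // N /= MN.
have -> : Hnorm z ^+ 2 - \sum_(i < N) cH i z ^+ 2 = Hnorm (z - \sum_(i < N) cH i z *: EH i) ^+ 2.
  by rewrite pythagoras.
rewrite ger0_norm ?sqr_ge0 // pythagoras.
apply: (@le_trans _ _ (Hnorm z ^+ 2 - \sum_(i < M) cH i z ^+ 2)).
  rewrite lerD2l lerN2 -!(big_mkord xpredT (fun i => cH i z ^+ 2)) (big_cat_nat (leq0n M) MN) //=.
  by rewrite lerDl sumr_ge0 // => i _; rewrite sqr_ge0.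
rewrite -pythagoras -(sqr_sqrtr (ltW eps0)) lerXn2r ?nnegrE ?Hnorm_ge0 ?sqrtr_ge0 //.
by rewrite {1}zz'.
Qed.

End hilbert_H0.

(** * Compact ellipsoids *)

Lemma ultra_pushforward T U (f : T -> U) (F : set_system T) :
  UltraFilter F -> UltraFilter (f @ F).
Proof.
move=> FU; apply: Build_UltraFilter => G GP FG.
apply/seteqP; split => A; last exact: FG.
move=> GA; have [//|] := in_ultra_setVsetC (f @^-1` A) FU.
rewrite preimage_setC => /FG GnA.
by have [a []] := @filter_ex _ G _ _ (filterI GA GnA).
Qed.

Lemma cvg_sum_ord (R : realType) T (F : set_system T) (N : nat)
    (f : nat -> T -> R) (l : nat -> R) : Filter F ->
  (forall i, f i @ F --> l i) ->
  \sum_(i < N) f i x @[x --> F] --> \sum_(i < N) l i.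
Proof.
move=> FF fl; elim: N => [|N IH].
  by under eq_fun do rewrite big_ord0; rewrite big_ord0; exact: cvg_cst.
by under eq_fun do rewrite big_ord_recr; rewrite big_ord_recr; exact: cvgD.
Qed.

Section ellipsoid.
Variable R : realType.
Implicit Types (x y z : H0 R).

Lemma Hnorm2_le (x : H0 R) (C : R) :
  (forall N, \sum_(i < N) cH i x ^+ 2 <= C) -> Hnorm x ^+ 2 <= C.
Proof.
move=> xC; rewrite -(cvg_lim (@Rhausdorff R) (@parseval R x)); apply: limr_le.
  by apply/cvg_ex; exists (Hnorm x ^+ 2); exact: (@parseval R x).
by apply: nearW => N; exact: xC.
Qed.

Definition ellipsoid (r : nat -> R) (b : R) : set (H0 R) :=
  [set x | forall N, \sum_(i < N) cH i x ^+ 2 / r i <= b].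

Lemma ellipsoid_tail (r : nat -> R) (b : R) x N M :
  (forall n, 0 < r n) -> nonincreasing_seq r -> ellipsoid r b x ->
  \sum_(i < M | (N <= i)%N) cH i x ^+ 2 <= r N * b.
Proof.
move=> r0 rd xE; apply: le_trans (_ : r N * \sum_(i < M) cH i x ^+ 2 / r i <= _); last first.
  by rewrite ler_wpM2l // ltW.
rewrite mulr_sumr [leRHS](bigID (fun i : 'I_M => (N <= i)%N)) /=.
rewrite ler_wpDr //.
  by apply: sumr_ge0 => i _; rewrite mulr_ge0 ?divr_ge0 ?sqr_ge0 // ltW.
apply: ler_sum => i Ni; rewrite mulrCA ler_peMr ?sqr_ge0 // ler_pdivlMr // mul1r.
exact: rd.
Qed.

Lemma continuous_cH n : continuous (@cH R n).
Proof. exact: innerH_continuous. Qed.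

Lemma compact_ellipsoid (r : nat -> R) (b : R) :
  (forall n, 0 < r n) -> nonincreasing_seq r -> r n @[n --> \oo] --> 0 ->
  compact (ellipsoid r b).
Proof.
move=> r0 rd r_cvg0; rewrite compact_ultra => F FU FE.
have [x0 x0E] := @filter_ex _ F _ _ FE.
have b0 : 0 <= b by have := x0E 0%N; rewrite big_ord0.
have coordlim n : exists c : R, cH n @ F --> c.
  have := @segment_compact R (- Num.sqrt (r n * b)) (Num.sqrt (r n * b)).
  rewrite compact_ultra => /(_ (cH n @ F) (ultra_pushforward _ _))[|c [_ cF]]; last by exists c.
  suff : F (cH n @^-1` [set` `[- Num.sqrt (r n * b), Num.sqrt (r n * b)]]) by [].
  apply: filterS FE => x xE; rewrite /= in_itv /= -ler_norml -sqrtr_sqr.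
  rewrite ler_wsqrtr // -ler_pdivrMl // mulrC.
  apply: le_trans (xE n.+1); rewrite big_ord_recr /= lerDr sumr_ge0 // => i _.
  by rewrite divr_ge0 ?sqr_ge0 // ltW.
have [c cF] := choice coordlim.
have cb N : \sum_(i < N) c i ^+ 2 / r i <= b.
  have H : \sum_(i < N) cH i x ^+ 2 / r i @[x --> F] --> \sum_(i < N) c i ^+ 2 / r i.
    apply: (@cvg_sum_ord _ _ F N (fun i x => cH i x ^+ 2 / r i) (fun i => c i ^+ 2 / r i)) =>
      i; apply: cvgM; last exact: cvg_cst.
    rewrite expr2; apply: cvgM; exact: cF.
  rewrite -(cvg_lim (@Rhausdorff R) H); apply: limr_le; first by apply/cvg_ex; eexists; exact: H.
  by apply: filterS FE => x; exact.
have [|x [xc _]] := @riesz_fischer R c (r 0%N * b).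
  move=> N; apply: le_trans (_ : r 0%N * \sum_(i < N) c i ^+ 2 / r i <= _); last first.
    by rewrite ler_wpM2l // ltW.
  rewrite mulr_sumr; apply: ler_sum => i _.
  rewrite mulrCA ler_peMr ?sqr_ge0 // ler_pdivlMr // mul1r; exact: rd.
have xE : ellipsoid r b x by move=> N; under eq_bigr do rewrite xc; exact: cb.
exists x; split => //=.
apply/(@cvgrPdist_le _ _ _ F _ id) => eps eps0.
have e8 : 0 < eps ^+ 2 / (8 * (b + 1)).
  by rewrite divr_gt0 ?exprn_gt0 // mulr_gt0 // ltr_wpDl.
have /cvgrPdist_lt/(_ _ e8)[N _ NP] := r_cvg0.
have rN : r N * b <= eps ^+ 2 / 8.
  have := NP N (leqnn N); rewrite /= sub0r normrN gtr0_norm // => /ltW rNe.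
  apply: (@le_trans _ _ (r N * (b + 1))); first by rewrite ler_wpM2l ?lerDl // ltW.
  by rewrite -ler_pdivlMr ?ltr_wpDl // -mulrA -invfM.
have Hsum : \sum_(i < N) (c i - cH i y) ^+ 2 @[y --> F] --> (0 : R).
  rewrite [X in _ --> X](_ : 0 = \sum_(i < N) (c i - c i) ^+ 2); last first.
    by rewrite big1 // => i _; rewrite subrr expr0n.
  apply: (@cvg_sum_ord _ _ F N (fun i y => (c i - cH i y) ^+ 2) (fun i => (c i - c i) ^+ 2)) =>
    i; rewrite expr2.
  have H : c i - cH i y @[y --> F] --> c i - c i by apply: cvgB; [exact: cvg_cst|exact: cF].
  exact: (cvgM H H).
have e2 : 0 < eps ^+ 2 / 2 by rewrite divr_gt0 // exprn_gt0.
have /cvgrPdist_le/(_ _ e2) := Hsum.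
apply: filterS2 FE => y yE /=; rewrite sub0r normrN => yx.
apply: le_trans (norm_le_Hnorm _) _.
rewrite -(@ler_pXn2r _ 2) ?nnegrE ?Hnorm_ge0 ?(ltW eps0) //.
apply: Hnorm2_le => M.
rewrite (bigID (fun i : 'I_M => (N <= i)%N)) /=.
have -> : eps ^+ 2 = eps ^+ 2 / 2 + eps ^+ 2 / 2 by lra.
apply: lerD.
  apply: (@le_trans _ _ (\sum_(i < M | (N <= i)%N) (2 * cH i x ^+ 2 + 2 * cH i y ^+ 2))).
    apply: ler_sum => i _; rewrite /cH innerHBl -!/(cH i _).
    have := sqr_ge0 (cH i x + cH i y); rewrite sqrrD sqrrB => H; lra.
  rewrite big_split /= -!mulr_sumr.
  have := ellipsoid_tail N M r0 rd xE; have := ellipsoid_tail N M r0 rd yE.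
  move=> H1 H2; lra.
apply: le_trans (ler_norm _) (le_trans _ yx).
rewrite !ger0_norm ?sumr_ge0 //; [|by move=> i _; rewrite sqr_ge0..].
have [NM|MN] := leqP N M.
  rewrite (big_ord_widen_cond M xpredT (fun i => (c i - cH i y) ^+ 2)) //.
  rewrite le_eqVlt; apply/orP; left; apply/eqP; apply: eq_big => i.
    by rewrite ltnNge.
  by rewrite /cH innerHBl -!/(cH i _) xc.
rewrite (big_ord_widen_cond N (fun i => ~~ (N <= i)%N) (fun i => cH i (x - y) ^+ 2) (ltnW MN)).
rewrite big_mkcond; apply: ler_sum => i _; case: ifP => _; last exact: sqr_ge0.
by rewrite /cH innerHBl -!/(cH i _) xc.
Qed.

End ellipsoid.

(** * The covariance and the rate function *)

Section covariance.
Variables (R : realType) (eta : nat -> R) (Q Qhalf : U0 R -> U0 R).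
Hypothesis eta_ge0 : forall k, 0 <= eta k.
Hypothesis Q_e : forall k, Q (e R k) = eta k *: e R k.
Hypothesis QhalfQ : sqrt_op Qhalf Q.
Hypothesis Qhalf_HS : hilbert_schmidt_U1 Qhalf.
Implicit Types (x y z xi : H0 R).

Lemma Qhalf_linear : linear Qhalf.
Proof. by have [[[? ?] _ _] _] := QhalfQ. Qed.

Lemma Qhalf_sym f g : inner (Qhalf f) g = inner f (Qhalf g).
Proof. by have [[_ + _] _] := QhalfQ; apply. Qed.

Lemma QhalfD f g : Qhalf (f + g) = Qhalf f + Qhalf g.
Proof. by have := Qhalf_linear 1 f g; rewrite !scale1r. Qed.

Lemma Qhalf0 : Qhalf 0 = 0.
Proof. by have := QhalfD 0 0; rewrite addr0 => /esym/eqP;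
  rewrite addrC -subr_eq0 addrK => /eqP. Qed.

Lemma QhalfZ a f : Qhalf (a *: f) = a *: Qhalf f.
Proof. by have := Qhalf_linear a f 0; rewrite Qhalf0 !addr0. Qed.

(* If (B - s)(B + s) v = 0 with B >= 0 and s > 0, then B v = s v. *)
Lemma Qhalf_e k : Qhalf (e R k) = Num.sqrt (eta k) *: e R k.
Proof.
have [[_ _ Qpos] QQ] := QhalfQ.
pose s := Num.sqrt (eta k).
pose v := Qhalf (e R k) - s *: e R k.
have Qv : Qhalf v = - s *: v.
  rewrite /v -[- (s *: _)]scaleN1r scalerA QhalfD QhalfZ QQ Q_e scalerDr scalerA.
  rewrite mulN1r mulrNN -expr2 sqr_sqrtr ?eta_ge0 // addrC.
  by rewrite scaleNr.
apply/eqP; rewrite -subr_eq0 -/v -normr_eq0 -sqrf_eq0 norm_inner.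
have [s0|s0] := eqVneq s 0.
  rewrite /v s0 scale0r subr0 Qhalf_sym QQ Q_e innerZr.
  have -> : eta k = s ^+ 2 by rewrite sqr_sqrtr.
  by rewrite s0 expr0n mul0r.
have s_gt0 : 0 < s by rewrite lt_neqAle eq_sym s0 sqrtr_ge0.
have := Qpos v; rewrite Qv innerZl -norm_inner mulNr oppr_ge0 pmulr_rle0 // => H.
by apply/eqP/le_anti; rewrite H sqr_ge0.
Qed.

Lemma eta_summable : exists C, forall N, \sum_(k < N) eta k <= C.
Proof.
have [_ _ _ HS] := Qhalf_HS.
have ge : (forall k, 0 <= (H1norm (Qhalf (e R k)) ^+ 2)%:E :> \bar R)%E.
  by move=> k; rewrite lee_fin sqr_ge0.
exists (fine (\sum_(k <oo) (H1norm (Qhalf (e R k)) ^+ 2)%:E)%E) => N.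
rewrite -lee_fin fineK; last by rewrite ge0_fin_numE // nneseries_ge0.
rewrite -sumEFin; apply: le_trans (nneseries_lim_ge N _); last by move=> *; exact: ge.
rewrite big_mkord; apply: lee_sum => k _; rewrite lee_fin.
rewrite /H1norm sqr_sqrtr ?addr_ge0 ?sqr_ge0 //.
rewrite Qhalf_e normrZ norm_e mulr1 ger0_norm ?sqrtr_ge0 // sqr_sqrtr ?eta_ge0 //.
by rewrite lerDl sqr_ge0.
Qed.

Definition etaH (n : nat) : R := eta n./2.

Lemma etaH_ge0 n : 0 <= etaH n. Proof. exact: eta_ge0. Qed.

Local Notation QH := (complexify Qhalf).

Lemma QHD z w : QH (z + w) = QH z + QH w.
Proof. by rewrite /complexify /= !QhalfD. Qed.

Lemma QHZ a z : QH (a *: z) = a *: QH z.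
Proof. by rewrite /complexify /= !QhalfZ. Qed.

Lemma QH_sym z w : innerH (QH z) w = innerH z (QH w).
Proof. by rewrite /innerH /= !Qhalf_sym. Qed.

Lemma QH_EH n : QH (EH R n) = Num.sqrt (etaH n) *: EH R n.
Proof.
rewrite /EH /complexify /etaH; case: (odd n) => /=.
  by rewrite Qhalf0 Qhalf_e -[RHS]/(_ *: 0, _ *: _) scaler0.
by rewrite Qhalf0 Qhalf_e -[RHS]/(_ *: _, _ *: 0) scaler0.
Qed.

Lemma cH_QH n z : cH n (QH z) = Num.sqrt (etaH n) * cH n z.
Proof. by rewrite /cH QH_sym QH_EH innerHZr. Qed.

Definition qform z : R := Hnorm (QH z) ^+ 2.

Lemma qform_ge0 z : 0 <= qform z. Proof. exact: sqr_ge0. Qed.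

Lemma qform_sum (c : nat -> R) N :
  qform (\sum_(i < N) c i *: EH R i) = \sum_(i < N) etaH i * c i ^+ 2.
Proof.
rewrite /qform.
have -> : QH (\sum_(i < N) c i *: EH R i) = \sum_(i < N) (Num.sqrt (etaH i) * c i) *: EH R i.
  rewrite (big_morph QH QHD (id1 := 0)); last by rewrite /complexify /= Qhalf0.
  by apply: eq_bigr => i _; rewrite QHZ QH_EH scalerA mulrC.
have := @Hnorm2_sum R (fun i => Num.sqrt (etaH i) * c i) 0 N (leq0n N).
rewrite !big_ord0 !subr0 => ->; apply: eq_bigr => i _.
by rewrite exprMn sqr_sqrtr ?etaH_ge0.
Qed.

Variable alpha : R.
Hypothesis alpha_gt0 : 0 < alpha.

(* Division by [etaH i = 0] gives [0]. *)
Definition in_dom x (C : R) : Prop :=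
  (forall n, etaH n = 0 -> cH n x = 0) /\
  forall N, \sum_(i < N) cH i x ^+ 2 / etaH i <= C.

Lemma sqr_div_sqrt n (a : R) : (a / Num.sqrt (etaH n)) ^+ 2 = a ^+ 2 / etaH n.
Proof. by rewrite expr_div_n sqr_sqrtr ?etaH_ge0. Qed.

Lemma in_dom_range z : in_dom (QH z) (Hnorm z ^+ 2).
Proof.
split=> [n n0|N]; first by rewrite cH_QH n0 sqrtr0 mul0r.
apply: le_trans (bessel z N); apply: ler_sum => i _.
rewrite cH_QH exprMn sqr_sqrtr ?etaH_ge0 //.
have [->|h] := eqVneq (etaH i) 0; first by rewrite !mul0r sqr_ge0.
by rewrite mulrAC mulfV // mul1r.
Qed.

Lemma in_dom_preimage x (C : R) : in_dom x C -> exists z,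
  [/\ QH z = x, Hnorm z ^+ 2 <= C & forall z', QH z' = x -> Hnorm z <= Hnorm z'].
Proof.
move=> [x0 xC].
have dC N : \sum_(i < N) (cH i x / Num.sqrt (etaH i)) ^+ 2 <= C.
  by under eq_bigr do rewrite sqr_div_sqrt.
have [z [zc _]] := riesz_fischer (c := fun i => cH i x / Num.sqrt (etaH i)) dC.
exists z; split.
- apply/eqP; rewrite -subr_eq0; apply/eqP/cH_total => n.
  rewrite /cH innerHBl -!/(cH n _) cH_QH zc.
  have [h|h] := eqVneq (etaH n) 0; first by rewrite h sqrtr0 mul0r x0 ?subrr.
  rewrite mulrCA divff ?mulr1 ?subrr //.
  by rewrite sqrtr_eq0 -ltNge lt_neqAle eq_sym h etaH_ge0.
- by apply: Hnorm2_le => N; under eq_bigr do rewrite zc; exact: dC.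
move=> z' z'x; rewrite -(@ler_pXn2r _ 2) ?nnegrE ?Hnorm_ge0 //.
apply: Hnorm2_le => N; under eq_bigr do rewrite zc sqr_div_sqrt.
by rewrite -z'x; have [_] := in_dom_range z'; apply.
Qed.

Local Notation I := (rate alpha Qhalf).
Local Notation Lam xi := (alpha ^+ 2 / 4 * qform xi).

Lemma rate_le_dom x (a : R) : (I x <= a%:E)%E -> in_dom x (alpha ^+ 2 * a).
Proof.
rewrite /rate; case: ifP => [/asboolP[z0 _ z0x]|_]; last by rewrite leye_eq.
have z0d := in_dom_range z0; rewrite z0x in z0d.
have [z [zx _ zmin]] := in_dom_preimage z0d.
have : [set z | QH z = x /\ forall z', QH z' = x -> Hnorm z <= Hnorm z'] (pseudo_inverse QH x).
  by apply: xgetPex; exists z.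
move=> [px _]; rewrite lee_fin => H; rewrite -px.
have [d1 d2] := in_dom_range (pseudo_inverse QH x); split=> // N.
apply: le_trans (d2 N) _.
by rewrite -ler_pdivrMl ?exprn_gt0.
Qed.

Lemma dom_rate_le x (a : R) : in_dom x (alpha ^+ 2 * a) -> (I x <= a%:E)%E.
Proof.
move=> xd; have [z [zx zC zmin]] := in_dom_preimage xd.
have : [set z | QH z = x /\ forall z', QH z' = x -> Hnorm z <= Hnorm z'] (pseudo_inverse QH x).
  by apply: xgetPex; exists z.
move=> [px pmin]; rewrite /rate asboolT; last by exists z.
rewrite lee_fin ler_pdivrMl ?exprn_gt0 //; apply: le_trans zC.
by rewrite lerXn2r ?nnegrE ?Hnorm_ge0 // pmin.
Qed.

Lemma rate_le_dual x (a : R) : (I x <= a%:E)%E ->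
  forall xi, innerH xi x - Lam xi <= a.
Proof.
move=> /rate_le_dom/in_dom_preimage[z [<- zC _]] xi.
rewrite -QH_sym.
have H1 : innerH (QH xi) z <= Hnorm (QH xi) * Hnorm z.
  exact: le_trans (ler_norm _) (cauchy_schwarzH _ _).
have H2 : alpha ^- 2 * Hnorm z ^+ 2 <= a by rewrite ler_pdivrMl ?exprn_gt0.
have := sqr_ge0 (alpha / 2 * Hnorm (QH xi) - alpha^-1 * Hnorm z).
rewrite /qform sqrrB !exprMn exprVn.
have -> : alpha / 2 * Hnorm (QH xi) * (alpha^-1 * Hnorm z) = 2^-1 * (Hnorm (QH xi) * Hnorm z).
  by field; rewrite gt_eqF.
rewrite -mulr_natl => H3; lra.
Qed.

Lemma dual_rate_le x (a : R) : (forall xi, innerH xi x - Lam xi <= a) -> (I x <= a%:E)%E.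
Proof.
move=> xa; apply: dom_rate_le.
have x0 n : etaH n = 0 -> cH n x = 0.
  move=> n0; apply/eqP; apply: contraT => xn.
  have xn2 : 0 < cH n x ^+ 2 by rewrite lt_neqAle eq_sym sqr_ge0 sqrf_eq0 xn.
  have := xa (((a + 1) / cH n x) *: EH R n).
  rewrite innerHZl innerHC -/(cH n x) divfK //.
  have -> : qform (((a + 1) / cH n x) *: EH R n) = 0.
    by rewrite /qform QHZ QH_EH n0 sqrtr0 scale0r scaler0 Hnorm2 innerH0l.
  rewrite mulr0 subr0 => H; lra.
split=> // N.
have := xa (\sum_(i < N) (2 / alpha ^+ 2 * (cH i x / etaH i)) *: EH R i).
rewrite (qform_sum (fun i => 2 / alpha ^+ 2 * (cH i x / etaH i)))
  (innerH_suml _ (fun i : 'I_N => (2 / alpha ^+ 2 * (cH i x / etaH i)) *: EH R i)).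
set S := \sum_(i < N) _ ^+ 2 / _.
have -> : \sum_(i < N) innerH ((2 / alpha ^+ 2 * (cH i x / etaH i)) *: EH R i) x
  = 2 / alpha ^+ 2 * S.
  rewrite /S mulr_sumr; apply: eq_bigr => i _; rewrite innerHZl innerHC -/(cH i x) expr2; ring.
have -> : \sum_(i < N) etaH i * (2 / alpha ^+ 2 * (cH i x / etaH i)) ^+ 2 = 4 / alpha ^+ 4 * S.
  rewrite /S mulr_sumr; apply: eq_bigr => i _.
  have [->|h] := eqVneq (etaH i) 0; first by rewrite invr0 !mulr0 mul0r.
  by field; rewrite h gt_eqF.
have -> : 2 / alpha ^+ 2 * S - alpha ^+ 2 / 4 * (4 / alpha ^+ 4 * S) = alpha ^- 2 * S.
  by field; rewrite gt_eqF.
by rewrite ler_pdivrMl ?exprn_gt0.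
Qed.

Lemma rate_ge0 x : (0 <= I x)%E.
Proof.
rewrite /rate; case: ifP => // _; rewrite lee_fin.
by rewrite mulr_ge0 ?sqr_ge0 // invr_ge0 sqr_ge0.
Qed.

Lemma rate_gt_dual x (a : R) : (a%:E < I x)%E ->
  exists xi, a < innerH xi x - Lam xi.
Proof.
move=> xa; apply/not_existsP => H; move: xa; rewrite ltNge => /negP; apply.
by apply: dual_rate_le => xi; rewrite leNgt; apply/negP => h; apply: (H xi).
Qed.

Lemma dual_rate_gt x (a : R) xi : a < innerH xi x - Lam xi -> (a%:E < I x)%E.
Proof.
move=> xa; rewrite ltNge; apply/negP => /rate_le_dual /(_ xi).
by rewrite leNgt xa.
Qed.

Lemma open_halfspace xi (a : R) : open [set x | a < innerH xi x - Lam xi].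
Proof.
have -> : [set x | a < innerH xi x - Lam xi]
  = (fun x => innerH x xi) @^-1` [set t | a + Lam xi < t].
  by apply/seteqP; split => x /=; rewrite innerHC ltrBrDr.
by apply: open_comp; [move=> x _; exact: innerH_continuous|exact: open_gt].
Qed.

Lemma rate_lsc : lower_semicontinuous I.
Proof.
move=> x a /rate_gt_dual[xi xia]; exists [set x | a < innerH xi x - Lam xi].
  by apply: open_nbhs_nbhs; split => //; exact: open_halfspace.
by move=> y /=; exact: dual_rate_gt.
Qed.

Lemma closed_rate_le (a : R) : closed [set x | (I x <= a%:E)%E].
Proof.
rewrite -openC [X in open X](_ : _ = \bigcup_xi [set x | a < innerH xi x - Lam xi]).
  by apply: bigcup_open => xi _; exact: open_halfspace.
apply/seteqP; split => x /=.
  by move/negP; rewrite -ltNge => /rate_gt_dual[xi H]; exists xi.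
by move=> [xi _ /dual_rate_gt]; rewrite ltNge => /negP.
Qed.

Lemma rate_lower_approx x (a delta : R) : (I x <= a%:E)%E -> 0 < delta ->
  exists xi x', [/\ Lam xi <= a, `|x - x'| < delta
    & forall zeta, innerH zeta x' = alpha ^+ 2 / 2 * innerH (QH zeta) (QH xi)].
Proof.
move=> /rate_le_dom[x0 xC] d0.
have /cvgrPdist_lt/(_ _ (exprn_gt0 2 d0))[N _ NP] := @parseval R x.
pose g i := 2 / alpha ^+ 2 * (cH i x / etaH i).
exists (\sum_(i < N) g i *: EH R i), (\sum_(i < N) cH i x *: EH R i); split.
- rewrite qform_sum.
  have -> : \sum_(i < N) etaH i * g i ^+ 2 = 4 / alpha ^+ 4 * \sum_(i < N) cH i x ^+ 2 / etaH i.
    rewrite mulr_sumr; apply: eq_bigr => i _; rewrite /g.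
    have [->|h] := eqVneq (etaH i) 0; first by rewrite invr0 !mulr0 mul0r.
    by field; rewrite h gt_eqF.
  have -> : forall S : R, alpha ^+ 2 / 4 * (4 / alpha ^+ 4 * S) = alpha ^- 2 * S.
    by move=> S; field; rewrite gt_eqF.
  by rewrite ler_pdivrMl ?exprn_gt0.
- apply: le_lt_trans (norm_le_Hnorm _) _.
  rewrite -(@ltr_pXn2r _ 2) ?nnegrE ?Hnorm_ge0 ?ltW // pythagoras.
  by apply: le_lt_trans (ler_norm _) (NP N (leqnn N)).
move=> zeta; rewrite QH_sym.
rewrite -[innerH zeta _]innerHC (innerH_suml _ (fun i : 'I_N => cH i x *: EH R i)).
rewrite -[innerH zeta (QH _)]innerHC.
rewrite (big_morph QH QHD (id1 := 0)); last by rewrite /complexify /= Qhalf0.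
rewrite (big_morph QH QHD (id1 := 0)); last by rewrite /complexify /= Qhalf0.
rewrite (innerH_suml _ (fun i : 'I_N => QH (QH (g i *: EH R i)))) mulr_sumr.
apply: eq_bigr => i _; rewrite !(QHZ, QH_EH) !innerHZl /g.
have [h|h] := eqVneq (etaH i) 0; first by rewrite x0 // h !mul0r !mulr0 mul0r mulr0.
rewrite !mulrA -[_ * Num.sqrt _ * Num.sqrt _]mulrA -expr2 sqr_sqrtr ?etaH_ge0 //.
by field; rewrite h gt_eqF.
Qed.

End covariance.

(** * Exponential estimates *)

Lemma weight_sequence (R : realType) (a : nat -> R) (C : R) :
  (forall n, 0 < a n) -> (forall N, \sum_(i < N) a i <= C) ->
  exists r : nat -> R, [/\ forall n, 0 < r n, nonincreasing_seq r, r n @[n --> \oo] --> (0 : R)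
    & exists C', 0 < C' /\ forall N, \sum_(i < N) a i / r i <= C'].
Proof.
move=> a0 aC.
pose s N := \sum_(i < N) a i.
have s_S n : s n.+1 = s n + a n by rewrite /s big_ord_recr.
have s_nd : nondecreasing_seq s.
  by apply/nondecreasing_seqP => n; rewrite s_S lerDl ltW.
have s_cvg : cvgn s.
  by apply: nondecreasing_is_cvgn => //; exists C => _ [n _ <-]; exact: aC.
pose L := limn s.
pose r n := Num.sqrt (L - s n).
have sL n : 0 < L - s n.
  rewrite subr_gt0; apply: (@lt_le_trans _ _ (s n.+1)); first by rewrite s_S ltrDl.
  exact: nondecreasing_cvgn_le.
have r0 n : 0 < r n by rewrite sqrtr_gt0.
have r2 n : r n ^+ 2 = L - s n by rewrite sqr_sqrtr // ltW.
have rd : nonincreasing_seq r.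
  by move=> n m nm; rewrite /r ler_wsqrtr // lerD2l lerN2; exact: s_nd.
have ar n : a n / r n <= 2 * (r n - r n.+1).
  rewrite ler_pdivrMr //.
  have -> : a n = r n ^+ 2 - r n.+1 ^+ 2 by rewrite !r2 s_S; ring.
  have := rd n n.+1 (leqnSn n); have := r0 n; have := r0 n.+1; nra.
exists r; split => //.
- have : L - s n @[n --> \oo] --> L - L by apply: cvgB; [exact: cvg_cst|exact: s_cvg].
  rewrite subrr => H; rewrite -[X in _ --> X]sqrtr0.
  by apply: (continuous_cvg _ _ H); exact: sqrt_continuous.
exists (2 * r 0%N); split; first by rewrite mulr_gt0.
move=> N; suff : \sum_(i < N) a i / r i <= 2 * (r 0%N - r N).
  by move=> /le_trans; apply; rewrite ler_wpM2l // lerBlDr lerDl ltW.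
elim: N => [|N IH]; first by rewrite big_ord0 subrr mulr0.
rewrite big_ord_recr /=; have := ar N; lra.
Qed.

Section expectations.
Context d (Omega : measurableType d) (R : realType).
Variable P : probability Omega R.

Lemma random_element_continuous (V : normedModType R) (X : Omega -> V) (f : V -> R) :
  random_element X -> continuous f -> measurable_fun setT (f \o X).
Proof.
move=> mX cf; apply: (measurability _ (RGenOInfty.measurableE R)) => _ [_ [x ->] <-].
have := mX measurableT (f @^-1` `]x, +oo[%classic); apply.
apply: sub_sigma_algebra; apply: open_comp; first by move=> y _; exact: cf.
exact: itv_open_ends_open.
Qed.

Lemma random_element_open (V : normedModType R) (X : Omega -> V) (G : set V) :
  random_element X -> open G -> measurable (X @^-1` G).
Proof.
move=> mX oG; rewrite -[X @^-1` G]setTI; apply: mX => //.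
exact: sub_sigma_algebra.
Qed.

Lemma random_element_closed (V : normedModType R) (X : Omega -> V) (G : set V) :
  random_element X -> closed G -> measurable (X @^-1` G).
Proof.
move=> mX /closed_openC cG; rewrite -[X @^-1` G]setCK; apply: measurableC.
by rewrite preimage_setC; exact: random_element_open.
Qed.

Lemma markov_le (A : set Omega) (g : Omega -> R) :
  measurable A -> measurable_fun setT g -> (forall w, 0 <= g w) ->
  (forall w, A w -> 1 <= g w) -> (P A <= \int[P]_w (g w)%:E)%E.
Proof.
move=> mA mg g0 gA; have -> : P A = (\int[P]_w (\1_A w)%:E)%E by rewrite integral_indic // setIT.
apply: ge0_le_integral => //.
- by apply/measurable_EFinP; exact: measurable_indic.
- exact/measurable_EFinP.
- move=> w _; rewrite lee_fin indicE; case: (boolP (w \in A)) => [/set_mem/gA//|_].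
  exact: g0.
Qed.

Lemma integral_expRD (f : Omega -> R) (c : R) : measurable_fun setT f ->
  (\int[P]_w (expR (c + f w))%:E = (expR c)%:E * \int[P]_w (expR (f w))%:E)%E.
Proof.
move=> mf; rewrite -ge0_integralZl //.
- by apply: eq_integral => w _; rewrite expRD EFinM.
- by apply/measurable_EFinP; apply: measurableT_comp.
Qed.

(* The term with [j <= |x| < j + 1] is enough. *)
Lemma expR_sqr_le_series (x : R) :
  ((expR (x ^+ 2 / 8))%:E <=
   \sum_(j <oo) (expR (j.+1%:R ^+ 2 / 8 - j%:R ^+ 2) * (expR (j%:R * x) + expR (- j%:R * x)))%:E)%E.
Proof.
pose j := Num.truncn `|x|.
have /andP[jx xj] : j%:R <= `|x| < j.+1%:R by apply: truncn_itv.
pose t j := (expR (j.+1%:R ^+ 2 / 8 - j%:R ^+ 2) * (expR (j%:R * x) + expR (- j%:R * x)))%:E.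
have t0 i : (0 <= t i)%E by rewrite lee_fin mulr_ge0 ?addr_ge0 ?expR_ge0.
apply: (@le_trans _ _ (t j)); last first.
  apply: le_trans (nneseries_lim_ge j.+1 _); last by move=> *; exact: t0.
  by rewrite big_nat_recr //= leeDr // sume_ge0.
rewrite lee_fin.
have h : expR (j%:R ^+ 2) <= expR (j%:R * x) + expR (- j%:R * x).
  have : expR (j%:R ^+ 2) <= expR (j%:R * `|x|).
    by rewrite ler_expR expr2 ler_wpM2l.
  move=> /le_trans; apply; have [x0|x0] := leP 0 x.
    by rewrite (ger0_norm x0) lerDl expR_ge0.
  by rewrite (ltr0_norm x0) mulrN mulNr lerDr expR_ge0.
apply: le_trans (ler_wpM2l (expR_ge0 _) h).
rewrite -expRD subrK ler_expR ler_pM2r ?invr_gt0 //.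
by rewrite -(real_normK (num_real x)) lerXn2r ?nnegrE // ltW.
Qed.

Lemma subgaussian_sqr : exists2 K : R, 0 <= K & forall (g : Omega -> R) (V : R),
  measurable_fun setT g -> 0 < V ->
  (forall s : R, \int[P]_w (expR (s * g w))%:E <= (expR (s ^+ 2 * V / 2))%:E)%E ->
  (\int[P]_w (expR (g w ^+ 2 / (8 * V)))%:E <= K%:E)%E.
Proof.
exists (2 * expR 2 * 2); first by rewrite !mulr_ge0 // expR_ge0.
move=> g V mg V0 gV.
pose sV := Num.sqrt V.
have sV0 : 0 < sV by rewrite sqrtr_gt0.
have mgV : measurable_fun setT (fun w => g w / sV) by exact: measurable_funM.
pose t j w := (expR (j.+1%:R ^+ 2 / 8 - j%:R ^+ 2) * (expR (j%:R * (g w / sV))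
  + expR (- j%:R * (g w / sV))))%:E.
have mE (c : R) : measurable_fun setT (fun w => (expR (c * (g w / sV)))%:E).
  apply/measurable_EFinP; apply: measurableT_comp => //.
  exact: measurable_funM.
have mt j : measurable_fun setT (t j).
  apply/measurable_EFinP; apply: measurable_funM => //.
  by apply: measurable_funD; exact/measurable_EFinP/mE.
have t0 j w : (0 <= t j w)%E by rewrite lee_fin mulr_ge0 ?addr_ge0 ?expR_ge0.
apply: (@le_trans _ _ (\int[P]_w (\sum_(j <oo) t j w))%E).
  apply: ge0_le_integral => //.
  - apply/measurable_EFinP; apply: measurableT_comp => //.
    by apply: measurable_funM => //; exact: measurable_funX.
  - exact: ge0_emeasurable_sum.
  - move=> w _; have -> : g w ^+ 2 / (8 * V) = (g w / sV) ^+ 2 / 8.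
      by rewrite expr_div_n sqr_sqrtr ?ltW //; field; rewrite gt_eqF.
    exact: expR_sqr_le_series.
rewrite integral_nneseries //.
have tj j : (\int[P]_w t j w <= (2 * expR 2 * 2^-1 ^+ j)%:E)%E.
  have Es (c : R) : (\int[P]_w (expR (c * (g w / sV)))%:E <= (expR (c ^+ 2 / 2))%:E)%E.
    have := gV (c / sV).
    have -> : (c / sV) ^+ 2 * V / 2 = c ^+ 2 / 2.
      by rewrite expr_div_n sqr_sqrtr ?ltW //; field; rewrite gt_eqF.
    by move=> H; apply: le_trans H; under eq_integral do rewrite mulrA mulrAC.
  rewrite /t; under eq_integral do rewrite EFinM EFinD.
  rewrite ge0_integralZl //; first last.
  - by move=> w _; rewrite -EFinD lee_fin addr_ge0 ?expR_ge0.
  - exact: emeasurable_funD.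
  rewrite ge0_integralD //; [|by move=> w _; rewrite lee_fin expR_ge0..].
  apply: (@le_trans _ _ ((expR (j.+1%:R ^+ 2 / 8 - j%:R ^+ 2))%:E *
    ((expR (j%:R ^+ 2 / 2))%:E + (expR ((- j%:R) ^+ 2 / 2))%:E))%E).
    by apply: lee_wpmul2l; [rewrite lee_fin expR_ge0|apply: leeD; exact: Es].
  rewrite sqrrN -EFinD -EFinM lee_fin.
  set A := expR (_ - _); set B := expR (_ / 2).
  have -> : A * (B + B) = 2 * (A * B) by ring.
  rewrite -mulrA ler_wpM2l // /A /B -expRD.
  have -> : 2^-1 ^+ j = (2 ^+ j)^-1 :> R by rewrite exprVn.
  have e2 : 2 <= expR 1 :> R by have := expR_ge1Dx (1 : R); lra.
  apply: (@le_trans _ _ (expR 2 * expR (- j%:R))).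
    rewrite -expRD ler_expR -natr1.
    have := sqr_ge0 (j%:R - 5 / 3 : R); rewrite !expr2 => H; nra.
  rewrite ler_wpM2l ?expR_ge0 // expRN lef_pV2 ?posrE ?expR_gt0 ?exprn_gt0 //.
  rewrite -[X in expR X]mul1r expRM_natr lerXn2r ?nnegrE ?expR_ge0 //.
apply: (@le_trans _ _ (\sum_(j <oo) (2 * expR 2 * 2^-1 ^+ j)%:E)%E).
  apply: lee_nneseries => [j _ _|j _]; last exact: tj.
  by apply: integral_ge0 => w _; exact: t0.
apply: lime_le.
  by apply: is_cvg_nneseries => n _ _; rewrite lee_fin !mulr_ge0 ?expR_ge0 // exprn_ge0 // invr_ge0.
apply: nearW => n; rewrite sumEFin lee_fin -mulr_sumr ler_wpM2l ?mulr_ge0 ?expR_ge0 //.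
by have := @geometric_half_sum R 0 n (leq0n n); rewrite expr0 mulr1.
Qed.

Lemma jensen_expR (N : nat) (p y : nat -> R) : (forall i, 0 <= p i) ->
  \sum_(i < N) p i <= 1 ->
  expR (\sum_(i < N) p i * y i) <= 1 + \sum_(i < N) p i * expR (y i).
Proof.
move=> p0 p1; set z := \sum_(i < N) p i * y i; set S := \sum_(i < N) p i.
have h : \sum_(i < N) p i * (expR z * (1 + y i - z)) <= \sum_(i < N) p i * expR (y i).
  apply: ler_sum => i _; rewrite ler_wpM2l //.
  have := expR_ge1Dx (y i - z); rewrite addrA => /(ler_wpM2l (expR_ge0 z)) /le_trans; apply.
  by rewrite -expRD addrC subrK.
have hE : \sum_(i < N) p i * (expR z * (1 + y i - z)) = expR z * (S + z - z * S).
  rewrite -[in RHS]/z /z /S -/z !mulr_sumr -big_split /= -sumrB mulr_sumr.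
  by apply: eq_bigr => i _; ring.
have h1 : expR z * (1 - z) <= 1.
  have := expR_ge1Dx (- z) => /(ler_wpM2l (expR_ge0 z)).
  by rewrite expRxMexpNx_1.
have h2 : (1 - S) * (expR z * (1 - z)) <= 1 - S by rewrite ler_piMr // subr_ge0.
have S0 : 0 <= S by apply: sumr_ge0 => i _.
have : expR z = (1 - S) * (expR z * (1 - z)) + expR z * (S + z - z * S) by ring.
rewrite hE in h; lra.
Qed.

End expectations.

(** * Large deviations from the moment generating function *)

Lemma limf_esup_le (R : realType) (f : R -> \bar R) (c : \bar R) (T0 : R) :
  (forall T : R, (T0 < T)%R -> (f T <= c)%E) -> (limf_esup f (pinfty_nbhs R) <= c)%E.
Proof.
move=> fc; rewrite limf_esupE.
apply: (@le_trans _ _ (ereal_sup [set f x | x in [set x | T0 < x]])).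
  apply: ereal_inf_lbound; exists [set x | T0 < x] => //.
  by exists T0; split; rewrite ?num_real.
by apply: ge_ereal_sup => _ [T /= TT0 <-]; exact: fc.
Qed.

Lemma limf_einf_ge (R : realType) (f : R -> \bar R) (c : \bar R) (T0 : R) :
  (forall T : R, (T0 < T)%R -> (c <= f T)%E) -> (c <= limf_einf f (pinfty_nbhs R))%E.
Proof.
move=> fc; rewrite limf_einfE.
apply: (@le_trans _ _ (ereal_inf [set f x | x in [set x | T0 < x]])).
  by apply: le_ereal_inf_tmp => _ [T /= TT0 <-]; exact: fc.
apply: ereal_sup_ubound; exists [set x | T0 < x] => //.
by exists T0; split; rewrite ?num_real.
Qed.

Lemma ereal_le_from_below (R : realType) (l L : \bar R) :
  (forall a : R, a%:E < l -> a%:E <= L)%E -> (l <= L)%E.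
Proof.
move=> H; case: l H => [l| |] H; last exact: leNye.
- apply/lee_addgt0Pr => eps eps0.
  rewrite -leeBlDr // -EFinB; apply: H.
  by rewrite lte_fin ltrBlDr ltrDl.
- case: L H => [L| |] H //.
  + by have := H (L + 1) (ltry _); rewrite lee_fin gerDl ler10.
  + by have := H 0 (ltry _).
Qed.

Lemma sqrD_le (R : realType) (x y a : R) :
  y ^+ 2 <= a -> (x + y) ^+ 2 <= 2 * x ^+ 2 + 2 * a.
Proof. by move=> ya; have := sqr_ge0 (x - y); rewrite sqrrB sqrrD => H; lra. Qed.

Lemma scaled_sqrD_le (R : realType) (lam T r g c a : R) :
  0 < lam -> 1 <= T -> 0 < r -> c ^+ 2 <= a ->
  lam * T * (((g + c) / T) ^+ 2 / r) <= 2 * (lam / (T * r)) * g ^+ 2 + 2 * lam * (a / r).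
Proof.
move=> l0 T1 r0 ca; have T0 : 0 < T by exact: lt_le_trans T1.
have a0 : 0 <= a by apply: le_trans ca; exact: sqr_ge0.
have K0 : 0 <= lam / (T * r) by apply: ltW; rewrite divr_gt0 // mulr_gt0.
have -> : lam * T * (((g + c) / T) ^+ 2 / r) = lam / (T * r) * (g + c) ^+ 2.
  by field; rewrite !gt_eqF.
apply: le_trans (ler_wpM2l K0 (sqrD_le g ca)) _.
have -> : lam / (T * r) * (2 * g ^+ 2 + 2 * a) =
    2 * (lam / (T * r)) * g ^+ 2 + 2 * lam * (a / r) * T^-1 by field; rewrite !gt_eqF.
rewrite lerD2l ler_piMr ?invf_le1 //.
by rewrite !mulr_ge0 ?invr_ge0 // ltW.
Qed.

Lemma half_absorb (R : realType) (x y : R) : x <= y + 2^-1 * x -> 2^-1 * x <= y.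
Proof. lra. Qed.

Lemma expR_combine (R : realType) (h a b c m : R) : 0 <= h -> a + (b + c) <= m ->
  expR a * (h * expR b * expR c) <= h * expR m.
Proof.
move=> h0 abc; have -> : expR a * (h * expR b * expR c) = h * expR (a + (b + c)).
  by rewrite !expRD; ring.
by rewrite ler_wpM2l // ler_expR.
Qed.

Lemma cancel_bound (R : realType) (x y z w : R) : x <= y ->
  2 * x + z + (- w - (y + z)) <= x - w.
Proof. lra. Qed.

Section rates.
Variable R : realType.

Lemma rate_upper (p : \bar R) (K a eps T : R) : (0 <= p)%E -> 0 < K -> 0 < eps -> 1 <= T ->
  `|ln K| / eps <= T -> (p <= (K * expR (- (T * a)))%:E)%E ->
  ((T^-1)%:E * lne p <= (eps - a)%:E)%E.
Proof.
move=> p0 K0 eps0 T1 TK pK.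
have T0 : 0 < T by exact: lt_le_trans T1.
have Ke : 0 < K * expR (- (T * a)) by rewrite mulr_gt0 // expR_gt0.
apply: (@le_trans _ _ ((T^-1)%:E * (ln (K * expR (- (T * a))))%:E)%E).
  apply: lee_wpmul2l; first by rewrite lee_fin invr_ge0 ltW.
  rewrite -lne_EFin // lee_lne ?in_itv /= ?p0 ?leey //.
  by rewrite lee_fin ltW.
rewrite -EFinM lee_fin lnM ?posrE ?expR_gt0 // expRK mulrDr mulrN mulKf ?gt_eqF //.
rewrite lerD2r ler_pdivrMl //.
by apply: le_trans (ler_norm _) _; rewrite -ler_pdivrMr.
Qed.

Lemma rate_lower (p : \bar R) (K a eps T : R) : 0 < K -> 0 < eps -> 1 <= T ->
  `|ln K| / eps <= T -> ((K * expR (- (T * a)))%:E <= p)%E ->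
  ((- a - eps)%:E <= (T^-1)%:E * lne p)%E.
Proof.
move=> K0 eps0 T1 TK pK.
have T0 : 0 < T by exact: lt_le_trans T1.
have Ke : 0 < K * expR (- (T * a)) by rewrite mulr_gt0 // expR_gt0.
apply: (@le_trans _ _ ((T^-1)%:E * (ln (K * expR (- (T * a))))%:E)%E); last first.
  apply: lee_wpmul2l; first by rewrite lee_fin invr_ge0 ltW.
  rewrite -lne_EFin // lee_lne ?in_itv /= ?leey ?andbT //.
    by rewrite lee_fin ltW.
  by apply: le_trans pK; rewrite lee_fin ltW.
rewrite -EFinM lee_fin lnM ?posrE ?expR_gt0 // expRK mulrDr mulrN mulKf ?gt_eqF //.
rewrite addrC lerD2r // lerNl -mulrN ler_pdivrMl //.
by apply: le_trans (ler_norm _) _; rewrite normrN -ler_pdivrMr.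
Qed.

End rates.

Section LDP.
Context d (Omega : measurableType d) (R : realType) (P : probability Omega R).
Variables (eta : nat -> R) (Q Qhalf : U0 R -> U0 R) (alpha : R).
Hypothesis eta_ge0 : forall k, 0 <= eta k.
Hypothesis Q_e : forall k, Q (e R k) = eta k *: e R k.
Hypothesis QhalfQ : sqrt_op Qhalf Q.
Hypothesis Qhalf_HS : hilbert_schmidt_U1 Qhalf.
Hypothesis alpha_gt0 : 0 < alpha.
Variables (u : R -> Omega -> H0 R) (v : R -> H0 R) (bb : nat -> R) (Cb : R).
Hypothesis mu_u : forall T, 1 <= T -> random_element (u T).
Hypothesis bb_ge : forall T n, 1 <= T -> cH n (v T) ^+ 2 <= bb n.
Hypothesis bb_sum : forall N, \sum_(i < N) bb i <= Cb.
Local Notation q := (qform Qhalf).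
Local Notation QH := (complexify Qhalf).
Hypothesis mgf_u : forall T zeta, 1 <= T -> exists w : R,
  (\int[P]_x (expR (innerH zeta (u T x)))%:E = (expR w)%:E)%E /\
  `|w - (innerH zeta (v T) + alpha ^+ 2 * T / 4 * q zeta)| <= alpha ^+ 2 / 2 * q zeta.
Local Notation Lam xi := (alpha ^+ 2 / 4 * q xi).
Local Notation I := (rate alpha Qhalf).
Local Notation et := (etaH eta).

Lemma Hnorm_v : exists2 K, 0 <= K & forall T, 1 <= T -> Hnorm (v T) <= K.
Proof.
have Cb0 : 0 <= Cb by have := bb_sum 0; rewrite big_ord0.
exists (Num.sqrt Cb); first exact: sqrtr_ge0.
move=> T T1; rewrite -(@ler_pXn2r _ 2) ?nnegrE ?Hnorm_ge0 ?sqrtr_ge0 // (sqr_sqrtr Cb0).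
by apply: Hnorm2_le => N; apply: le_trans (bb_sum N); apply: ler_sum => i _; exact: bb_ge.
Qed.

Lemma measurable_innerH_u T zeta : 1 <= T ->
  measurable_fun setT (fun x => innerH zeta (u T x)).
Proof.
move=> T1; rewrite (_ : (fun x => _) = (fun z => innerH z zeta) \o u T).
  by apply: random_element_continuous; [exact: mu_u|exact: innerH_continuous].
by apply/funext => x /=; rewrite innerHC.
Qed.

Lemma measurable_expR_u T zeta : 1 <= T ->
  measurable_fun setT (fun x => expR (innerH zeta (u T x))).
Proof. by move=> T1; apply: measurableT_comp => //; exact: measurable_innerH_u. Qed.

Lemma scaler_cont (c : R) : continuous (fun y : H0 R => c *: y).
Proof. by move=> y; apply: cvgZr; exact: cvg_id. Qed.

Lemma measurable_open_u T (G : set (H0 R)) : 1 <= T -> open G ->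
  measurable ((fun x => T^-1 *: u T x) @^-1` G).
Proof.
move=> T1 oG; have := @random_element_open _ _ _ _ (u T) ((fun y => T^-1 *: y) @^-1` G) (mu_u T1).
apply; apply: open_comp => // y _; exact: scaler_cont.
Qed.

Lemma measurable_closed_u T (G : set (H0 R)) : 1 <= T -> closed G ->
  measurable ((fun x => T^-1 *: u T x) @^-1` G).
Proof.
move=> T1 cG; have := @random_element_closed _ _ _ _ (u T) ((fun y => T^-1 *: y) @^-1` G) (mu_u T1).
apply; apply: closed_comp => // y _; exact: scaler_cont.
Qed.

Lemma halfspace_bound xi (a : R) : exists2 K : R, 0 < K & forall T : R, 1 <= T ->
  (P ((fun x => T^-1 *: u T x) @^-1` [set y | (a < innerH xi y - Lam xi)%R])
   <= (K * expR (- (T * a)))%:E)%E.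
Proof.
have [K K0 vK] := Hnorm_v.
exists (expR (Hnorm xi * K + alpha ^+ 2 / 2 * q xi)); first exact: expR_gt0.
move=> T T1; have T0 : 0 < T by exact: lt_le_trans T1.
have [w [wE wB]] := mgf_u xi T1.
apply: (@le_trans _ _ (\int[P]_x (expR (- (T * (a + Lam xi)) + innerH xi (u T x)))%:E)%E).
  apply: markov_le.
  - by apply: measurable_open_u => //; exact: open_halfspace.
  - by apply: measurableT_comp => //; apply: measurable_funD => //; exact: measurable_innerH_u.
  - by move=> x; exact: expR_ge0.
  - move=> x /=; rewrite innerHZr ltrBrDr ltr_pdivlMl // => H.
    by rewrite -[leLHS]expR0 ler_expR [leRHS]addrC subr_ge0 ltW.
rewrite integral_expRD; last exact: measurable_innerH_u.
rewrite wE -EFinM lee_fin -!expRD ler_expR.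
have h1 : innerH xi (v T) <= Hnorm xi * K.
  apply: le_trans (ler_norm _) _; apply: le_trans (cauchy_schwarzH _ _) _.
  by rewrite ler_wpM2l ?Hnorm_ge0 // vK.
move: wB; rewrite ler_norml => /andP[_ wB].
have : alpha ^+ 2 * T / 4 * q xi = T * Lam xi by field.
set L := T * Lam xi => E; rewrite E in wB.
rewrite mulrDr -/L; lra.
Qed.

Definition aw (n : nat) : R := et n + bb n + 2^-1 ^+ n.

Lemma bb_ge0 n : 0 <= bb n.
Proof. by apply: le_trans (bb_ge n (lexx 1)); exact: sqr_ge0. Qed.

Lemma aw_gt0 n : 0 < aw n.
Proof.
by rewrite /aw ltr_wpDl ?addr_ge0 ?bb_ge0 ?etaH_ge0 // exprn_gt0 // invr_gt0.
Qed.

Lemma etaH_le_aw n : et n <= aw n.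
Proof. by rewrite /aw -addrA lerDl addr_ge0 ?bb_ge0 // exprn_ge0 // invr_ge0. Qed.

Lemma bb_le_aw n : bb n <= aw n.
Proof. by rewrite /aw addrAC lerDr addr_ge0 ?etaH_ge0 // exprn_ge0 // invr_ge0. Qed.

Lemma aw_sum : exists C, forall N, \sum_(i < N) aw i <= C.
Proof.
have et0 n : 0 <= et n by exact: etaH_ge0.
have [Ce CeP] := eta_summable eta_ge0 Q_e QhalfQ Qhalf_HS.
have et_sum N : \sum_(i < N) et i <= 2 * Ce.
  apply: (@le_trans _ _ (\sum_(i < N.*2) et i)).
    have NN : (N <= N.*2)%N by rewrite -addnn leq_addr.
    rewrite -!(big_mkord xpredT et) (big_cat_nat (leq0n N) NN) /=.
    by rewrite lerDl sumr_ge0.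
  have -> : \sum_(i < N.*2) et i = 2 * \sum_(k < N) eta k.
    elim: N => [|N IH]; first by rewrite !big_ord0 mulr0.
    rewrite doubleS !big_ord_recr /= IH mulrDr /etaH /= uphalf_double doubleK; ring.
  by rewrite ler_pM2l.
exists (2 * Ce + Cb + 2) => N.
rewrite /aw !big_split /= !lerD ?et_sum ?bb_sum //.
by have := @geometric_half_sum R 0 N (leq0n N); rewrite expr0 mulr1 big_mkord.
Qed.

(* [aw n] bounds both the variance per unit of time and the squared mean of the
   n-th coordinate of [u T]; [r] decreases so slowly that [aw n / r n] is
   summable, and Jensen's inequality with these weights reduces the
   exponential moment of the weighted sum of squares to single coordinates. *)
Lemma exponential_tightness : exists r : nat -> R,
  [/\ forall n, 0 < r n, nonincreasing_seq r, r n @[n --> \oo] --> (0 : R),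
   exists C, 0 < C /\ forall n, et n <= C * r n &
   exists K lam, [/\ 0 < K, 0 < lam & forall T b, 1 <= T ->
     (P ((fun x => T^-1 *: u T x) @^-1` (~` ellipsoid r b))
       <= (K * expR (- (T * (lam * b))))%:E)%E]].
Proof.
pose a := aw.
have et0 n : 0 <= et n by exact: etaH_ge0.
have a0 : forall n, 0 < a n by exact: aw_gt0.
have [Ca aC] : exists C, forall N, \sum_(i < N) a i <= C by exact: aw_sum.
have [r [r0 rd rc [C' [C'0 rC]]]] := weight_sequence a0 aC.
have ar n : a n / r n <= C'.
  apply: le_trans (rC n.+1); rewrite big_ord_recr /= lerDr sumr_ge0 // => i _.
  by rewrite divr_ge0 // ltW.
exists r; split => //.
  exists C'; split => // n; rewrite -ler_pdivrMr //; apply: le_trans (ar n).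
  by rewrite ler_pM2r ?invr_gt0 // etaH_le_aw.
have [K0 K00 sg] := subgaussian_sqr P.
pose kap := C'^-1.
have kap0 : 0 < kap by rewrite invr_gt0.
pose lam := kap / (32 * alpha ^+ 2).
have a2 : 0 < alpha ^+ 2 by rewrite exprn_gt0.
have lam0 : 0 < lam by rewrite divr_gt0 // mulr_gt0.
exists ((1 + K0) * expR (2 * lam * C')), lam; split => //.
  by rewrite mulr_gt0 ?expR_gt0 // ltr_wpDr.
move=> T b T1; have T0 : 0 < T by exact: lt_le_trans T1.
pose X x := T^-1 *: u T x.
pose J N y := \sum_(i < N) cH i y ^+ 2 / r i.
have cJ N : continuous (J N).
  move=> y; apply: (@cvg_sum_ord _ _ (nbhs y) N (fun i x => cH i x ^+ 2 / r i)
    (fun i => cH i y ^+ 2 / r i)) => i.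
  apply: cvgM; last exact: cvg_cst.
  by rewrite expr2; apply: cvgM; exact: continuous_cH.
pose A N := [set y | b < J N y].
have oA N : open (A N).
  rewrite (_ : A N = J N @^-1` [set t | b < t]) //.
  by apply: open_comp; [move=> y _; exact: cJ|exact: open_gt].
have EA : ~` ellipsoid r b = \bigcup_N A N.
  apply/seteqP; split => y /=.
    by move=> /existsNP[N /negP]; rewrite -ltNge => H; exists N.
  by move=> [N _ /=] H1 /(_ N); rewrite leNgt H1.
pose g n x := cH n (u T x) - cH n (v T).
pose V n := 2 * alpha ^+ 2 * T * a n.
have V0 n : 0 < V n by rewrite !mulr_gt0.
have mg n : measurable_fun setT (g n).
  apply: measurable_funB => //.
  rewrite /cH; under eq_fun do rewrite innerHC; exact: measurable_innerH_u.
have gK n : (\int[P]_x (expR (g n x ^+ 2 / (8 * V n)))%:E <= K0%:E)%E.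
  apply: sg => // s.
  have [w [wE wB]] := mgf_u (s *: EH R n) T1.
  have -> : (\int[P]_x (expR (s * g n x))%:E
    = \int[P]_x (expR (- (s * cH n (v T)) + innerH (s *: EH R n) (u T x)))%:E)%E.
    apply: eq_integral => x _; rewrite /g innerHZl innerHC -/(cH n (u T x)).
    by congr (expR _)%:E; ring.
  rewrite integral_expRD; last exact: measurable_innerH_u.
  rewrite wE -EFinM lee_fin -expRD ler_expR.
  have qs : q (s *: EH R n) = s ^+ 2 * et n.
    have QHn := QH_EH eta_ge0 Q_e QhalfQ n.
    rewrite /qform (QHZ QhalfQ) QHn !HnormZ !exprMn !real_normK ?num_real //.
    by rewrite sqr_sqrtr // Hnorm2 EH_orthonormal eqxx mulr1.
  move: wB; rewrite innerHZl innerHC -/(cH n (v T)) qs ler_norml => /andP[_ wB].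
  have h : et n <= a n by exact: etaH_le_aw.
  have h2 : 0 <= s ^+ 2 by exact: sqr_ge0.
  have h3 : alpha ^+ 2 * s ^+ 2 * et n <= alpha ^+ 2 * s ^+ 2 * a n.
    by rewrite ler_wpM2l // mulr_ge0 // (ltW a2).
  have h5 : 0 <= alpha ^+ 2 * s ^+ 2 * et n by apply: mulr_ge0 => //; apply: mulr_ge0 => //;
    exact: ltW.
  have h4 : alpha ^+ 2 * s ^+ 2 * et n <= T * (alpha ^+ 2 * s ^+ 2 * et n) by rewrite ler_peMl.
  have h6 : T * (alpha ^+ 2 * s ^+ 2 * et n) <= T * (alpha ^+ 2 * s ^+ 2 * a n).
    by rewrite ler_pM2l.
  have -> : s ^+ 2 * V n / 2 = T * (alpha ^+ 2 * s ^+ 2 * a n) by rewrite /V; field.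
  have E1 : alpha ^+ 2 * T / 4 * (s ^+ 2 * et n)
    = 4^-1 * (T * (alpha ^+ 2 * s ^+ 2 * et n)) by field.
  have E2 : alpha ^+ 2 / 2 * (s ^+ 2 * et n) = 2^-1 * (alpha ^+ 2 * s ^+ 2 * et n) by field.
  rewrite E1 E2 in wB; lra.
pose p n := kap * (a n / r n).
have p0 n : 0 <= p n by rewrite mulr_ge0 ?divr_ge0 // ltW.
have p1 N : \sum_(i < N) p i <= 1.
  by rewrite -mulr_sumr /kap ler_pdivrMl // mulr1.
have bound N : (P (X @^-1` A N)
  <= ((1 + K0) * expR (2 * lam * C') * expR (- (T * (lam * b))))%:E)%E.
  pose c0 := 2 * lam * C' - T * (lam * b).
  pose Gf x := expR c0 * (1 + \sum_(i < N) p i * expR (g i x ^+ 2 / (8 * V i))).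
  have mexp i : measurable_fun setT (fun x => expR (g i x ^+ 2 / (8 * V i))).
    apply: measurableT_comp => //; apply: measurable_funM => //; exact: measurable_funX.
  have msum : measurable_fun setT (fun x => \sum_(i < N) p i * expR (g i x ^+ 2 / (8 * V i))).
    by apply: measurable_sum => i; exact: measurable_funM.
  have mG : measurable_fun setT Gf.
    by apply: measurable_funM => //; exact: measurable_funD.
  have s0 x : 0 <= \sum_(i < N) p i * expR (g i x ^+ 2 / (8 * V i)).
    by rewrite sumr_ge0 // => i _; rewrite mulr_ge0 ?expR_ge0.
  apply: (@le_trans _ _ (\int[P]_x (Gf x)%:E)%E).
    apply: markov_le => //; first exact: measurable_open_u.
      by move=> x; rewrite mulr_ge0 ?expR_ge0 // addr_ge0.
    move=> x /= bJ; rewrite /Gf.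
    have Jle : lam * T * J N (X x) <= \sum_(i < N) p i * (g i x ^+ 2 / (8 * V i)) + 2 * lam * C'.
      apply: (@le_trans _ _ (\sum_(i < N) (p i * (g i x ^+ 2 / (8 * V i))
        + 2 * lam * (a i / r i)))).
        rewrite /J mulr_sumr; apply: ler_sum => i _.
        have cE : cH i (X x) = (g i x + cH i (v T)) / T.
          by rewrite /X /cH innerHZl -!/(cH i _) /g subrK mulrC.
        rewrite cE.
        have vb : cH i (v T) ^+ 2 <= a i.
          exact: le_trans (bb_ge i T1) (bb_le_aw i).
        have -> : p i * (g i x ^+ 2 / (8 * V i)) = 2 * (lam / (T * r i)) * g i x ^+ 2.
          by rewrite /p /V /lam; field; rewrite !gt_eqF.
        exact: scaled_sqrD_le.
      by rewrite big_split /= lerD2l -mulr_sumr ler_wpM2l ?rC // mulr_ge0 // ltW.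
    have h1 : lam * T * b <= lam * T * J N (X x) by exact: (ler_wpM2l (ltW (mulr_gt0 lam0 T0))
      (ltW bJ)).
    apply: (@le_trans _ _ (expR (c0 + \sum_(i < N) p i * (g i x ^+ 2 / (8 * V i))))).
      rewrite -[leLHS]expR0 ler_expR /c0; have -> : T * (lam * b) = lam * T * b by ring.
      lra.
    rewrite expRD ler_wpM2l ?expR_ge0 //.
    exact: (jensen_expR (fun i => g i x ^+ 2 / (8 * V i)) p0 (p1 N)).
  have -> : (1 + K0) * expR (2 * lam * C') * expR (- (T * (lam * b))) = expR c0 * (1 + K0).
    by rewrite /c0 expRD; ring.
  rewrite /Gf; under eq_integral do rewrite EFinM.
  rewrite ge0_integralZl //; first last.
  - by move=> x _; rewrite lee_fin addr_ge0.
  - by apply/measurable_EFinP; exact: measurable_funD.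
  rewrite EFinM; apply: lee_wpmul2l; first by rewrite lee_fin expR_ge0.
  under eq_integral do rewrite EFinD.
  rewrite ge0_integralD //; first last.
  - exact/measurable_EFinP.
  - by move=> x _; rewrite lee_fin.
  have -> : (\int[P]__ 1 = 1)%E by rewrite integral_cst // mul1e; exact: probability_setT.
  rewrite EFinD leeD2l //.
  under eq_integral do rewrite -sumEFin.
  rewrite ge0_integral_sum //; first last.
  - by move=> i x _; rewrite lee_fin mulr_ge0 ?expR_ge0.
  - by move=> i; apply/measurable_EFinP; exact: measurable_funM.
  apply: (@le_trans _ _ (\sum_(i < N) (p i * K0)%:E)%E).
    apply: lee_sum => i _; under eq_integral do rewrite EFinM.
    rewrite ge0_integralZl //; first last.
    - by rewrite lee_fin.
    - exact/measurable_EFinP.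
    by rewrite (EFinM (p i) K0); apply: lee_wpmul2l; [rewrite lee_fin|exact: gK].
  by rewrite sumEFin lee_fin -mulr_suml ler_piMl.
rewrite EA preimage_bigcup.
have Acvg := @nondecreasing_cvg_mu _ _ _ P (fun N => X @^-1` A N).
have mXA N : measurable (X @^-1` A N) by exact: measurable_open_u.
have AS : {homo (fun N => X @^-1` A N) : n m / (n <= m)%N >-> (n <= m)%O}.
  move=> n m nm; apply/subsetPset => x /= bJ; apply: lt_le_trans bJ _.
  rewrite /J -!(big_mkord xpredT (fun i => cH i (X x) ^+ 2 / r i)) (big_cat_nat (leq0n n) nm) /=.
  by rewrite lerDl sumr_ge0 // => i _; rewrite divr_ge0 ?sqr_ge0 // ltW.
have {}Acvg := Acvg mXA (bigcup_measurable (fun N _ => mXA N)) AS.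
rewrite -(cvg_lim (@ereal_hausdorff R) Acvg); apply: lime_le.
  by apply/cvg_ex; eexists; exact: Acvg.
by apply: nearW => N; exact: bound.
Qed.

Lemma rate_good : good_rate_function I.
Proof.
split; first by move=> x; exact: rate_ge0.
  exact: (rate_lsc eta_ge0 Q_e QhalfQ alpha_gt0).
move=> a a0; have [r [r0 rd rc [C [C0 etC]] _]] := exponential_tightness.
apply: (@subclosed_compact _ _ (ellipsoid r (C * (alpha ^+ 2 * a)))).
- exact: (closed_rate_le eta_ge0 Q_e QhalfQ alpha_gt0).
- exact: compact_ellipsoid.
move=> x /= /(rate_le_dom eta_ge0 Q_e QhalfQ alpha_gt0)[x0 xC] N.
apply: le_trans (ler_wpM2l (ltW C0) (xC N)); rewrite mulr_sumr; apply: ler_sum => i _.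
have [h|h] := eqVneq (et i) 0; first by rewrite x0 // expr0n /= !mul0r mulr0.
rewrite mulrCA ler_wpM2l ?sqr_ge0 // -[leLHS]mul1r ler_pdivrMr // mulrAC.
rewrite ler_pdivlMr ?mul1r ?etC //.
by rewrite lt_neqAle eq_sym h etaH_ge0.
Qed.

Lemma LDP_upper (C : set (H0 R)) : closed C ->
  (limf_esup (fun T : R => (T^-1)%:E * lne (P ((fun x => T^-1 *: u T x) @^-1` C))) (pinfty_nbhs R)
   <= - ereal_inf (I @` C))%E.
Proof.
move=> cC; rewrite leeNr; apply: ereal_le_from_below => a aC; rewrite leeNr.
have Ca x : C x -> (a%:E < I x)%E.
  by move=> Cx; apply: lt_le_trans aC _; apply: ereal_inf_lbound; exists x.
have [r [r0 rd rc _ [K [lam [K0 lam0 tight]]]]] := exponential_tightness.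
pose b := a / lam.
have cE := @compact_ellipsoid R r b r0 rd rc.
have cCE : compact (C `&` ellipsoid r b).
  by rewrite setIC; apply: compact_closedI.
pose Hs xi := [set y | a < innerH xi y - Lam xi].
have [D _ cover] : finite_subset_cover [set: H0 R] Hs (C `&` ellipsoid r b).
  have := cCE; rewrite compact_cover; apply.
    by move=> xi _; exact: open_halfspace.
  move=> x [Cx _]; have [xi H] := rate_gt_dual eta_ge0 Q_e QhalfQ alpha_gt0 (Ca x Cx).
  by exists xi.
have [Kf KfP] := choice (fun xi => (let: ex_intro2 k k0 kP := halfspace_bound xi a in
  ex_intro (fun k => 0 < k /\ forall T : R, 1 <= T ->
  (P ((fun x => T^-1 *: u T x) @^-1` Hs xi) <= (k * expR (- (T * a)))%:E)%E) k (conj k0 kP))).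
pose KK := \sum_(xi <- enum_fset D) Kf xi + K.
have KK0 : 0 < KK.
  by rewrite /KK ltr_wpDl // sumr_ge0 // => xi _; have [/ltW] := KfP xi.
have bound T : 1 <= T ->
    (P ((fun x => (T^-1 *: u T x)%R) @^-1` C) <= (KK * expR (- (T * a)))%:E)%E.
  move=> T1; pose X x := T^-1 *: u T x.
  have mH xi : measurable (X @^-1` Hs xi) by apply: measurable_open_u => //; exact: open_halfspace.
  have mE : measurable (X @^-1` (~` ellipsoid r b)).
    by apply: measurable_open_u => //; apply: closed_openC; apply: compact_closed => //;
      exact: norm_hausdorff.
  have mC : measurable (X @^-1` C) by exact: measurable_closed_u.
  have mU : measurable (\big[setU/set0]_(xi <- enum_fset D) X @^-1` Hs xi).
    by apply: bigsetU_measurable => xi _; exact: mH.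
  apply: (@le_trans _ _ (P ((\big[setU/set0]_(xi <- enum_fset D) X @^-1` Hs xi) `|` X @^-1` (~`
    ellipsoid r b)))).
    apply: le_measure; rewrite ?inE //; first exact: measurableU.
    move=> w /= Cw; have [Ew|Ew] := pselect (ellipsoid r b (X w)); last by right.
    left; have [xi xiD Hw] := cover (X w) (conj Cw Ew).
    rewrite -bigcup_seq /=; exists xi => //.
  apply: le_trans (measureU2 _ mU mE) _.
  rewrite /KK mulrDl EFinD; apply: leeD; last first.
    by have lb : lam * b = a; [rewrite /b mulrC divfK ?gt_eqF|rewrite -lb; exact: tight].
  rewrite mulr_suml -sumEFin; apply: (@le_trans _ _ (\sum_(xi <- enum_fset D) P (X @^-1` Hs xi))%E).
    elim: (enum_fset D) => [|xi s IH]; first by rewrite !big_nil measure0.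
    rewrite !big_cons; apply: le_trans (measureU2 _ _ _) _ => //.
      by apply: bigsetU_measurable => xi' _; exact: mH.
    by apply: leeD.
  by apply: lee_sum => xi _; have [_] := KfP xi; apply.
rewrite -EFinN; apply/lee_addgt0Pr => eps eps0.
apply: (@limf_esup_le _ _ _ (Num.max 1 (`|ln KK| / eps))) => T.
rewrite gt_max => /andP[/ltW T1 /ltW TK].
rewrite -EFinD addrC; apply: (@rate_upper _ _ KK) => //.
exact: bound.
Qed.

Lemma Hnorm2_series (z : H0 R) : ((Hnorm z ^+ 2)%:E = \sum_(n <oo) (cH n z ^+ 2)%:E)%E.
Proof.
apply/esym/cvg_lim => //.
under eq_fun do rewrite sumEFin big_mkord.
by apply: cvg_EFin; [exact: nearW|exact: parseval].
Qed.

Lemma sqr_le_expR (x : R) : x ^+ 2 <= 2 * (expR x + expR (- x)).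
Proof.
wlog x0 : x / 0 <= x.
  move=> H; have [/H//|/ltW x0] := leP 0 x.
  by have := H (- x); rewrite sqrrN opprK [in X in _ -> X](addrC (expR x)); apply; rewrite oppr_ge0.
have := expR_ge1Dxn 1 x0; have := expR_ge0 (- x).
rewrite (_ : 2`!%:R = 2 :> R) // => h1 h2; lra.
Qed.

Lemma qformD_scale xi (c : R) n :
  q (xi + c *: EH R n) = q xi + 2 * c * innerH (QH (EH R n)) (QH xi) + c ^+ 2 * et n.
Proof.
have QHn := QH_EH eta_ge0 Q_e QhalfQ n.
rewrite /qform (QHD QhalfQ) (QHZ QhalfQ) Hnorm2 innerHDl !innerHDr !innerHZl !innerHZr.
rewrite -!Hnorm2 (innerHC (QH xi)).
have -> : Hnorm (QH (EH R n)) ^+ 2 = et n.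
  by rewrite QHn HnormZ exprMn real_normK ?num_real // sqr_sqrtr ?etaH_ge0 // Hnorm2
    EH_orthonormal eqxx mulr1.
ring.
Qed.

(* Under the tilt by [expR (innerH xi (u T))] the coordinates of [u T / T]
   concentrate at [x'], the gradient of [Lam] at [xi]. *)
Lemma tilted_second_moment xi x' :
  (forall n, cH n x' = alpha ^+ 2 / 2 * innerH (QH (EH R n)) (QH xi)) ->
  exists K, forall n T, 1 <= T ->
  (\int[P]_w ((cH n (T^-1 *: u T w) - cH n x') ^+ 2 * expR (innerH xi (u T w)))%:E
   <= (4 * aw n / T * expR (T * Lam xi + K))%:E)%E.
Proof.
move=> x'E; have [Kv Kv0 vK] := Hnorm_v.
exists (Hnorm xi * Kv + 1 + alpha ^+ 2 / 4 + (alpha ^+ 2 * q xi + alpha ^+ 2)) => n T T1.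
set K := Hnorm xi * Kv + _ + _ + _.
have T0 : 0 < T by exact: lt_le_trans T1.
have an0 := aw_gt0 n.
pose s := Num.sqrt (T / aw n).
have s0 : 0 < s by rewrite sqrtr_gt0 divr_gt0.
have s2 : s ^+ 2 = T / aw n by rewrite sqr_sqrtr // ltW // divr_gt0.
pose B := innerH (QH (EH R n)) (QH xi).
have E sg : sg ^+ 2 = s ^+ 2 ->
    (\int[P]_w (expR (- (sg * cH n x') + innerH (xi + (sg / T) *: EH R n) (u T w)))%:E
     <= (expR (T * Lam xi + K))%:E)%E.
  move=> sg2.
  have [w [wE wB]] := mgf_u (xi + (sg / T) *: EH R n) T1.
  rewrite integral_expRD; last exact: measurable_innerH_u.
  rewrite wE -EFinM lee_fin -expRD ler_expR.
  move: wB; rewrite ler_norml => /andP[_].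
  rewrite qformD_scale -/B x'E -/B innerHDl innerHZl (innerHC (EH R n)) -/(cH n (v T)).
  have h1 : innerH xi (v T) <= Hnorm xi * Kv.
    apply: le_trans (ler_norm _) _; apply: le_trans (cauchy_schwarzH _ _) _.
    by rewrite ler_wpM2l ?Hnorm_ge0 // vK.
  have h2 : sg / T * cH n (v T) <= 1.
    apply: le_trans (ler_norm _) _; rewrite -(@ler_pXn2r _ 2) ?nnegrE // real_normK ?num_real //.
    rewrite exprMn expr_div_n sg2 s2 expr1n.
    have := bb_ge n T1 => /le_trans/(_ (bb_le_aw n)) cv.
    have -> : T / aw n / T ^+ 2 * cH n (v T) ^+ 2 = cH n (v T) ^+ 2 / (aw n * T).
      by field; rewrite !gt_eqF.
    rewrite ler_pdivrMr ?mulr_gt0 // mul1r; apply: le_trans cv _.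
    by rewrite ler_peMr // ltW.
  have e1 : et n / aw n <= 1 by rewrite ler_pdivrMr // mul1r etaH_le_aw.
  have e0 : 0 <= et n / aw n by rewrite divr_ge0 ?etaH_ge0 // ltW.
  have a2 : 0 < alpha ^+ 2 by rewrite exprn_gt0.
  have h3 : (sg / T) ^+ 2 * et n = et n / aw n / T.
    by rewrite expr_div_n sg2 s2; field; rewrite !gt_eqF.
  have h4 : alpha ^+ 2 / 2 * (q xi + 2 * (sg / T) * B + (sg / T) ^+ 2 * et n) <=
     alpha ^+ 2 * q xi + alpha ^+ 2.
    have qm : 0 <= q (xi + (- (sg / T)) *: EH R n) by exact: qform_ge0.
    rewrite qformD_scale -/B sqrrN h3 in qm; rewrite h3.
    have e3 : et n / aw n / T <= 1.
      by rewrite ler_pdivrMr // mul1r; exact: le_trans e1 T1.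
    have e4 : alpha ^+ 2 * (et n / aw n / T) <= alpha ^+ 2 by rewrite ler_piMr // ltW.
    have e5 : 0 <= alpha ^+ 2 * (q xi + 2 * (- (sg / T)) * B + et n / aw n / T).
      by rewrite mulr_ge0 // ltW.
    have -> : alpha ^+ 2 / 2 * (q xi + 2 * (sg / T) * B + et n / aw n / T) =
      alpha ^+ 2 * q xi + alpha ^+ 2 * (et n / aw n / T)
      - alpha ^+ 2 * (q xi + 2 * (- (sg / T)) * B + et n / aw n / T) / 2 by field; rewrite !gt_eqF.
    lra.
  have h5 : alpha ^+ 2 * T / 4 * (q xi + 2 * (sg / T) * B + (sg / T) ^+ 2 * et n) =
     T * Lam xi + sg * (alpha ^+ 2 / 2 * B) + alpha ^+ 2 / 4 * (et n / aw n).
    by rewrite h3; field; rewrite !gt_eqF.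
  have h6 : alpha ^+ 2 / 4 * (et n / aw n) <= alpha ^+ 2 / 4.
    by rewrite ler_piMr // divr_ge0 // ltW.
  rewrite h5 /K; set L := T * Lam xi; set M := sg * (_ * B) => wB; lra.
have mI := measurable_innerH_u xi T1.
have mE sg : measurable_fun setT (fun w => (expR (- (sg * cH n x') + innerH (xi
  + (sg / T) *: EH R n) (u T w)))%:E).
  apply/measurable_EFinP; apply: measurableT_comp => //; apply: measurable_funD => //.
  exact: measurable_innerH_u.
apply: (@le_trans _ _ (\int[P]_w ((2 * aw n / T)%:E *
   ((expR (- (s * cH n x') + innerH (xi + (s / T) *: EH R n) (u T w)))%:E +
    (expR (- (- s * cH n x') + innerH (xi + (- s / T) *: EH R n) (u T w)))%:E)))%E).
  apply: ge0_le_integral => //.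
  - by move=> w _; rewrite lee_fin mulr_ge0 ?sqr_ge0 ?expR_ge0.
  - apply/measurable_EFinP; apply: measurable_funM; last exact: measurable_expR_u.
    apply: measurable_funX; apply: measurable_funB => //.
    rewrite (_ : (fun w => _) = (fun w => T^-1 * innerH (EH R n) (u T w))).
      by apply: measurable_funM => //; exact: measurable_innerH_u.
    by apply/funext => w; rewrite /cH innerHZl innerHC.
  - apply: emeasurable_funM => //; exact: emeasurable_funD.
  move=> w _; rewrite -EFinD -EFinM lee_fin.
  have cE : cH n (T^-1 *: u T w) = cH n (u T w) / T by rewrite /cH innerHZl mulrC.
  rewrite !innerHDl !innerHZl (innerHC (EH R n)) -/(cH n (u T w)) cE.
  set c := cH n (u T w); set c' := cH n x'; set i := innerH xi _.
  have := sqr_le_expR (s * (c / T - c')).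
  rewrite exprMn s2 => H.
  have {}H : (c / T - c') ^+ 2 <= aw n / T * (2 * (expR (s * (c / T - c'))
    + expR (- (s * (c / T - c'))))).
    rewrite -ler_pdivrMl ?divr_gt0 //; apply: le_trans H.
    by rewrite invf_div mulrC.
  apply: le_trans (ler_wpM2r (expR_ge0 i) H) _.
  rewrite le_eqVlt; apply/orP; left; apply/eqP.
  have -> : - (s * c') + (i + s / T * c) = s * (c / T - c') + i by field; rewrite gt_eqF.
  have -> : - (- s * c') + (i + - s / T * c) = - (s * (c / T - c')) + i by field; rewrite gt_eqF.
  rewrite !expRD; move: (expR (s * _)) (expR (- _)) (expR i) (aw n) => A1 A2 A3 A4.
  by rewrite -mulrDl; move: (A1 + A2) => A5; ring.
have c0 : 0 <= 2 * aw n / T by rewrite divr_ge0 ?mulr_ge0 // ltW.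
rewrite ge0_integralZl //; first last.
- by move=> w _; rewrite -EFinD lee_fin addr_ge0 ?expR_ge0.
- exact: emeasurable_funD.
rewrite ge0_integralD //.
have -> : (4 * aw n / T * expR (T * Lam xi + K))%:E =
   ((2 * aw n / T)%:E * ((expR (T * Lam xi + K))%:E + (expR (T * Lam xi + K))%:E))%E.
  by rewrite -EFinD -EFinM; congr EFin; field; rewrite gt_eqF.
by apply: lee_wpmul2l; [rewrite lee_fin|apply: leeD; apply: E; rewrite ?sqrrN].
Qed.

Lemma LDP_lower (G : set (H0 R)) : open G ->
  (- ereal_inf (I @` G) <=
   limf_einf (fun T : R => (T^-1)%:E * lne (P ((fun x => (T^-1 *: u T x)%R) @^-1` G)))
     (pinfty_nbhs R))%E.
Proof.
move=> oG; rewrite leeNl; apply: le_ereal_inf_tmp => _ [x Gx <-]; rewrite leeNl.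
case Ix : (I x) => [rho| |]; last 2 first.
- by rewrite /= leNye.
- by have := rate_ge0 Qhalf alpha x; rewrite Ix.
have Ixr : (I x <= rho%:E)%E by rewrite Ix.
rewrite -EFinN; apply/lee_subgt0Pr => eps0' eps0'0.
pose eps := eps0' / 2.
have eps0 : 0 < eps by rewrite divr_gt0.
have [del del0 delG] : exists2 del, 0 < del & forall y, `|x - y| < del -> G y.
  have /nbhs_ballP[del /= del0 delG] : nbhs x G by exact: open_nbhs_nbhs.
  by exists del => // y xy; apply: delG; rewrite -ball_normE.
have [xi [x' [Lrho xx' x'E]]] :=
  rate_lower_approx eta_ge0 Q_e QhalfQ alpha_gt0 Ixr (divr_gt0 del0 (ltr0n _ 2)).
have [K1 K1P] : exists K1, forall n T, 1 <= T ->
  (\int[P]_w ((cH n (T^-1 *: u T w) - cH n x') ^+ 2 * expR (innerH xi (u T w)))%:E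
   <= (4 * aw n / T * expR (T * Lam xi + K1))%:E)%E.
  by apply: tilted_second_moment => n; rewrite /cH innerHC x'E.
have [Ca CaP] := aw_sum.
have Ca0 : 0 <= Ca by have := CaP 0%N; rewrite big_ord0.
have [Kv Kv0 vK] := Hnorm_v.
pose K2 := Hnorm xi * Kv + alpha ^+ 2 / 2 * q xi.
pose del' := Num.min (del / 2) (eps / (Hnorm xi + 1)).
have hx1 : 0 < Hnorm xi + 1 by rewrite ltr_wpDl ?Hnorm_ge0.
have del'0 : 0 < del' by rewrite lt_min !divr_gt0.
pose D2 := del' ^- 2.
have D20 : 0 < D2 by rewrite invr_gt0 exprn_gt0.
pose T1 := 8 * D2 * Ca * expR (K1 + K2).
pose KK := 2^-1 * expR (- K2).
have KK0 : 0 < KK by rewrite mulr_gt0 ?expR_gt0 // invr_gt0.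
have xix' : innerH xi x' = 2 * Lam xi by rewrite x'E -Hnorm2 /qform; field.
have bound T : 1 <= T -> T1 <= T ->
    ((KK * expR (- (T * (rho + eps))))%:E <= P ((fun x => (T^-1 *: u T x)%R) @^-1` G))%E.
  move=> T1' TT; have T0 : 0 < T by exact: lt_le_trans T1'.
  pose X w := T^-1 *: u T w.
  pose M w := expR (innerH xi (u T w)).
  have mG : measurable (X @^-1` G) by exact: measurable_open_u.
  pose cc := expR (T * (2 * Lam xi + eps)).
  have mM : measurable_fun setT M by exact: measurable_expR_u.
  have mc n : measurable_fun setT (fun w => (cH n (X w) - cH n x') ^+ 2).
    apply: measurable_funX; apply: measurable_funB => //.
    rewrite (_ : (fun w => _) = (fun w => T^-1 * innerH (EH R n) (u T w))).
      by apply: measurable_funM => //; exact: measurable_innerH_u.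
    by apply/funext => w; rewrite /X /cH innerHZl innerHC.
  have pw w : ((M w)%:E <= (cc * \1_(X @^-1` G) w)%:E +
     D2%:E * \sum_(n <oo) ((cH n (X w) - cH n x') ^+ 2 * M w)%:E)%E.
    have -> : (\sum_(n <oo) ((cH n (X w) - cH n x') ^+ 2 * M w)%:E
      = (Hnorm (X w - x') ^+ 2 * M w)%:E)%E.
      rewrite EFinM Hnorm2_series muleC -nneseriesZl; last first.
        by move=> n _; rewrite lee_fin sqr_ge0.
      apply: eq_eseriesr => n _; rewrite -EFinM mulrC; congr (_ * _)%:E.
      by rewrite [in RHS]/cH innerHBl.
    rewrite -EFinM -EFinD lee_fin.
    have [Xx|Xx] := ltP (Hnorm (X w - x')) del'.
      have GX : G (X w).
        apply: delG; have -> : x - X w = (x - x') - (X w - x') by rewrite opprB addrA subrK.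
        apply: le_lt_trans (ler_normB _ _) _.
        have : `|X w - x'| < del / 2.
          by apply: le_lt_trans (norm_le_Hnorm _) _; move: Xx; rewrite lt_min => /andP[].
        by move=> h; lra.
      rewrite indicE mem_set // mulr1 -[leLHS]addr0 lerD //; last first.
        by exact: (mulr_ge0 (ltW D20) (mulr_ge0 (sqr_ge0 _) (expR_ge0 _))).
      rewrite /M /cc ler_expR.
      have -> : u T w = T *: X w by rewrite /X scalerA divff ?scale1r // gt_eqF.
      rewrite innerHZr ler_pM2l //.
      have -> : X w = x' + (X w - x') by rewrite addrC subrK.
      rewrite innerHDr xix' lerD2l.
      apply: le_trans (ler_norm _) _; apply: le_trans (cauchy_schwarzH _ _) _.
      have : Hnorm (X w - x') < eps / (Hnorm xi + 1).
        by move: Xx; rewrite lt_min => /andP[].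
      rewrite ltr_pdivlMr // => h; rewrite mulrC; apply: le_trans (ltW h).
      by rewrite ler_wpM2l ?Hnorm_ge0 // lerDl.
    rewrite -[leLHS]add0r lerD //.
      by rewrite mulr_ge0 ?expR_ge0 // indicE.
    rewrite mulrA ler_peMl ?expR_ge0 // /D2 -(mulVf (x := del' ^+ 2)) ?gt_eqF ?exprn_gt0 //.
    rewrite ler_wpM2l ?invr_ge0 ?sqr_ge0 //.
    by rewrite lerXn2r ?nnegrE ?Hnorm_ge0 // ltW.
  have [w0 [w0E w0B]] := mgf_u xi T1'.
  have Mlow : ((expR (T * Lam xi - K2))%:E <= \int[P]_w (M w)%:E)%E.
    rewrite /M w0E lee_fin ler_expR /K2.
    have h1 : - (Hnorm xi * Kv) <= innerH xi (v T).
      have h : `|innerH xi (v T)| <= Hnorm xi * Kv.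
        apply: le_trans (cauchy_schwarzH _ _) _.
        by rewrite ler_wpM2l ?Hnorm_ge0 // vK.
      by move: h; rewrite ler_norml => /andP[].
    move: w0B; rewrite ler_norml => /andP[+ _].
    have -> : alpha ^+ 2 * T / 4 * q xi = T * Lam xi by field.
    set L := T * Lam xi => h; lra.
  have Mup : (\int[P]_w (M w)%:E <= cc%:E * P (X @^-1` G) +
      (D2 * (4 * Ca / T * expR (T * Lam xi + K1)))%:E)%E.
    have m2 : measurable_fun setT (fun w => \sum_(n <oo) ((cH n (X w) - cH n x') ^+ 2 * M w)%:E)%E.
      apply: ge0_emeasurable_sum => [n w _ _|n _].
        by rewrite lee_fin mulr_ge0 ?sqr_ge0 ?expR_ge0.
      by apply/measurable_EFinP; exact: measurable_funM.
    have m1 : measurable_fun setT (fun w => (cc * \1_(X @^-1` G) w)%:E).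
      by apply/measurable_EFinP; apply: measurable_funM => //; exact: measurable_indic.
    have s0 w : (0 <= \sum_(n <oo) ((cH n (X w) - cH n x') ^+ 2 * M w)%:E)%E.
      by apply: nneseries_ge0 => n _; rewrite lee_fin mulr_ge0 ?sqr_ge0 ?expR_ge0.
    apply: (@le_trans _ _ (\int[P]_w ((cc * \1_(X @^-1` G) w)%:E +
     D2%:E * \sum_(n <oo) ((cH n (X w) - cH n x') ^+ 2 * M w)%:E))%E).
      apply: ge0_le_integral => //.
      - by move=> w _; rewrite lee_fin expR_ge0.
      - exact/measurable_EFinP.
      - by apply: emeasurable_funD => //; exact: emeasurable_funM.
    rewrite ge0_integralD //; first last.
    - exact: emeasurable_funM.
    - by move=> w _; rewrite mule_ge0 // lee_fin ltW.
    - by move=> w _; rewrite lee_fin mulr_ge0 ?expR_ge0 // indicE.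
    apply: leeD.
      under eq_integral do rewrite EFinM.
      rewrite ge0_integralZl //.
      + by rewrite integral_indic // setIT.
      + by apply/measurable_EFinP; exact: measurable_indic.
      + by rewrite lee_fin expR_ge0.
    rewrite ge0_integralZl //; last by rewrite lee_fin ltW.
    rewrite EFinM; apply: lee_wpmul2l; first by rewrite lee_fin ltW.
    rewrite integral_nneseries //; first last.
    - by move=> n w _; rewrite lee_fin mulr_ge0 ?sqr_ge0 ?expR_ge0.
    - by move=> n; apply/measurable_EFinP; exact: measurable_funM.
    apply: lime_le.
      apply: is_cvg_nneseries => n _ _; apply: integral_ge0 => w _.
      by rewrite lee_fin mulr_ge0 ?sqr_ge0 ?expR_ge0.
    apply: nearW => N.
    apply: (@le_trans _ _ (\sum_(0 <= n < N) (4 * aw n / T * expR (T * Lam xi + K1))%:E)%E).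
      by apply: lee_sum => n _; exact: K1P.
    rewrite sumEFin lee_fin -mulr_suml ler_wpM2r ?expR_ge0 // -mulr_suml ler_wpM2r ?invr_ge0
      ?(ltW T0) //.
    by rewrite -mulr_sumr ler_wpM2l // big_mkord; exact: CaP.
  have half : D2 * (4 * Ca / T * expR (T * Lam xi + K1)) <= 2^-1 * expR (T * Lam xi - K2).
    have -> : expR (T * Lam xi + K1) = expR (K1 + K2) * expR (T * Lam xi - K2).
      by rewrite -expRD; congr expR; ring.
    rewrite mulrA mulrA ler_wpM2r ?expR_ge0 //.
    have -> : D2 * (4 * Ca / T) * expR (K1 + K2) = T1 / T / 2 by rewrite /T1; field; rewrite gt_eqF.
    by rewrite ler_pdivrMr // mulVf // ler_pdivrMr // mul1r.
  have PG : P (X @^-1` G) \is a fin_num by exact: fin_num_measure.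
  have : ((expR (T * Lam xi - K2))%:E
    <= cc%:E * P (X @^-1` G) + (2^-1 * expR (T * Lam xi - K2))%:E)%E.
    apply: le_trans Mlow (le_trans Mup _).
    by apply: leeD => //; rewrite lee_fin.
  rewrite -/X -(fineK PG) -EFinM -EFinD !lee_fin => H.
  have {}H := half_absorb H.
  rewrite -(ler_pM2l (expR_gt0 (T * (2 * Lam xi + eps)))); apply: le_trans H.
  rewrite /KK; apply: expR_combine; first by rewrite invr_ge0.
  have : T * Lam xi <= T * rho by rewrite ler_pM2l.
  rewrite !mulrDr; set A := T * (2 * _); have -> : A = 2 * (T * Lam xi) by rewrite /A; ring.
  exact: cancel_bound.
apply: (@limf_einf_ge _ _ _ (Num.max 1 (Num.max T1 (`|ln KK| / eps)))) => T.
rewrite !gt_max => /and3P[/ltW h1 /ltW h2 /ltW h3].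
have -> : (- rho%:E - eps0'%:E = (- (rho + eps) - eps)%:E)%E.
  by rewrite -EFinN -EFinB; congr EFin; rewrite /eps; field.
by apply: (@rate_lower _ _ KK) => //; exact: bound.
Qed.

End LDP.

(** * Gaussian sums of Brownian increments *)

Section transfer_independence.
Context d (Omega : measurableType d) (R : realType).
Variable P : probability Omega R.
Implicit Types (X Z h : Omega -> R).

Lemma integral_indep X h (c : R) (f : R -> R) :
  measurable_fun setT X -> measurable_fun setT h -> (forall w, 0 <= h w) -> 0 <= c ->
  (forall B : set (measurableTypeR R), measurable B ->
    (\int[P]_w (\1_B (X w) * h w)%:E = c%:E * P (X @^-1` B))%E) ->
  measurable_fun setT (f : measurableTypeR R -> R) -> (forall x, 0 <= f x) ->
  (\int[P]_w (f (X w) * h w)%:E = c%:E * \int[P]_w (f (X w))%:E)%E.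
Proof.
move=> mX mh h0 c0 hc mf f0.
have mfE : measurable_fun setT (fun x : measurableTypeR R => (f x)%:E) by exact/measurable_EFinP.
have mX1 : @measurable_fun _ _ Omega (measurableTypeR R) setT X := mX.
pose mX' : {mfun Omega >-> measurableTypeR R} :=
  HB.pack (X : Omega -> measurableTypeR R)
    (@isMeasurableFun.Build _ _ Omega (measurableTypeR R) X mX1).
rewrite -(@ge0_integral_distribution _ _ _ _ _ P mX' _ mfE) => [|x]; last by rewrite lee_fin.
rewrite -(ge0_integral_mscale (distribution P mX') measurableT (NngNum c0)) //;
  last by move=> x _; rewrite lee_fin.
rewrite -(@ge0_integral_transfer _ _ _ _ R P (mscale (NngNum c0) (distribution P mX')) X h) //.
Qed.

Lemma integral_indic1 (A : set Omega) : measurable A ->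
  (\int[P]_w (\1_A w)%:E = P A)%E.
Proof. by move=> mA; rewrite integral_indic // setIT. Qed.

Definition adapted (G : set (set Omega)) X :=
  forall B : set (measurableTypeR R), measurable B -> G (X @^-1` B).

Lemma adaptedP (G : set (set Omega)) X : sigma_algebra setT G ->
  adapted G X <-> measurable_fun setT (X : g_sigma_algebraType G -> R).
Proof.
move=> sG; split=> [GX _ B mB|mX B mB].
  by rewrite setTI measurable_g_measurableTypeE //; exact: GX.
by have := mX measurableT B mB; rewrite setTI measurable_g_measurableTypeE.
Qed.

Lemma adapted_measurable (G : set (set Omega)) X : is_sub_sigma_algebra G ->
  adapted G X -> measurable_fun setT X.
Proof. by move=> [_ Gm] GX _ B mB; rewrite setTI; apply: Gm; exact: GX. Qed.

Lemma adapted_lin (G : set (set Omega)) X Y (c : R) : sigma_algebra setT G ->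
  adapted G X -> adapted G Y -> adapted G (fun w => X w + c * Y w).
Proof.
move=> sG /(adaptedP _ sG) mX /(adaptedP _ sG) mY; apply/(adaptedP _ sG).
by apply: measurable_funD => //; exact: measurable_funM.
Qed.

Lemma adapted_cst (G : set (set Omega)) (c : R) : sigma_algebra setT G ->
  adapted G (fun=> c).
Proof. by move=> sG; apply/(adaptedP _ sG). Qed.

Lemma adaptedS (G G' : set (set Omega)) X : G `<=` G' -> adapted G X -> adapted G' X.
Proof. by move=> GG' GX B mB; apply: GG'; exact: GX. Qed.

Lemma normal_mgf X (sg c : R) : 0 < sg -> measurable_fun setT X ->
  (forall B : set (measurableTypeR R), measurable B -> P (X @^-1` B) = normal_prob 0 sg B) ->
  (\int[P]_w (expR (c * X w))%:E = (expR (c ^+ 2 * sg ^+ 2 / 2))%:E)%E.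
Proof.
move=> sg0 mX XB.
have sgN0 : sg != 0 by rewrite gt_eqF.
have mX1 : @measurable_fun _ _ Omega (measurableTypeR R) setT X := mX.
pose mX' : {mfun Omega >-> measurableTypeR R} :=
  HB.pack (X : Omega -> measurableTypeR R)
    (@isMeasurableFun.Build _ _ Omega (measurableTypeR R) X mX1).
have me : measurable_fun setT (fun x : measurableTypeR R => (expR (c * x))%:E).
  by apply/measurable_EFinP; apply: measurableT_comp => //; exact: measurable_funM.
rewrite -(@ge0_integral_distribution _ _ _ _ _ P mX' _ me) => [|x];
  last by rewrite lee_fin expR_ge0.
rewrite -(@ge0_integral_transfer _ _ _ _ R (@lebesgue_measure R) (distribution P mX') (@idfun R)
  (normal_pdf 0 sg) (fun x => (expR (c * x))%:E)) //; first last.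
- move=> B mB; rewrite -[RHS]/(P (X @^-1` B)) XB // /normal_prob [RHS]integral_mkcond.
  apply: eq_integral => x _; rewrite /patch /indic.
  by case: ifPn => _; rewrite ?mul1r ?mul0r.
- by move=> x; exact: normal_pdf_ge0.
- exact: measurable_normal_pdf.
- exact: measurable_id.
transitivity (\int[@lebesgue_measure R]_x ((expR (c ^+ 2 * sg ^+ 2 / 2))%:E * (normal_pdf (c * sg
  ^+ 2) sg x)%:E))%E.
  apply: eq_integral => x _; rewrite -!EFinM; congr EFin.
  rewrite !normal_pdfE // mulrCA [in RHS]mulrCA; congr (_ * _).
  rewrite /normal_fun -!expRD /=; congr expR.
  by field; rewrite sgN0.
rewrite ge0_integralZl //; first by rewrite integral_normal_pdf mule1.
- by apply/measurable_EFinP; exact: measurable_normal_pdf.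
- by move=> x _; rewrite lee_fin normal_pdf_ge0.
Qed.

(* The centred normal law of variance [v], degenerate for [v = 0]. *)
Definition gaussian Z (v : R) := measurable_fun setT Z /\
  forall c, (\int[P]_w (expR (c * Z w))%:E = (expR (c ^+ 2 * v / 2))%:E)%E.

Section brownian_sums.
Variables (F : R -> set (set Omega)) (b : R -> Omega -> R).
Hypothesis HF : usual_filtration P F.
Hypothesis Hb : brownian P F b.

Lemma brownian_adapted t s : 0 <= t -> t <= s -> adapted (F s) (b t).
Proof.
move=> t0 ts; have [_ _ Fmon _ _] := HF; have [_ _ bF _ _] := Hb.
by apply: adaptedS (Fmon _ _ t0 ts) _ => B mB; exact: bF.
Qed.

Lemma brownian_measurable t : 0 <= t -> measurable_fun setT (b t).
Proof.
move=> t0; have [_ Fs _ _ _] := HF.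
apply: adapted_measurable (Fs t t0) _; exact: brownian_adapted.
Qed.

Definition brownian_sum (s c : nat -> R) n (w : Omega) : R :=
  \sum_(j < n) c j * incr b (s j) (s j.+1) w.

Lemma brownian_sum_adapted (s c : nat -> R) n : 0 <= s 0 ->
  (forall j, (j < n)%N -> s j <= s j.+1) ->
  0 <= s n /\ adapted (F (s n)) (brownian_sum s c n).
Proof.
have [_ Fs Fmon _ _] := HF.
move=> s0; elim: n => [|n IH] sn.
  split => //; rewrite (_ : brownian_sum s c 0 = fun=> 0).
    by apply: adapted_cst; have [] := Fs _ s0.
  by apply/funext => w; rewrite /brownian_sum big_ord0.
have [|sn0 IHn] := IH; first by move=> j jn; apply: sn; exact: ltnW.
have snn := sn n (ltnSn n); have sn1 := le_trans sn0 snn.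
have [sF _] := Fs _ sn1.
split => //.
rewrite (_ : brownian_sum s c n.+1
  = fun w => brownian_sum s c n w + c n * (b (s n.+1) w + (-1) * b (s n) w)).
  apply: adapted_lin => //; first by apply: adaptedS IHn; exact: Fmon.
  by apply: adapted_lin => //; exact: brownian_adapted.
by apply/funext => w; rewrite /brownian_sum big_ord_recr /= /incr mulN1r.
Qed.

Lemma incr_mgf s t c (A : set Omega) : 0 <= s -> s <= t -> F s A ->
  (\int[P]_w (expR (c * incr b s t w) * \1_A w)%:E = (expR (c ^+ 2 * (t - s) / 2))%:E * P A)%E.
Proof.
move=> s0 st FA.
have [_ Fs Fmon _ _] := HF; have [_ _ _ bN bI] := Hb.
have mA : measurable A by have [_] := Fs s s0; apply.
have [<-|st'] := eqVneq s t.
  rewrite subrr mulr0 mul0r expR0 mul1e -integral_indic1 //.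
  by apply: eq_integral => w _; rewrite /incr subrr mulr0 expR0 mul1r.
have {st'} slt : s < t by rewrite lt_neqAle st' st.
have mI : measurable_fun setT (incr b s t).
  by apply: measurable_funB; apply: brownian_measurable => //; exact: le_trans st.
have PA : P A \is a fin_num by exact: fin_num_measure.
rewrite (@integral_indep (incr b s t) (\1_A) (fine (P A)) (fun x => expR (c * x))) //.
- rewrite fineK // (@normal_mgf _ (Num.sqrt (t - s))) ?sqrtr_gt0 ?subr_gt0 //.
    by rewrite sqr_sqrtr ?subr_ge0 // muleC.
  by move=> B mB; rewrite bN.
- by rewrite fine_ge0.
- move=> B mB; rewrite fineK // -bI // -integral_indic1; last first.
    apply: measurableI => //; rewrite -[X in measurable X]setTI; exact: mI.
  apply: eq_integral => w _; rewrite !indicE in_setI -natrM mulnC mulnb;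
    congr ((_ && _)%:R%:E); apply/idP/idP => /set_mem h; exact/mem_set.
- by apply: measurableT_comp => //; exact: measurable_funM.
Qed.

Lemma brownian_sum_gaussian (s c : nat -> R) n : 0 <= s 0 ->
  (forall j, (j < n)%N -> s j <= s j.+1) ->
  gaussian (brownian_sum s c n) (\sum_(j < n) c j ^+ 2 * (s j.+1 - s j)).
Proof.
have [_ Fs Fmon _ _] := HF.
move=> s0; elim: n => [|n IH] sn.
  rewrite big_ord0 (_ : brownian_sum s c 0 = fun=> 0).
    split => [|a]; first exact: measurable_cst.
    rewrite !mulr0 mul0r expR0.
    by rewrite integral_cst // mul1e; exact: probability_setT.
  by apply/funext => w; rewrite /brownian_sum big_ord0.
have sn' : forall j, (j < n)%N -> s j <= s j.+1 by move=> j jn; apply: sn; exact: ltnW.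
have [mZ gZ] := IH sn'.
have [sn0 aZ] := brownian_sum_adapted c s0 sn'.
have snn := sn n (ltnSn n); have sn1 := le_trans sn0 snn.
have mI : measurable_fun setT (incr b (s n) (s n.+1)).
  by apply: measurable_funB; exact: brownian_measurable.
have SE : brownian_sum s c n.+1 = fun w => brownian_sum s c n w + c n * incr b (s n) (s n.+1) w.
  by apply/funext => w; rewrite /brownian_sum big_ord_recr.
split; first by rewrite SE; apply: measurable_funD => //; exact: measurable_funM.
move=> a.
pose h w := expR (a * c n * incr b (s n) (s n.+1) w).
have mh : measurable_fun setT h by apply: measurableT_comp => //; exact: measurable_funM.
transitivity (\int[P]_w (expR (a * brownian_sum s c n w) * h w)%:E)%E.
  apply: eq_integral => w _; rewrite SE /h -expRD; congr (expR _)%:E; ring.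
rewrite (@integral_indep _ h (expR ((a * c n) ^+ 2 * (s n.+1 - s n) / 2))
  (fun x => expR (a * x))) //.
- rewrite gZ -EFinM -expRD big_ord_recr /=; congr (expR _)%:E; by field.
- by move=> w; exact: expR_ge0.
- move=> B mB; rewrite -incr_mgf //; last exact: aZ.
  by apply: eq_integral => w _; rewrite mulrC.
- by apply: measurableT_comp => //; exact: measurable_funM.
Qed.

Lemma brownian_sum_sigma (s c : nat -> R) n : (forall j, (j <= n)%N -> 0 <= s j) ->
  adapted (sigma_process b) (brownian_sum s c n).
Proof.
have sS : sigma_algebra setT (sigma_process b) by exact: smallest_sigma_algebra.
have ab t : 0 <= t -> adapted (sigma_process b) (b t).
  by move=> t0 B mB; apply: sub_gen_smallest; exists t, B.
elim: n => [|n IH] sn.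
  rewrite (_ : brownian_sum s c 0 = fun=> 0); first exact: adapted_cst.
  by apply/funext => w; rewrite /brownian_sum big_ord0.
rewrite (_ : brownian_sum s c n.+1
  = fun w => brownian_sum s c n w + c n * (b (s n.+1) w + (-1) * b (s n) w)).
  apply: adapted_lin => //; first by apply: IH => j jn; apply: sn; exact: leqW.
  by apply: adapted_lin => //; apply: ab; exact: sn.
by apply/funext => w; rewrite /brownian_sum big_ord_recr /= /incr mulN1r.
Qed.

End brownian_sums.

Section independent_sums.
Variables (F : R -> set (set Omega)) (b : nat -> R -> Omega -> R).
Hypothesis HF : usual_filtration P F.
Hypothesis Hb : forall k, brownian P F (b k).
Hypothesis bI : independent_processes P b.

Lemma sigma_process_measurable k : sigma_process (b k) `<=` measurable.
Proof.
apply: smallest_sub; first exact: sigma_algebra_measurable.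
move=> _ [t [B [t0 mB ->]]]; rewrite -[X in measurable X]setTI.
by have := brownian_measurable HF (Hb k) t0; apply.
Qed.

Lemma independent_events m (A : nat -> set Omega) :
  (forall k, sigma_process (b k) (A k)) ->
  (\int[P]_w (\prod_(k < m) \1_(A k) w)%:E = \prod_(k < m) P (A k))%E.
Proof.
move=> sA.
have mA k : measurable (A k) by exact: sigma_process_measurable (sA k).
have perm : perm_eq [fset k in iota 0 m]%fset (index_iota 0 m).
  by rewrite /index_iota subn0; apply: uniq_perm => //=; [exact: iota_uniq|move=> k; rewrite !inE].
rewrite -(big_mkord xpredT (fun k => P (A k))) -(perm_big _ perm) /= -bI //.
rewrite -integral_indic1; last first.
  by apply: fin_bigcap_measurable => // k _; exact: mA.
apply: eq_integral => w _; congr EFin.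
rewrite -(big_mkord xpredT (fun k => \1_(A k) w)) -(perm_big _ perm) /=.
rewrite indicE; case: (boolP (w \in _)) => [/set_mem wA|wA].
  rewrite big1_seq // => k /andP[_ kJ]; rewrite indicE mem_set //.
  exact: wA.
have [k kJ kA] : exists2 k, k \in [fset k in iota 0 m]%fset & w \notin A k.
  apply: contrapT => H; move/negP: wA; apply; apply/mem_set => k /= kJ.
  by apply: contrapT => kA; apply: H; exists k; [exact: kJ|apply/negP => /set_mem].
by rewrite (perm_big _ perm) /= (bigD1_seq k) ?iota_uniq //= -?(perm_mem perm) //= indicE (negbTE
  kA) mul0r.
Qed.

(* Indicators of independent events are replaced by exponentials one factor at a
   time. *)
Lemma independent_mgf m (Z : nat -> Omega -> R) (v : nat -> R) :
  (forall k, adapted (sigma_process (b k)) (Z k)) -> (forall k, gaussian (Z k) (v k)) ->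
  gaussian (fun w => \sum_(k < m) Z k w) (\sum_(k < m) v k).
Proof.
move=> aZ gZ.
have mZ k : measurable_fun setT (Z k) by have [] := gZ k.
split; first by apply: measurable_sum => k.
move=> c.
pose E k := expR (c ^+ 2 * v k / 2).
have step i : (i <= m)%N -> forall A : nat -> set Omega, (forall k, sigma_process (b k) (A k)) ->
  (\int[P]_w (\prod_(k < m) (if (k < i)%N then expR (c * Z k w) else \1_(A k) w))%:E =
   \prod_(k < m) (if (k < i)%N then (E k)%:E else P (A k)))%E.
  elim: i => [|i IH] im A sA; first exact: independent_events.
  pose i' := Ordinal im.
  pose h w := \prod_(k < m | k != i') (if (k < i.+1)%N then expR (c * Z k w) else \1_(A k) w).
  pose C := \prod_(k < m | k != i') (if (k < i.+1)%N then E k else fine (P (A k))).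
  have mA k : measurable (A k) by apply: sigma_process_measurable; exact: sA.
  have mh : measurable_fun setT h.
    have mk k : measurable_fun setT (fun w => if k != i' then (if (k < i.+1)%N then expR (c * Z k
      w) else \1_(A k) w) else 1 : R).
      case: (k != i') => //; case: (k < i.+1)%N => /=; last exact: measurable_indic (mA k).
      by apply: measurableT_comp => //; exact: measurable_funM.
    have := @measurable_prod _ _ R setT _ (index_enum 'I_m) _ (fun k _ => mk k).
    by congr measurable_fun; apply/funext => w; rewrite /h [RHS]big_mkcond.
  have h0 w : 0 <= h w.
    by apply: prodr_ge0 => k _; case: ifP => _; rewrite ?expR_ge0 // indicE.
  have C0 : 0 <= C.
    by apply: prodr_ge0 => k _; case: ifP => _; rewrite ?expR_ge0 ?fine_ge0.
  have PE k : (fine (P (A k)))%:E = P (A k) by rewrite fineK // fin_num_measure.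
  rewrite (bigD1 i') //= ltnSn.
  under eq_integral do rewrite (bigD1 i') //= ltnSn -/(h _).
  rewrite (@integral_indep (Z i) h C (fun x => expR (c * x))) //.
  - have [_ ->] := gZ i; rewrite muleC; congr (_ * _)%E.
    rewrite /C -prodEFin; apply: eq_bigr => k _; case: ifP => _ //; exact: PE.
  - move=> B mB.
    pose A' k := if k == i then Z i @^-1` B else A k.
    have sA' k : sigma_process (b k) (A' k).
      by rewrite /A'; case: eqP => [->|_]; [exact: aZ|exact: sA].
    have A'i : A' i = Z i @^-1` B by rewrite /A' eqxx.
    have := IH (ltnW im) A' sA'.
    rewrite (bigD1 i') //= ltnn A'i => IH'.
    rewrite [RHS]muleC /C -prodEFin.
    transitivity (P (Z i @^-1` B) * \prod_(k < m | k != i')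
      (if (k < i)%N then (E k)%:E else P (A' k)))%E.
      rewrite -IH'; apply: eq_integral => w _; congr EFin.
      rewrite [RHS](bigD1 i') //= ltnn A'i; congr (_ * _).
      apply: eq_bigr => k /eqP/val_eqP/= ki; rewrite ltnS leq_eqVlt (negbTE ki) /=.
      by case: ifP => // _; rewrite /A' (negbTE ki).
    congr (_ * _)%E; apply: eq_bigr => k /eqP/val_eqP/= ki.
    rewrite [X in _ = ((if X then _ else _)%:E)]ltnS [X in _
      = ((if X then _ else _)%:E)]leq_eqVlt (negbTE ki) /=.
    by case: ifP => // _; rewrite /A' (negbTE ki) PE.
  - by apply: measurableT_comp => //; exact: measurable_funM.
have sT k : sigma_process (b k) setT.
  by apply: sub_gen_smallest; exists 0, setT; split => //; rewrite preimage_setT.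
have := step m (leqnn m) (fun=> setT) sT.
rewrite (eq_bigr (fun k : 'I_m => (E k)%:E)); last by move=> k _; rewrite ltn_ord.
rewrite prodEFin -expR_sum => H.
transitivity (\int[P]_w (\prod_(k < m) (if (k < m)%N then expR (c * Z k w) else \1_setT w))%:E)%E.
  apply: eq_integral => w _; congr EFin; rewrite mulr_sumr expR_sum.
  by apply: eq_bigr => k _; rewrite ltn_ord.
by rewrite H -mulr_suml -mulr_sumr.
Qed.

End independent_sums.

End transfer_independence.

(** * Limits in mean square *)

Section lower_integral.
Context d (T : measurableType d) (R : realType) (mu : {measure set T -> \bar R}).

(* The library's integral of a nonnegative function is a supremum over the
   simple functions below it, hence monotone without measurability. *)
Lemma ge0_le_lower_integral (D : set T) (f g : T -> \bar R) :
  (forall x, D x -> 0 <= f x)%E -> (forall x, D x -> f x <= g x)%E ->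
  (\int[mu]_(x in D) f x <= \int[mu]_(x in D) g x)%E.
Proof.
move=> f0 fg; have g0 x : D x -> (0 <= g x)%E by move=> Dx; exact: le_trans (f0 x Dx) (fg x Dx).
rewrite !ge0_integralE //; apply: le_ereal_sup => _ [h hf <-]; exists h => // x.
apply: le_trans (hf x) _; rewrite /patch; case: ifPn => // /set_mem xD; exact: fg.
Qed.

End lower_integral.

Section mean_square_null.
Context d (Omega : measurableType d) (R : realType).
Variable P : probability Omega R.
Implicit Types X Y : nat -> Omega -> R.

Definition L2null X := (forall n, measurable_fun setT (X n)) /\
  mean_square P (X n) @[n --> \oo] --> 0%E.

Lemma mean_square_ge0 (X : Omega -> R) : (0 <= mean_square P X)%E.
Proof. by apply: integral_ge0 => w _; rewrite lee_fin sqr_ge0. Qed.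

Lemma mean_square_le (X Y : Omega -> R) (C : R) : measurable_fun setT X -> 0 < C ->
  (forall w, X w ^+ 2 <= C * Y w ^+ 2) -> (mean_square P X <= C%:E * mean_square P Y)%E.
Proof.
move=> mX C0 XY.
have mX2 : measurable_fun setT (fun w => X w ^+ 2 / C) by apply: measurable_funM => //;
  exact: measurable_funX.
have -> : mean_square P X = (C%:E * \int[P]_w (X w ^+ 2 / C)%:E)%E.
  rewrite -ge0_integralZl //; last 3 first.
  - exact/measurable_EFinP.
  - by move=> w _; rewrite lee_fin divr_ge0 ?sqr_ge0 // ltW.
  - by rewrite lee_fin ltW.
  by apply: eq_integral => w _; rewrite -EFinM mulrCA divff ?gt_eqF // mulr1.
apply: lee_wpmul2l; first by rewrite lee_fin ltW.
apply: ge0_le_lower_integral => w _; first by rewrite lee_fin divr_ge0 ?sqr_ge0 // ltW.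
by rewrite lee_fin ler_pdivrMr // mulrC.
Qed.

Lemma L2null_le X (Y : nat -> Omega -> R) (C : R) : (forall n, measurable_fun setT (X n)) ->
  0 < C -> (forall n w, X n w ^+ 2 <= C * Y n w ^+ 2) ->
  mean_square P (Y n) @[n --> \oo] --> 0%E -> L2null X.
Proof.
move=> mX C0 XY Y0; split => //.
have CY : (C%:E * mean_square P (Y n) @[n --> \oo] --> 0)%E.
  by rewrite -(mule0 C%:E); apply: cvgeZl.
apply: squeeze_cvge CY; last exact: cvg_cst.
by apply: nearW => n; rewrite mean_square_ge0 /=; exact: mean_square_le.
Qed.

Lemma L2null_add X Y : L2null X -> L2null Y -> L2null (fun n w => X n w + Y n w).
Proof.
move=> [mX X0] [mY Y0]; split; first by move=> n; exact: measurable_funD.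
have XY : (2%:E * mean_square P (X n) + 2%:E * mean_square P (Y n) @[n --> \oo] --> 0)%E.
  rewrite -[0%E in X in _ --> X](adde0 0%E) -{1}(mule0 2%:E) -{2}(mule0 2%:E).
  apply: cvgeD; first by rewrite !mule0.
    exact: cvgeZl.
  exact: cvgeZl.
apply: squeeze_cvge XY; last exact: cvg_cst.
apply: nearW => n; rewrite mean_square_ge0 /= /mean_square.
have m2 (Z : Omega -> R) : measurable_fun setT Z -> measurable_fun setT (fun w => (Z w ^+ 2)%:E).
  by move=> mZ; apply/measurable_EFinP; exact: measurable_funX.
rewrite -!ge0_integralZl // ?lee_fin //; last 4 first.
- exact: m2.
- by move=> w _; rewrite lee_fin sqr_ge0.
- exact: m2.
- by move=> w _; rewrite lee_fin sqr_ge0.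
rewrite -ge0_integralD //; last 4 first.
- by move=> w _; rewrite mule_ge0 // lee_fin ?sqr_ge0.
- by apply: measurable_funeM; exact: m2.
- by move=> w _; rewrite mule_ge0 // lee_fin ?sqr_ge0.
- by apply: measurable_funeM; exact: m2.
apply: ge0_le_lower_integral => w _; first by rewrite lee_fin sqr_ge0.
rewrite -!EFinM -EFinD lee_fin -subr_ge0.
rewrite (_ : _ - _ = (X n w - Y n w) ^+ 2) ?sqr_ge0 //; ring.
Qed.

Lemma L2null_sum N (X : nat -> nat -> Omega -> R) : (forall j, (j < N)%N -> L2null (X j)) ->
  L2null (fun n w => \sum_(j < N) X j n w).
Proof.
elim: N => [_|N IH XN].
  split => [n|].
    by rewrite (_ : (fun w => _) = cst 0) //; apply/funext => w; rewrite big_ord0.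
  rewrite (_ : (fun n => _) = cst 0%E); first exact: cvg_cst.
  apply/funext => n; apply: integral0_eq => w _; by rewrite big_ord0 expr0n.
have := L2null_add (IH (fun j jN => XN j (leqW jN))) (XN N (ltnSn N)).
congr L2null; apply/funext => n; apply/funext => w; by rewrite big_ord_recr.
Qed.

Lemma cvge0_near (u : nat -> \bar R) (d0 : R) : u n @[n --> \oo] --> 0%E -> 0 < d0 ->
  \forall n \near \oo, (u n <= d0%:E)%E.
Proof.
move=> /fine_cvgP[ufin u0] d00.
move/cvgrPdist_le: u0 => /(_ _ d00) u0.
near=> n; rewrite -(@fineK _ (u n)); last by near: n.
rewrite lee_fin; apply: le_trans (ler_norm _) _.
by rewrite -[leLHS]normrN -[- _]add0r; near: n.
Unshelve. all: by end_near. Qed.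

End mean_square_null.

Section gaussian_limits.
Context d (Omega : measurableType d) (R : realType).
Variable P : probability Omega R.

Lemma le_add_sqr_div (t d0 : R) : 0 < d0 -> t <= d0 + t ^+ 2 / d0.
Proof.
move=> d00; rewrite -(ler_pM2r d00) mulrDl divfK ?gt_eqF //.
have := sqr_ge0 (t - d0 / 2); nra.
Qed.

Lemma expR_le_tangent (x y : R) : expR x <= expR y + expR x * (x - y).
Proof.
have := expR_ge1Dx (y - x); rewrite expRB ler_pdivlMr ?expR_gt0 //; lra.
Qed.

Lemma expR_min_le (x y K d0 : R) : 0 < d0 ->
  expR (Num.min x K) <= expR y + expR K * (d0 + (y - x) ^+ 2 / d0).
Proof.
move=> d00; apply: le_trans (expR_le_tangent _ y) _; rewrite lerD2l.
have zK : expR (Num.min x K) <= expR K by rewrite ler_expR ge_min lexx orbT.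
have h : Num.min x K - y <= d0 + (y - x) ^+ 2 / d0.
  rewrite -sqrrN opprB; apply: le_trans (le_add_sqr_div _ d00).
  by rewrite lerD2r ge_min lexx.
apply: (@le_trans _ _ (expR (Num.min x K) * (d0 + (y - x) ^+ 2 / d0))).
  by rewrite ler_wpM2l // expR_ge0.
by rewrite ler_wpM2r // addr_ge0 ?(ltW d00) // divr_ge0 ?sqr_ge0 // ltW.
Qed.

Lemma expR_le_young (x y d0 : R) : 0 < d0 ->
  expR y <= expR x + (d0 * expR (2 * y) + (y - x) ^+ 2 / d0).
Proof.
move=> d00; apply: le_trans (expR_le_tangent _ x) _; rewrite lerD2l.
have -> : expR (2 * y) = expR y ^+ 2 by rewrite -expRM_natl mulr_natl.
rewrite -(ler_pM2r d00) mulrDl divfK ?gt_eqF //.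
have := sqr_ge0 (d0 * expR y - (y - x) / 2); have := sqr_ge0 (y - x);
  move: (expR y) (y - x) => E t; nra.
Qed.

Lemma ge0_integral_lin3 (f g h : Omega -> R) (a b : R) :
  measurable_fun setT f -> measurable_fun setT g -> measurable_fun setT h ->
  (forall w, 0 <= f w) -> (forall w, 0 <= g w) -> (forall w, 0 <= h w) -> 0 <= a -> 0 <= b ->
  (\int[P]_w (f w + (a * g w + b * h w))%:E =
   \int[P]_w (f w)%:E + (a%:E * \int[P]_w (g w)%:E + b%:E * \int[P]_w (h w)%:E))%E.
Proof.
move=> mf mg mh f0 g0 h0 a0 b0.
have mE (k : Omega -> R) : measurable_fun setT k ->
  measurable_fun setT (EFin \o k) by move=> mk; exact/measurable_EFinP.
have mM (k : Omega -> R) c : measurable_fun setT k ->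
  measurable_fun setT (fun w => c * k w) by move=> mk; exact: measurable_funM.
have [mag mbh] := (mM _ a mg, mM _ b mh).
have mD : measurable_fun setT (fun w => a * g w + b * h w) by exact: measurable_funD.
have D (k l : Omega -> R) : measurable_fun setT k -> measurable_fun setT l ->
  (forall w, 0 <= k w) -> (forall w, 0 <= l w) ->
    (\int[P]_w (k w + l w)%:E = \int[P]_w (k w)%:E + \int[P]_w (l w)%:E)%E.
  by move=> mk ml k0 l0; rewrite -(ge0_integralD P measurableT) //;
    [move=> w _; rewrite lee_fin|exact: mE|move=> w _; rewrite lee_fin|exact: mE].
have Z (k : Omega -> R) c : measurable_fun setT k -> (forall w, 0 <= k w) -> 0 <= c ->
    (\int[P]_w (c * k w)%:E = c%:E * \int[P]_w (k w)%:E)%E.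
  by move=> mk k0 c0; rewrite -(ge0_integralZl P measurableT) //; [exact: mE|move=> w _;
    rewrite lee_fin].
rewrite D // => [|w]; last by apply: addr_ge0; apply: mulr_ge0.
by rewrite D ?Z // => w; exact: mulr_ge0.
Qed.

(* Both inequalities rest on [expR x >= expR y * (1 + x - y)]; truncating [c * Z]
   makes up for the integrability of [expR (c * Z)], which is not known yet. *)
Lemma gaussian_cvg (Z_ : nat -> Omega -> R) (v_ : nat -> R) (Z : Omega -> R) (v : R) :
  measurable_fun setT Z -> (\forall n \near \oo, gaussian P (Z_ n) (v_ n)) ->
  v_ n @[n --> \oo] --> v ->
  mean_square P (fun w => Z_ n w - Z w) @[n --> \oo] --> 0%E ->
  gaussian P Z v.
Proof.
move=> mZ gZ vv ZZ; split => // c.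
pose m v := expR (c ^+ 2 * v / 2); pose m2 v := expR ((2 * c) ^+ 2 * v / 2).
have cexp a : expR (a * v_ n / 2) @[n --> \oo] --> expR (a * v / 2).
  apply: continuous_cvg; first exact: continuous_expR.
  by apply: cvgMl; apply: cvgMr.
have near_n (d0 : R) : 0 < d0 -> exists n, [/\ gaussian P (Z_ n) (v_ n),
    ((c ^+ 2)%:E * mean_square P (fun w => Z_ n w - Z w)%R <= (d0 ^+ 2)%:E)%E,
    `|m v - m (v_ n)| <= d0 & `|m2 v - m2 (v_ n)| <= 1].
  move=> d00.
  have cZ : ((c ^+ 2)%:E * mean_square P (fun w => Z_ n w - Z w)%R @[n --> \oo] --> 0)%E.
    by rewrite -(mule0 ((c ^+ 2)%:E)) ; exact: cvgeZl.
  have d02 : 0 < d0 ^+ 2 by rewrite exprn_gt0.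
  have h1 := cvge0_near cZ d02.
  have /cvgrPdist_le/(_ _ d00) h2 := cexp (c ^+ 2).
  have /cvgrPdist_le/(_ _ ltr01) h3 := cexp ((2 * c) ^+ 2).
  near \oo => n; exists n; split; by near: n.
have ms n : measurable_fun setT (Z_ n) ->
  measurable_fun setT (fun w => (c * Z_ n w - c * Z w) ^+ 2).
  by move=> mn; apply: measurable_funX; apply: measurable_funB; exact: measurable_funM.
have msE n : measurable_fun setT (Z_ n) -> (\int[P]_w ((c * Z_ n w - c * Z w) ^+ 2)%:E
  = (c ^+ 2)%:E * mean_square P (fun w => Z_ n w - Z w)%R)%E.
  move=> mn; rewrite -ge0_integralZl //.
  - by apply: eq_integral => w _; rewrite -EFinM -exprMn mulrBr.
  - by apply/measurable_EFinP; apply: measurable_funX; exact: measurable_funB.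
  - by move=> w _; rewrite lee_fin sqr_ge0.
  - by rewrite lee_fin sqr_ge0.
have me (f : Omega -> R) : measurable_fun setT f -> measurable_fun setT (fun w => expR (f w)).
  by move=> mf; exact: measurableT_comp.
have mcZ : measurable_fun setT (fun w => c * Z w) by exact: measurable_funM.
apply/eqP; rewrite eq_le; apply/andP; split.
- have trunc (K : R) : (\int[P]_w (expR (Num.min (c * Z w) K))%:E <= (m v)%:E)%E.
    apply/lee_addgt0Pr => eps eps0.
    pose d0 := eps / (1 + expR K * 2).
    have K0 : 0 < 1 + expR K * 2 by rewrite ltr_wpDr // mulr_ge0 ?expR_ge0.
    have d00 : 0 < d0 by rewrite divr_gt0.
    have [n [[mn gn] msn mvn _]] := near_n _ d00.
    apply: (@le_trans _ _ (\int[P]_w (expR (c * Z_ n w) + (expR K * d0 * 1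
      + expR K / d0 * (c * Z_ n w - c * Z w) ^+ 2))%:E)%E).
      apply: ge0_le_lower_integral => w _; first by rewrite lee_fin expR_ge0.
      rewrite lee_fin; apply: le_trans (expR_min_le _ (c * Z_ n w) _ d00) _.
      by rewrite mulr1 mulrDr -[expR K / d0 * _]mulrA [d0^-1 * _]mulrC.
    rewrite (@ge0_integral_lin3 (fun w => expR (c * Z_ n w)) (cst 1)) //; first last.
    + by rewrite divr_ge0 ?expR_ge0 // ltW.
    + by rewrite mulr_ge0 ?expR_ge0 // ltW.
    + by move=> w; exact: sqr_ge0.
    + exact: ms.
    + by apply: me; exact: measurable_funM.
    have -> : (\int[P]_w (cst 1%R w)%:E = 1)%E.
      by rewrite (_ : (fun w => _) = cst 1%E) // integral_cst // mul1e; exact: probability_setT.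
    rewrite mule1 gn msE //.
    apply: (@le_trans _ _ ((m (v_ n))%:E + ((expR K * d0)%:E + (expR K / d0)%:E * (d0 ^+ 2)%:E))%E).
      apply: leeD => //; apply: leeD => //; apply: lee_wpmul2l => //.
      by rewrite lee_fin divr_ge0 ?expR_ge0 // ltW.
    rewrite -EFinM -!EFinD lee_fin.
    have -> : expR K / d0 * d0 ^+ 2 = expR K * d0 by field; rewrite gt_eqF.
    have h : (1 + expR K * 2) * d0 = eps by rewrite /d0 mulrC divfK // gt_eqF.
    move: mvn; rewrite ler_norml => /andP[mvn _].
    rewrite -h; lra.
  have := @ae_fatou _ _ _ P (fun n w => (expR (Num.min (c * Z w) n%:R))%:E)
    (fun w => (expR (c * Z w))%:E) (m v)%:E 0.
  apply => //.
  + by move=> n; apply/measurable_EFinP; apply: me; exact: measurable_minr.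
  + by apply/measurable_EFinP; exact: me.
  + apply: aeW => w; apply: cvg_near_cst.
    exists (Num.truncn `|c * Z w|).+1 => // n /= hn; congr ((expR _)%:E).
    apply/min_idPl; apply: le_trans (ler_norm _) _.
    apply: le_trans (ltW (truncnS_gt _)) _; by rewrite ler_nat.
- apply/lee_addgt0Pr => eps eps0.
  pose d0 := eps / (2 + (m2 v + 1)).
  have K0 : 0 < 2 + (m2 v + 1) by rewrite addr_gt0 // addr_gt0 // expR_gt0.
  have d00 : 0 < d0 by rewrite divr_gt0.
  have [n [[mn gn] msn mvn m2n]] := near_n _ d00.
  have : ((m (v_ n))%:E <= \int[P]_w (expR (c * Z w))%:E + ((d0 * m2 (v_ n))%:E + d0%:E))%E.
    have {1}-> : (m (v_ n))%:E = (\int[P]_w (expR (c * Z_ n w))%:E)%E by rewrite gn.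
    apply: (@le_trans _ _ (\int[P]_w (expR (c * Z w) + (d0 * expR (2 * c * Z_ n w)
      + d0^-1 * (c * Z_ n w - c * Z w) ^+ 2))%:E)%E).
      apply: ge0_le_lower_integral => w _; first by rewrite lee_fin expR_ge0.
      by rewrite lee_fin -mulrA [d0^-1 * _]mulrC; exact: expR_le_young.
    rewrite ge0_integral_lin3 //; first last.
    + by rewrite invr_ge0 ltW.
    + exact: ltW.
    + by move=> w; exact: sqr_ge0.
    + exact: ms.
    + by apply: me; exact: measurable_funM.
    + exact: me.
    rewrite gn leeD2l // msE //; apply: leeD; first by rewrite -EFinM.
    apply: (@le_trans _ _ (d0^-1%:E * (d0 ^+ 2)%:E)%E).
      by rewrite lee_wpmul2l // lee_fin invr_ge0 ltW.
    by rewrite -EFinM expr2 mulKf // gt_eqF.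
  move=> h.
  apply: (@le_trans _ _ ((m (v_ n))%:E + d0%:E)%E).
    rewrite -EFinD lee_fin; move: mvn; rewrite ler_norml => /andP[_ mvn]; rewrite -/(m v); lra.
  apply: le_trans (leeD h (lexx _)) _; rewrite -addeA leeD2l // -!EFinD lee_fin.
  have h' : (2 + (m2 v + 1)) * d0 = eps by rewrite /d0 mulrC divfK // gt_eqF.
  rewrite -h'; move: m2n; rewrite ler_norml => /andP[m2n _].
  have : d0 * m2 (v_ n) <= d0 * (m2 v + 1) by rewrite ler_pM2l //; lra.
  move: (d0 * _) => A; lra.
Unshelve. all: by end_near. Qed.

End gaussian_limits.

(** * Stochastic integrals of deterministic integrands *)

Section step_gaussian.
Context d (Omega : measurableType d) (R : realType).
Variables (P : probability Omega R) (F : R -> set (set Omega)) (eta : nat -> R).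
Variables (b : nat -> R -> Omega -> R) (W : R -> Omega -> U0 R).
Hypothesis HF : usual_filtration P F.
Hypothesis HW : wiener_process P F eta b W.
Hypothesis eta_ge0 : forall k, 0 <= eta k.
Implicit Types (A : U0 R -> H0 R) (xi : H0 R).

Lemma bounded_opE A : bounded_op A -> (forall f g, A (f + g) = A f + A g) /\
  (forall a f, A (a *: f) = a *: A f).
Proof.
move=> [Al _].
have AD f g : A (f + g) = A f + A g by have := Al 1 f g; rewrite !scale1r.
split=> // a f; have A0 : A 0 = 0.
  by have := AD 0 0; rewrite addr0 => /esym/eqP; rewrite addrC -subr_eq0 addrK => /eqP.
by have := Al a f 0; rewrite A0 !addr0.
Qed.

Lemma functionalB A xi f g : bounded_op A ->
  innerH xi (A (f - g)) = innerH xi (A f) - innerH xi (A g).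
Proof. by move=> /bounded_opE[AD AZ]; rewrite AD -scaleN1r AZ scaleN1r innerHBr. Qed.

Lemma functional_sum A xi n (c : nat -> R) (f : nat -> U0 R) : bounded_op A ->
  innerH xi (A (\sum_(k < n) c k *: f k)) = \sum_(k < n) c k * innerH xi (A (f k)).
Proof.
move=> /bounded_opE[AD AZ]; elim: n => [|n IH].
  by rewrite !big_ord0 -(scale0r 0) AZ scale0r innerH0r.
by rewrite !big_ord_recr /= AD innerHDr IH AZ innerHZr.
Qed.

Lemma functional_continuous A xi : bounded_op A -> continuous (fun f => innerH xi (A f)).
Proof.
move=> [_ Ac] f; rewrite (_ : (fun f => _) = (fun z => innerH z xi) \o A); last first.
  by apply/funext => g /=; rewrite innerHC.
by apply: continuous_comp; [exact: Ac|exact: innerH_continuous].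
Qed.

Lemma functional_bound A xi : bounded_op A ->
  exists2 C, 0 < C & forall f, `|innerH xi (A f)| <= C * `|f|.
Proof.
move=> Ab; have [_ AZ] := bounded_opE Ab.
have A0 : A 0 = 0 by rewrite -(scale0r 0) AZ scale0r.
have /(@cvgrPdist_le _ _ _ (nbhs (0 : U0 R)) (nbhs_filter _))/(_ _ ltr01) :=
  @functional_continuous A xi Ab 0.
rewrite A0 innerH0r => /nbhs_normP[dl /= dl0 dlP].
exists (2 / dl); first by rewrite divr_gt0.
move=> f; have [->|f0] := eqVneq f 0; first by rewrite A0 innerH0r !normr0 mulr0.
have nf : 0 < `|f| by rewrite normr_gt0.
pose c := dl / 2 / `|f|.
have c0 : 0 < c by rewrite !divr_gt0.
have := dlP (c *: f).
rewrite /ball_ /= sub0r normrN normrZ (gtr0_norm c0) AZ innerHZr sub0r normrN normrM (gtr0_norm c0).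
have -> : c * `|f| = dl / 2 by rewrite /c divfK ?gt_eqF.
have -> : dl / 2 < dl by rewrite ltr_pdivrMr // ltr_pMr // ltr1n.
move=> /(_ isT); rewrite -ler_pdivlMl // mulr1 => /le_trans; apply.
by rewrite /c; rewrite le_eqVlt; apply/orP; left; apply/eqP; field; rewrite !gt_eqF.
Qed.

Lemma wiener_functional_null A xi t : bounded_op A -> 0 <= t ->
  L2null P (fun m w => \sum_(k < m)
    (Num.sqrt (eta k) * b k t w) * innerH xi (A (e R k)) - innerH xi (A (W t w))).
Proof.
move=> Ab t0; have [Hb _ WE _ Wlim] := HW.
have [C C0 CP] := functional_bound xi Ab.
apply: (L2null_le (C := C ^+ 2) _ _ _ (Wlim t t0)) => [m||m w].
- apply: measurable_funB; last first.
    exact: (random_element_continuous (WE t t0) (functional_continuous Ab)).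
  apply: measurable_sum => k; apply: measurable_funM => //.
  by apply: measurable_funM => //; exact: (brownian_measurable HF (Hb k) t0).
- by rewrite exprn_gt0.
rewrite -(functional_sum _ _ (fun k => Num.sqrt (eta k) * b k t w)) // -functionalB //.
rewrite -exprMn -[leLHS]real_normK ?num_real // lerXn2r ?nnegrE ?mulr_ge0 ?(ltW C0) //.
Qed.

Lemma nneseries_cvg (c : nat -> R) (v : R) : (forall k, 0 <= c k) ->
  (\sum_(k <oo) (c k)%:E = v%:E)%E -> \sum_(k < n) c k @[n --> \oo] --> v.
Proof.
move=> c0 cv.
have := @is_cvg_nneseries R (fun k => (c k)%:E) xpredT 0 (fun k _ _ => c0 k).
rewrite (_ : (fun n => \sum_(k < n) c k) = fine \o (fun n => \sum_(0 <= k < n) (c k)%:E)%E).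
  by move=> H; apply: fine_cvg; rewrite -cv; exact: H.
by apply/funext => n /=; rewrite sumEFin /= big_mkord.
Qed.

Lemma step_gaussian xi T s (A : nat -> U0 R -> H0 R) v : step_integrand T s A ->
  (\sum_(k <oo) (\sum_(j < (size s).-1) eta k * innerH xi (A j (e R k)) ^+ 2 * (s`_j.+1 -
    s`_j))%:E = v%:E)%E ->
  gaussian P (fun w => innerH xi (step_integral s A W w)) v.
Proof.
move=> [ss sT Ab] sv; have [Hb bI WE _ Wlim] := HW.
set N := (size s).-1 in sv *.
have s0 j : 0 <= s`_j.
  have [js|js] := ltnP j (size s); last by rewrite nth_default.
  by have /allP/(_ _ (mem_nth 0 js))/andP[] := sT.
have sS j : (j < N)%N -> s`_j <= s`_j.+1.
  by move=> jN; apply: (sortedP 0 ss); rewrite -ltn_predRL.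
pose c k j := Num.sqrt (eta k) * innerH xi (A j (e R k)).
pose Z k := brownian_sum (b k) (nth 0 s) (c k) N.
pose vk k := \sum_(j < N) c k j ^+ 2 * (s`_j.+1 - s`_j).
have vkE k : vk k = \sum_(j < N) eta k * innerH xi (A j (e R k)) ^+ 2 * (s`_j.+1 - s`_j).
  by apply: eq_bigr => j _; rewrite /c exprMn sqr_sqrtr.
have gZ k : gaussian P (Z k) (vk k).
  exact: (brownian_sum_gaussian HF (Hb k)).
have mstep : measurable_fun setT (fun w => innerH xi (step_integral s A W w)).
  rewrite (_ : (fun w => _) = fun w => \sum_(j < N)
    (innerH xi (A j (W s`_j.+1 w)) - innerH xi (A j (W s`_j w)))).
    by apply: measurable_sum => j; apply: measurable_funB;
      exact: (random_element_continuous (WE _ (s0 _)) (functional_continuous (Ab _))).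
  apply/funext => w; rewrite innerHC /step_integral innerH_suml.
  by apply: eq_bigr => j _; rewrite innerHC functionalB.
apply: (@gaussian_cvg _ _ _ P (fun m w => \sum_(k < m) Z k w) (fun m => \sum_(k < m) vk k)) => //.
- apply: nearW => m; apply: (independent_mgf HF Hb bI) => // k.
  by apply: brownian_sum_sigma => j _; exact: s0.
- apply: nneseries_cvg => [k|].
    by apply: sumr_ge0 => j _; rewrite mulr_ge0 ?sqr_ge0 // subr_ge0 sS.
  by rewrite -sv; apply: eq_eseriesr => k _; rewrite vkE.
pose X j m w := (\sum_(k < m) (Num.sqrt (eta k) * b k s`_j.+1 w) * innerH xi (A j (e R k)) -
  innerH xi (A j (W s`_j.+1 w)))
  + - (\sum_(k < m) (Num.sqrt (eta k) * b k s`_j w) * innerH xi (A j (e R k)) - innerH xi (A j (W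
    s`_j w))).
have XN : L2null P (fun m w => \sum_(j < N) X j m w).
  apply: L2null_sum => j jN; apply: L2null_add; first exact: wiener_functional_null.
  have [mN N0] := wiener_functional_null xi (Ab j) (s0 j).
  apply: (L2null_le (C := 1) _ _ _ N0) => // [m|m w]; first exact: measurable_funN.
  by rewrite mul1r sqrrN.
have [_ XN0] := XN.
rewrite (_ : (fun n => _) = (fun m => mean_square P (fun w => \sum_(j < N) X j m w))) //.
apply/funext => m; congr mean_square; apply/funext => w.
rewrite /X [innerH xi _]innerHC /step_integral innerH_suml /Z /brownian_sum exchange_big /= -sumrB.
apply: eq_bigr => j _; rewrite [innerH _ xi]innerHC functionalB //.
have -> : \sum_(k < m) c k j * incr (b k) s`_j s`_j.+1 w =
    \sum_(k < m) Num.sqrt (eta k) * b k s`_j.+1 w * innerH xi (A j (e R k)) -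
    \sum_(k < m) Num.sqrt (eta k) * b k s`_j w * innerH xi (A j (e R k)).
  by rewrite -sumrB; apply: eq_bigr => k _; rewrite /c /incr; ring.
ring.
Qed.

End step_gaussian.

Section variance.
Context (R : realType).
Variables (Q Qhalf : U0 R -> U0 R) (eta : nat -> R).
Hypothesis eta_ge0 : forall k, 0 <= eta k.
Hypothesis Q_e : forall k, Q (e R k) = eta k *: e R k.
Hypothesis QhalfQ : sqrt_op Qhalf Q.
Implicit Types (xi : H0 R) (T : R) (a b c : nat -> R -> R).
Local Notation leb := (@lebesgue_measure R).

(* The squared norm of [a] in L^2 of the product of the counting measure and [0, T]. *)
Definition sqr_mass T a : \bar R := (\sum_(k <oo) \int[leb]_(r in `[0%R, T]) (a k r ^+ 2)%:E)%E.

Lemma sqr_mass_ge0 T a : (0 <= sqr_mass T a)%E.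
Proof.
by apply: nneseries_ge0 => k _ _; apply: integral_ge0 => r _; rewrite lee_fin sqr_ge0.
Qed.

Lemma sqr_mass_le T a b c (p q : R) : (forall k, measurable_fun setT (b k)) ->
  (forall k, measurable_fun setT (c k)) -> 0 <= p -> 0 <= q ->
  (forall k r, a k r ^+ 2 <= p * b k r ^+ 2 + q * c k r ^+ 2) ->
  (sqr_mass T a <= p%:E * sqr_mass T b + q%:E * sqr_mass T c)%E.
Proof.
move=> mb mc p0 q0 abc.
have g0 (u : nat -> R -> R) k : (0 <= \int[leb]_(r in `[0%R, T]) (u k r ^+ 2)%:E)%E.
  by apply: integral_ge0 => r _; rewrite lee_fin sqr_ge0.
have mD : measurable (`[0%R, T]%classic : set (measurableTypeR R)) by exact: measurable_itv.
rewrite /sqr_mass -!nneseriesZl // -nneseriesD; last 2 first.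
- by move=> k _ _; rewrite mule_ge0 // lee_fin.
- by move=> k _ _; rewrite mule_ge0 // lee_fin.
apply: lee_nneseries => [k _ _|k _]; first exact: g0.
have m2 (u : nat -> R -> R) : measurable_fun setT (u k) ->
    measurable_fun (`[0%R, T]%classic : set (measurableTypeR R)) (fun r => (u k r ^+ 2)%:E).
  by move=> mu; apply/measurable_EFinP; apply: measurable_funX; exact: measurable_funTS.
have [mb2 mc2] := (m2 b (mb k), m2 c (mc k)).
rewrite -ge0_integralZl //; last by move=> r _; rewrite lee_fin sqr_ge0.
rewrite -ge0_integralZl //; last by move=> r _; rewrite lee_fin sqr_ge0.
rewrite -ge0_integralD //; last 4 first.
- by move=> r _; rewrite mule_ge0 // lee_fin ?sqr_ge0.
- exact: measurable_funeM.
- by move=> r _; rewrite mule_ge0 // lee_fin ?sqr_ge0.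
- exact: measurable_funeM.
apply: ge0_le_lower_integral => r _; first by rewrite lee_fin sqr_ge0.
by rewrite -!EFinM -EFinD lee_fin.
Qed.

Lemma sqr_young (x y eps : R) : 0 < eps ->
  x ^+ 2 <= (1 + eps) * y ^+ 2 + (1 + eps^-1) * (x - y) ^+ 2.
Proof.
move=> e0; rewrite -subr_ge0.
have -> : (1 + eps) * y ^+ 2 + (1 + eps^-1) * (x - y) ^+ 2 - x ^+ 2
  = (eps * y - (x - y)) ^+ 2 / eps.
  by field; rewrite gt_eqF.
by rewrite divr_ge0 ?sqr_ge0 // ltW.
Qed.

Lemma indic_sum_sqr (N : nat) (I : nat -> R -> bool) (x : nat -> R) r :
  (forall i j, (i < j < N)%N -> ~~ (I i r && I j r)) ->
  (\sum_(j < N) (I j r)%:R * x j) ^+ 2 = \sum_(j < N) (I j r)%:R * x j ^+ 2.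
Proof.
elim: N => [|N IH] dis; first by rewrite !big_ord0 expr0n.
rewrite !big_ord_recr /=.
have {IH}IH : (\sum_(j < N) (I j r)%:R * x j) ^+ 2 = \sum_(j < N) (I j r)%:R * x j ^+ 2.
  by apply: IH => i j /andP[ij jN]; apply: dis; rewrite ij leqW.
have [IN|_] := boolP (I N r); last by rewrite !mul0r !addr0.
have IN0 j : (j < N)%N -> I j r = false.
  by move=> jN; have := dis j N; rewrite jN ltnSn IN !andbT => /(_ isT) /negbTE.
by rewrite !big1 ?add0r ?mul1r // => j _; rewrite IN0 // mul0r.
Qed.

Lemma step_sqr_mass xi T s (A : nat -> U0 R -> H0 R) : step_integrand T s A ->
  sqr_mass T (fun k r => innerH xi (step_value s A r (Qhalf (e R k)))) =
  (\sum_(k <oo) (\sum_(j < (size s).-1) eta k * innerH xi (A j (e R k)) ^+ 2 * (s`_j.+1 -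
    s`_j))%:E)%E.
Proof.
move=> [ss sT Ab]; set N := (size s).-1.
have mD : measurable (`[0%R, T]%classic : set (measurableTypeR R)) by exact: measurable_itv.
have mI i : measurable (`]s`_i,
  s`_i.+1]%classic : set (measurableTypeR R)) by exact: measurable_itv.
have smon i j : (i <= j)%N -> (j < size s)%N -> s`_i <= s`_j.
  move=> ij js; apply: (sorted_leq_nth le_trans lexx 0 ss) => //.
  by rewrite inE (leq_ltn_trans ij).
apply: eq_eseriesr => k _.
pose x j := Num.sqrt (eta k) * innerH xi (A j (e R k)).
transitivity (\int[leb]_(r in `[0%R, T]) (\sum_(j < N) (x j ^+ 2)%:E * (\1_(`]s`_j,
  s`_j.+1]%classic) r)%:E))%E.
  apply: eq_integral => r _.
  rewrite (eq_bigr (fun j : 'I_N => ((r \in `]s`_j, s`_j.+1]%classic)%:R * x j ^+ 2)%:E));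
    last first.
    by move=> j _; rewrite -EFinM mulrC indicE.
  rewrite sumEFin; congr EFin.
  rewrite innerHC /step_value innerH_suml -/N.
  rewrite (eq_bigr (fun j : 'I_N => (r \in `]s`_j, s`_j.+1]%classic)%:R * x j)); last first.
    move=> j _; rewrite innerHZl indicE (Qhalf_e eta_ge0 Q_e QhalfQ);
      have [_ AZ] := bounded_opE (Ab j).
    by rewrite AZ innerHZl innerHC.
  rewrite (@indic_sum_sqr N (fun j r => r \in `]s`_j, s`_j.+1]%classic)) //.
  move=> i j /andP[ij jN]; apply/negP => /andP[/set_mem/= + /set_mem/=].
  rewrite !in_itv /= => /andP[_ ri] /andP[jr _].
  have : s`_i.+1 <= s`_j by apply: smon => //; rewrite (leq_trans jN) // leq_pred.
  by move=> /(le_trans ri); rewrite leNgt jr.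
rewrite ge0_integral_sum //; first last.
- by move=> j r _; rewrite mule_ge0 // lee_fin ?sqr_ge0 // indicE.
- move=> j; apply: measurable_funeM; apply/measurable_EFinP; apply: measurable_funTS.
  exact: measurable_indic (mI j).
rewrite -sumEFin; apply: eq_bigr => j _.
rewrite ge0_integralZl //; first last.
- by rewrite lee_fin sqr_ge0.
- by apply/measurable_EFinP; apply: measurable_funTS; exact: measurable_indic (mI j).
rewrite (integral_indic leb mD (mI j)) setIidl; last first.
  have jN : (j.+1 < size s)%N by rewrite -ltn_predRL.
  have /allP/(_ _ (mem_nth 0 (ltnW jN)))/andP[s0 _] := sT.
  have /allP/(_ _ (mem_nth 0 jN))/andP[_ s1] := sT.
  move=> r; rewrite /= !in_itv /= => /andP[sr rs].
  by rewrite (le_trans s0 (ltW sr)) (le_trans rs s1).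
have sj : s`_j <= s`_j.+1 by apply: smon => //; rewrite -ltn_predRL.
rewrite [X in (_ * X)%E](lebesgue_measure_itv `]s`_j, s`_j.+1]) /= lte_fin.
have -> : x j ^+ 2 = eta k * innerH xi (A j (e R k)) ^+ 2 by rewrite /x exprMn sqr_sqrtr.
case: ltP => [_|js]; first by rewrite EFinM.
have -> : s`_j.+1 - s`_j = 0 by apply/eqP; rewrite subr_eq0 eq_le js sj.
by rewrite mulr0 mule0.
Qed.

End variance.

Section stochastic_gaussian.
Context d (Omega : measurableType d) (R : realType).
Variables (P : probability Omega R) (F : R -> set (set Omega)) (eta : nat -> R).
Variables (b : nat -> R -> Omega -> R) (W : R -> Omega -> U0 R).
Variables (Q Qhalf : U0 R -> U0 R).
Hypothesis HF : usual_filtration P F.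
Hypothesis HW : wiener_process P F eta b W.
Hypothesis eta_ge0 : forall k, 0 <= eta k.
Hypothesis Q_e : forall k, Q (e R k) = eta k *: e R k.
Hypothesis QhalfQ : sqrt_op Qhalf Q.
Local Notation leb := (@lebesgue_measure R).

Lemma sqr_mass_hs xi T (D : nat -> R -> R) (Psi : R -> U0 R -> H0 R) :
  (forall k, measurable_fun setT (D k)) ->
  (forall k r, D k r = innerH xi (Psi r (Qhalf (e R k)))) ->
  (sqr_mass T D <= (Hnorm xi ^+ 2 + 1)%:E *
    \int[leb]_(r in `[0%R, T]) hs_norm2 (fun v => Psi r (Qhalf v)))%E.
Proof.
move=> mD DE; set p := Hnorm xi ^+ 2 + 1.
have p0 : 0 < p by rewrite /p ltr_wpDl ?sqr_ge0.
have mI : measurable (`[0%R, T]%classic : set (measurableTypeR R)) by exact: measurable_itv.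
have mDp k : measurable_fun (`[0%R,
  T]%classic : set (measurableTypeR R)) (fun r => (D k r ^+ 2 / p)%:E).
  apply/measurable_EFinP; apply: measurable_funM; last exact: measurable_cst.
  by apply: measurable_funX; apply: measurable_funTS; exact: mD.
have Dp0 k r : (0 <= (D k r ^+ 2 / p)%:E)%E by rewrite lee_fin divr_ge0 ?sqr_ge0 // ltW.
have -> : sqr_mass T D = (p%:E * \int[leb]_(r in `[0%R, T]) \sum_(k <oo) (D k r ^+ 2 / p)%:E)%E.
  rewrite integral_nneseries // -nneseriesZl; last first.
    by move=> k _; apply: integral_ge0 => r _; exact: Dp0.
  apply: eq_eseriesr => k _; rewrite -ge0_integralZl //; last by rewrite lee_fin ltW.
  by apply: eq_integral => r _; rewrite -EFinM mulrCA divff ?gt_eqF // mulr1.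
apply: lee_wpmul2l; first by rewrite lee_fin ltW.
apply: ge0_le_lower_integral => r _; first by apply: nneseries_ge0 => k _ _; exact: Dp0.
apply: lee_nneseries => [k _ _|k _]; first exact: Dp0.
rewrite lee_fin ler_pdivrMr // DE mulrC.
rewrite -[leLHS]real_normK ?num_real //.
apply: (@le_trans _ _ (Hnorm xi ^+ 2 * Hnorm (Psi r (Qhalf (e R k))) ^+ 2)).
  rewrite -exprMn lerXn2r ?nnegrE ?mulr_ge0 ?Hnorm_ge0 //; exact: cauchy_schwarzH.
by rewrite ler_wpM2r ?sqr_ge0 // /p lerDl.
Qed.

Lemma stochastic_gaussian xi T (Phi : R -> U0 R -> H0 R) Y V :
  (forall k, measurable_fun setT (fun r => innerH xi (Phi r (Qhalf (e R k))))) ->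
  sqr_mass T (fun k r => innerH xi (Phi r (Qhalf (e R k)))) = V%:E ->
  stochastic_integral P Qhalf W T Phi Y ->
  gaussian P (fun w => innerH xi (Y w)) V.
Proof.
move=> mPhi PhiV [mY [s [A [sA hs ms]]]].
pose a n k r := innerH xi (step_value (s n) (A n) r (Qhalf (e R k))).
pose c k r := innerH xi (Phi r (Qhalf (e R k))).
pose dif n k r := a n k r - c k r.
have ma n k : measurable_fun setT (a n k).
  rewrite (_ : a n k = fun r => \sum_(j < (size (s n)).-1) (r \in `](s n)`_j,
    (s n)`_j.+1]%classic)%:R * innerH xi (A n j (Qhalf (e R k)))); last first.
    apply/funext => r; rewrite /a innerHC /step_value innerH_suml.
    by apply: eq_bigr => j _; rewrite innerHZl indicE innerHC.
  apply: measurable_sum => j; apply: measurable_funM => //.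
  have mI : measurable (`](s n)`_j,
    (s n)`_j.+1]%classic : set (measurableTypeR R)) by exact: measurable_itv.
  exact: measurable_indic mI.
have mdif n k : measurable_fun setT (dif n k) by apply: measurable_funB => //; exact: mPhi.
have V0 : 0 <= V by rewrite -lee_fin -PhiV sqr_mass_ge0.
set p := Hnorm xi ^+ 2 + 1; have p0 : 0 < p by rewrite /p ltr_wpDl ?sqr_ge0.
have dif0 : sqr_mass T (dif n) @[n --> \oo] --> 0%E.
  have h : (p%:E * \int[leb]_(r in `[0%R, T]) hs_norm2 (fun v => step_value (s n)
    (A n) r (Qhalf v) - Phi r (Qhalf v))%R @[n --> \oo] --> 0)%E.
    by rewrite -(mule0 p%:E); exact: cvgeZl.
  apply: squeeze_cvge h; last exact: cvg_cst.
  apply: nearW => n; rewrite sqr_mass_ge0 /=.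
  apply: (@sqr_mass_hs xi T (dif n) (fun r v => step_value (s n) (A n) r v - Phi r v)) => // k r.
  by rewrite /dif /a /c innerHBr.
have upper n eps : 0 < eps -> (sqr_mass T (a n)
  <= (1 + eps)%:E * V%:E + (1 + eps^-1)%:E * sqr_mass T (dif n))%E.
  move=> e0; rewrite -PhiV; apply: sqr_mass_le => //.
  - by rewrite addr_ge0 // ltW.
  - by rewrite addr_ge0 // invr_ge0 ltW.
  - by move=> k r; exact: sqr_young.
have lower n eps : 0 < eps -> (V%:E
  <= (1 + eps)%:E * sqr_mass T (a n) + (1 + eps^-1)%:E * sqr_mass T (dif n))%E.
  move=> e0; rewrite -PhiV; apply: sqr_mass_le => //.
  - by rewrite addr_ge0 // ltW.
  - by rewrite addr_ge0 // invr_ge0 ltW.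
  - by move=> k r; rewrite -[dif n k r ^+ 2]sqrrN /dif opprB; exact: sqr_young.
have nearD dl : 0 < dl -> \forall n \near \oo, exists2 D : R, 0 <= D
  <= dl & sqr_mass T (dif n) = D%:E.
  move=> dl0; have := cvge0_near dif0 dl0; apply: filterS => n nd.
  have fin : sqr_mass T (dif n) \is a fin_num.
    by rewrite ge0_fin_numE ?sqr_mass_ge0 // (le_lt_trans nd) ?ltry.
  exists (fine (sqr_mass T (dif n))); last by rewrite fineK.
  by rewrite -!lee_fin fineK // sqr_mass_ge0.
pose v_ n := fine (sqr_mass T (a n)).
have vfin n (D : R) : sqr_mass T (dif n) = D%:E -> sqr_mass T (a n) = (v_ n)%:E.
  move=> DE; rewrite /v_ fineK // ge0_fin_numE ?sqr_mass_ge0 //.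
  have := upper n 1 ltr01; rewrite DE -!EFinM -EFinD => /le_lt_trans; apply; exact: ltry.
have vbound n (D : R) eps : 0 < eps -> sqr_mass T (dif n) = D%:E ->
    v_ n <= (1 + eps) * V + (1 + eps^-1) * D /\ V <= (1 + eps) * v_ n + (1 + eps^-1) * D.
  move=> e0 DE; have vE := vfin n D DE.
  have := upper n eps e0; have := lower n eps e0; rewrite vE DE -!EFinM -!EFinD !lee_fin; by split.
apply: (@gaussian_cvg _ _ _ P (fun n w => innerH xi (step_integral (s n) (A n) W w)) v_).
- rewrite (_ : (fun w => _) = (fun z => innerH z xi) \o Y); last by apply/funext => w /=;
  rewrite innerHC.
  by apply: random_element_continuous => //; exact: innerH_continuous.
- have := nearD 1 ltr01; apply: filterS => n [D _ DE].
  by apply: (step_gaussian HF HW eta_ge0 (sA n));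
    rewrite -(step_sqr_mass eta_ge0 Q_e QhalfQ xi (sA n)) -(vfin n D).
- apply/cvgrPdist_le => dl dl0.
  pose eps := dl / (2 * (2 * V + 2)).
  have W0 : 0 < 2 * V + 2 by rewrite ltr_wpDl ?mulr_ge0.
  have e0 : 0 < eps by rewrite divr_gt0 // mulr_gt0.
  have K0 : 0 < 1 + eps^-1 by rewrite ltr_wpDr // invr_ge0 ltW.
  have dl'0 : 0 < Num.min 1 (dl / (2 * (1 + eps^-1))).
    by rewrite lt_min ltr01 divr_gt0 // mulr_gt0.
  have := nearD _ dl'0; apply: filterS => n [D /andP[D0 +] DE].
  rewrite le_min => /andP[D1 Ddl].
  have KD : (1 + eps^-1) * D <= dl / 2.
    move: Ddl; rewrite ler_pdivlMr ?mulr_gt0 // => Ddl; lra.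
  have eW : eps * (2 * V + 2) = dl / 2 by rewrite /eps; field; rewrite gt_eqF.
  have [u1 _] := vbound n D 1 ltr01 DE.
  have [u2 l2] := vbound n D eps e0 DE.
  have vle : v_ n <= 2 * V + 2 by move: u1; rewrite invr1; lra.
  have ev : eps * v_ n <= dl / 2 by rewrite -eW ler_pM2l.
  have eV : eps * V <= dl / 2 by rewrite -eW ler_pM2l //; lra.
  rewrite ler_norml; lra.
have h : (p%:E * mean_square P (fun w => Hnorm (step_integral (s n)
  (A n) W w - Y w))%R @[n --> \oo] --> 0)%E.
  by rewrite -(mule0 p%:E); exact: cvgeZl.
have mYxi : measurable_fun setT (fun w => innerH xi (Y w)).
  rewrite (_ : (fun w => _) = (fun z => innerH z xi) \o Y); last by apply/funext => w /=;
    rewrite innerHC.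
  by apply: random_element_continuous => //; exact: innerH_continuous.
apply: squeeze_cvge h; last exact: cvg_cst.
have := nearD 1 ltr01; apply: filterS => n [D _ DE].
have [mZ _] : gaussian P (fun w => innerH xi (step_integral (s n) (A n) W w)) (v_ n).
  by apply: (step_gaussian HF HW eta_ge0 (sA n));
    rewrite -(step_sqr_mass eta_ge0 Q_e QhalfQ xi (sA n)) -(vfin n D).
rewrite mean_square_ge0 /=; apply: mean_square_le => // [|w]; first exact: measurable_funB.
rewrite -innerHBr -[leLHS]real_normK ?num_real //.
apply: (@le_trans _ _ (Hnorm xi ^+ 2 * Hnorm (step_integral (s n) (A n) W w - Y w) ^+ 2)).
  rewrite -exprMn lerXn2r ?nnegrE ?mulr_ge0 ?Hnorm_ge0 //; exact: cauchy_schwarzH.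
by rewrite ler_wpM2r ?sqr_ge0 // /p lerDl.
Qed.

End stochastic_gaussian.

(** * The group of the Schrodinger equation *)

Section dirichlet_eigenfunctions.
Variable R : realType.
Local Notation mu := (@mu0pi R).
Local Notation leb := (@lebesgue_measure R).
Implicit Types (f g h : U0 R).

Lemma integrable_mu0pi_continuous (f : R -> R) : continuous f ->
  mu.-integrable setT (EFin \o f).
Proof.
move=> cf.
have mf : measurable_fun setT (f : measurableTypeR R -> R) by exact: continuous_measurable_fun.
have mfE : measurable_fun setT (EFin \o f : measurableTypeR R -> \bar R) by exact/measurable_EFinP.
have /integrableP[_ fI] : leb.-integrable `[0, pi] (EFin \o f).
  apply: continuous_compact_integrable; first exact: segment_compact.
  exact: continuous_subspaceT.
apply/integrableP; split => //.
rewrite ge0_integral_mu0pi //; last exact: measurableT_comp.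
apply: le_lt_trans fI; apply: ge0_subset_integral => //;
  first by apply: measurableT_comp => //; exact: measurable_funTS.
exact: subset_itv_oo_cc.
Qed.

Lemma is_derive_continuous (u v : R -> R) : (forall x : R, is_derive x 1 u (v x)) -> continuous u.
Proof.
move=> du x; apply: differentiable_continuous; apply/derivable1_diffP; exact: ex_derive.
Qed.

Lemma weak_deriv_classical (u v : R -> R) f g :
  (forall x : R, is_derive x 1 u (v x)) -> continuous v ->
  (f : R -> R) = u %[ae mu] -> (g : R -> R) = v %[ae mu] -> weak_deriv f g.
Proof.
move=> du cv fu gv phi [dphi [a [c [a0 cpi phi0]]]].
have cu := is_derive_continuous du.
have dp (x : R) : is_derive x 1 phi (derive1 phi x).
  by rewrite derive1E; apply: derivableP; exact: (dphi 0%N).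
have dp' (x : R) : is_derive x 1 (derive1 phi) (derive1 (derive1 phi) x).
  by rewrite derive1E; apply: derivableP; exact: (dphi 1%N).
have cp := is_derive_continuous dp; have cp' := is_derive_continuous dp'.
have mc (w : R -> R) : continuous w -> measurable_fun setT (w : measurableTypeR R -> R).
  exact: continuous_measurable_fun.
have -> : \int[mu]_x (f x * derive1 phi x) = \int[mu]_x (u x * derive1 phi x).
  apply: eq_ae_Rintegral.
  - by apply: measurable_funM; [exact: measurable_U0|exact: mc].
  - by apply: measurable_funM; exact: mc.
  - apply: (@filterS _ (almost_everywhere mu) _ _ _ _ fu) => x /(_ I)/= + _; by move=> ->.
have -> : \int[mu]_x (g x * phi x) = \int[mu]_x (v x * phi x).
  apply: eq_ae_Rintegral.
  - by apply: measurable_funM; [exact: measurable_U0|exact: mc].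
  - by apply: measurable_funM; exact: mc.
  - apply: (@filterS _ (almost_everywhere mu) _ _ _ _ gv) => x /(_ I)/= + _; by move=> ->.
have cM (w z : R -> R) : continuous w -> continuous z -> continuous (fun x => w x * z x).
  by move=> cw cz x; apply: cvgM; [exact: cw|exact: cz].
apply/eqP; rewrite -subr_eq0 opprK -RintegralD //; last 2 first.
- by apply: integrable_mu0pi_continuous; exact: cM.
- by apply: integrable_mu0pi_continuous; exact: cM.
have dF (x : R) : is_derive x 1 (fun x => u x * phi x) (u x * derive1 phi x + v x * phi x).
  have := is_deriveM (du x) (dp x).
  by move/is_derive_eq; apply; rewrite -![_ *: _]/(_ * _) [phi x * _]mulrC.
rewrite (Rintegral_derive _ dF); last by move=> x; apply: cvgD; exact: cM.
rewrite !phi0 ?mulr0 ?subrr //; first by rewrite in_itv /= negb_and -!ltNge a0.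
by rewrite in_itv /= negb_and -!ltNge cpi orbT.
Qed.

Lemma zeroU0E : (0 : U0 R) = (cst 0 : R -> R) %[ae mu].
Proof.
rewrite -(scale0r (0 : U0 R)); have := U0scaleE 0 (0 : U0 R).
by apply: filterS => x /= /(_ I) -> _; rewrite mul0r.
Qed.

Lemma inH10_0 : inH10 (0 : U0 R).
Proof.
split.
  exists 0; apply: (@weak_deriv_classical (cst 0) (cst 0)) => //; try exact: zeroU0E.
  by move=> x; exact: cst_continuous.
exists (cst 0); split => //; last exact: zeroU0E.
by apply: continuous_subspaceT => x; exact: cst_continuous.
Qed.

Lemma weak_deriv0 : weak_deriv (0 : U0 R) 0.
Proof.
by apply: (@weak_deriv_classical (cst 0) (cst 0)) => //; [move=> x;
  exact: cst_continuous|exact: zeroU0E..].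
Qed.

Definition cosine k (x : R) : R := k.+1%:R * (Num.sqrt (2 / pi) * cos (k.+1%:R * x)).

Lemma cosine_Lfun k : cosine k \in Lfun mu 2%:E.
Proof.
have mcos : measurable_fun setT (cosine k : measurableTypeR R -> R).
  apply: continuous_measurable_fun => x; apply: cvgMr; apply: cvgMr; exact: continuous_cos_scale.
apply: (@bounded_Lfun2 _ _ _ mu _ (k.+1%:R * Num.sqrt (2 / pi)) mcos) => x.
rewrite !normrM ger0_norm // (ger0_norm (sqrtr_ge0 _)) ler_wpM2l // ler_piMr ?sqrtr_ge0 //.
by rewrite ler_norml cos_geN1 cos_le1.
Qed.

Definition cosine_class k : U0 R := L2class (Lfun_Sub (le1_2 R) (cosine_Lfun k)).

Lemma is_derive_sine k (x : R) : is_derive x 1 (@sine R k) (cosine k x).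
Proof.
have := is_deriveZ (Num.sqrt (2 / pi)) (is_derive_sin_scale k.+1%:R x).
by move/is_derive_eq; apply; rewrite /cosine -[LHS]/(_ * _) mulrCA.
Qed.

Lemma is_derive_cosine k (x : R) : is_derive x 1 (cosine k) (- k.+1%:R ^+ 2 * @sine R k x).
Proof.
have := is_deriveZ k.+1%:R (is_deriveZ (Num.sqrt (2 / pi)) (is_derive_cos_scale k.+1%:R x)).
by move/is_derive_eq; apply; rewrite /sine -[LHS]/(_ * (_ * _)); ring.
Qed.

Lemma cosine_classE k : (cosine_class k : R -> R) = cosine k %[ae mu].
Proof. exact: L2class_fun. Qed.

Lemma weak_deriv_e k : weak_deriv (e R k) (cosine_class k).
Proof.
apply: weak_deriv_classical (eU0E R k) (cosine_classE k); first exact: is_derive_sine.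
exact: (is_derive_continuous (is_derive_cosine k)).
Qed.

Lemma laplacian_e k : laplacian (e R k) (- k.+1%:R ^+ 2 *: e R k).
Proof.
split; last first.
  exists (cosine_class k); first exact: weak_deriv_e.
  apply: (weak_deriv_classical (is_derive_cosine k) _ (cosine_classE k)).
    by move=> x; apply: cvgMr; exact: (is_derive_continuous (is_derive_sine k)).
  have := @filterS2 _ (almost_everywhere mu) _ _ _ _ _ (U0scaleE (- k.+1%:R ^+ 2) (e R k))
    (eU0E R k).
  by apply => x /(_ I)/= -> /(_ I) /= -> _.
split; first by exists (cosine_class k); exact: weak_deriv_e.
exists (@sine R k); split; last exact: (eU0E R k).
- apply: continuous_subspaceT; exact: (is_derive_continuous (is_derive_sine k)).
- by rewrite /sine mulr0 sin0 mulr0.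
- by rewrite /sine sin_natpi mulr0.
Qed.

Lemma laplacian_0 : laplacian (0 : U0 R) 0.
Proof. by split; [exact: inH10_0|exists 0; exact: weak_deriv0]. Qed.

End dirichlet_eigenfunctions.

Section group.
Variables (R : realType) (S : R -> H0 R -> H0 R).
Hypothesis HS : schrodinger_group S.
Local Notation freq k := (k.+1%:R ^+ 2 : R).
Implicit Types (z w : H0 R).

Lemma groupD t z w : S t (z + w) = S t z + S t w.
Proof. by have [[/(_ t) [Sl _] _ _ _] _] := HS; have := Sl 1 z w; rewrite !scale1r. Qed.

Lemma group0 t : S t 0 = 0.
Proof. by have := groupD t 0 0; rewrite addr0 => /esym/eqP;
  rewrite addrC -subr_eq0 addrK => /eqP. Qed.

Lemma groupZ t a z : S t (a *: z) = a *: S t z.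
Proof. by have [[/(_ t) [Sl _] _ _ _] _] := HS; have := Sl a z 0; rewrite group0 !addr0. Qed.

Lemma is_derive_group z w t zeta : generator S z w ->
  is_derive t (1 : R) (fun r => innerH (S r z) zeta) (innerH (S t w) zeta).
Proof.
move=> gen; have [[Sb S0 SD _] _] := HS.
have cvgq : (fun h : R => h^-1 *: (((fun r => innerH (S r z) zeta) \o shift t)
  (h *: 1) - innerH (S t z) zeta)) @ 0^' --> innerH (S t w) zeta.
  rewrite (_ : (fun h => _) = (fun y => innerH (S t y) zeta) \o (fun h : R => h^-1 *: (S h z -
    z))); last first.
    apply/funext => h; rewrite [RHS]/= (groupZ t h^-1 (S h z - z)) innerHZl (groupD t (S h z)
      (- z)) innerHDl.
    by rewrite -[- z]scaleN1r groupZ innerHZl mulN1r -SD [t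
      + h]addrC /= /shift /= -[h%:A]/(h * 1) mulr1.
  apply: (@cvg_comp _ _ _ _ (fun y => innerH (S t y) zeta) _ (nbhs w)); first exact: gen.
  have [_ Sc] := Sb t.
  by apply: (@continuous_comp _ _ _ (S t) (fun y => innerH y zeta));
    [exact: Sc|exact: innerH_continuous].
by apply: DeriveDef; [apply/cvg_ex; eexists; exact: cvgq|exact: cvg_lim cvgq].
Qed.

Lemma generator_e_re k : generator S (e R k, 0) (- freq k *: (0, e R k)).
Proof.
have [_ HG] := HS; apply/HG; exists (- freq k *: (e R k, 0)).
  by split; rewrite /= ?scaler0; [exact: laplacian_e|exact: laplacian_0].
transitivity (- freq k *: (0 : U0 R), - freq k *: e R k); first by [].
transitivity (- (- freq k *: (0 : U0 R)), - freq k *: e R k); last by [].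
by rewrite !scaler0 oppr0.
Qed.

Lemma generator_e_im k : generator S (0, e R k) (freq k *: (e R k, 0)).
Proof.
have [_ HG] := HS; apply/HG; exists (- freq k *: (0, e R k)).
  by split; rewrite /= ?scaler0; [exact: laplacian_0|exact: laplacian_e].
transitivity (freq k *: e R k, freq k *: (0 : U0 R)); first by [].
transitivity (- (- freq k *: e R k), - freq k *: (0 : U0 R)); last by [].
by rewrite !scaler0 scaleNr opprK.
Qed.

(* The pairings of the orbits of [(e k, 0)] and [(0, e k)] with a fixed vector solve
   [f' = - om g], [g' = om f]; rotating back by [om t] gives constants. *)
Lemma rotation_ode (f g : R -> R) (om : R) :
  (forall t : R, is_derive t 1 f (- om * g t)) -> (forall t : R, is_derive t 1 g (om * f t)) ->
  forall t, f t = cos (om * t) * f 0 - sin (om * t) * g 0 /\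
    g t = sin (om * t) * f 0 + cos (om * t) * g 0.
Proof.
move=> df dg t.
have dc (x : R) := is_derive_cos_scale om x; have ds (x : R) := is_derive_sin_scale om x.
pose p x := f x * cos (om * x) + g x * sin (om * x).
pose q x := g x * cos (om * x) - f x * sin (om * x).
have p0 : p t = p 0.
  apply: is_derive_0_is_cst => x.
  have := is_deriveD (is_deriveM (df x) (dc x)) (is_deriveM (dg x) (ds x)).
  by move/is_derive_eq; apply; rewrite -![_ *: _]/(_ * _); ring.
have q0 : q t = q 0.
  apply: is_derive_0_is_cst => x.
  have := is_deriveB (is_deriveM (dg x) (dc x)) (is_deriveM (df x) (ds x)).
  by move/is_derive_eq; apply; rewrite -![_ *: _]/(_ * _); ring.
move: p0 q0; rewrite /p /q mulr0 cos0 sin0 !mulr0 !mulr1 addr0 subr0 => <- <-.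
have := cos2Dsin2 (om * t); move: (cos _) (sin _) => c s cs.
by split; [rewrite -[LHS]mulr1|rewrite -[LHS]mulr1]; rewrite -cs; ring.
Qed.

Lemma innerH_ext z w : (forall zeta, innerH z zeta = innerH w zeta) -> z = w.
Proof.
move=> h; apply/eqP; rewrite -subr_eq0; apply/eqP/Hnorm0_eq0.
have /eqP := Hnorm2 (z - w); rewrite innerHBl h subrr expf_eq0 /=; exact: eqP.
Qed.

Lemma group_rotation z w om t : generator S z (- om *: w) -> generator S w (om *: z) ->
  S t z = cos (om * t) *: z - sin (om * t) *: w /\
  S t w = sin (om * t) *: z + cos (om * t) *: w.
Proof.
move=> gz gw; have [[_ S0 _ _] _] := HS.
have H zeta r : innerH (S r z) zeta = cos (om * r) * innerH z zeta - sin (om * r) * innerH w zeta /\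
    innerH (S r w) zeta = sin (om * r) * innerH z zeta + cos (om * r) * innerH w zeta.
  have := @rotation_ode (fun r => innerH (S r z) zeta) (fun r => innerH (S r w) zeta) om.
  rewrite !S0; apply => x.
  - by have := is_derive_group x zeta gz; rewrite groupZ innerHZl.
  - by have := is_derive_group x zeta gw; rewrite groupZ innerHZl.
split; apply: innerH_ext => zeta; have [h1 h2] := H zeta t.
  by rewrite h1 innerHBl !innerHZl.
by rewrite h2 innerHDl !innerHZl.
Qed.

Lemma EH_even k : EH R k.*2 = (e R k, 0).
Proof. by rewrite /EH odd_double doubleK. Qed.

Lemma EH_odd k : EH R k.*2.+1 = (0, e R k).
Proof. by rewrite /EH /= odd_double /= uphalf_double. Qed.

Lemma group_EH k t :
  S t (EH R k.*2) = cos (freq k * t) *: EH R k.*2 - sin (freq k * t) *: EH R k.*2.+1 /\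
  S t (EH R k.*2.+1) = sin (freq k * t) *: EH R k.*2 + cos (freq k * t) *: EH R k.*2.+1.
Proof.
by apply: group_rotation; rewrite EH_even EH_odd; [exact: generator_e_re|exact: generator_e_im].
Qed.

Lemma EH_expansion z : \sum_(i < N) cH i z *: EH R i @[N --> \oo] --> z.
Proof.
apply/cvgrPdist_le => eps eps0.
have e2 : 0 < eps ^+ 2 by rewrite exprn_gt0.
have /cvgrPdist_le/(_ _ e2) := @parseval R z.
apply: filterS => N hN; apply: le_trans (norm_le_Hnorm _) _.
rewrite -(@ler_pXn2r _ 2) ?nnegrE ?Hnorm_ge0 ?(ltW eps0) //.
by rewrite pythagoras; exact: le_trans (ler_norm _) hN.
Qed.

Lemma functional_ext t w w' : (forall n, innerH (S t (EH R n)) w = innerH (EH R n) w') ->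
  forall z, innerH (S t z) w = innerH z w'.
Proof.
move=> SE z; have [[Sb _ _ _] _] := HS; have [_ Sc] := Sb t.
have c1 : innerH (S t (\sum_(i < N) cH i z *: EH R i)) w @[N --> \oo] --> innerH (S t z) w.
  apply: (@cvg_comp _ _ _ _ (fun y => innerH (S t y) w) _ (nbhs z)); first exact: EH_expansion.
  by apply: (@continuous_comp _ _ _ (S t) (fun y => innerH y w));
    [exact: Sc|exact: innerH_continuous].
have c2 : innerH (\sum_(i < N) cH i z *: EH R i) w' @[N --> \oo] --> innerH z w'.
  apply: (@cvg_comp _ _ _ _ (fun y => innerH y w') _ (nbhs z)); first exact: EH_expansion.
  exact: innerH_continuous.
have E : (fun N => innerH (S t (\sum_(i < N) cH i z *: EH R i)) w)
  = (fun N => innerH (\sum_(i < N) cH i z *: EH R i) w').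
  apply/funext => N; elim: N => [|N IH]; first by rewrite !big_ord0 group0 !innerH0l.
  by rewrite !big_ord_recr /= groupD !innerHDl IH groupZ !innerHZl SE.
by rewrite E in c1; apply: cvg_unique c1 c2.
Qed.

Lemma group_coord t k z :
  cH k.*2 (S t z) = cos (freq k * t) * cH k.*2 z + sin (freq k * t) * cH k.*2.+1 z /\
  cH k.*2.+1 (S t z) = - sin (freq k * t) * cH k.*2 z + cos (freq k * t) * cH k.*2.+1 z.
Proof.
set c := cos _; set s := sin _.
have SE n := group_EH n t.
have ee (i j : nat) : (i.*2 == j.*2.+1) = false.
  by apply/negbTE/eqP => /(congr1 odd); rewrite /= !odd_double.
have eo (i j : nat) : (i.*2.+1 == j.*2) = false by rewrite eq_sym.
have dd (i j : nat) : (i.*2 == j.*2) = (i == j) by rewrite (inj_eq double_inj).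
have par n : n = n./2.*2 \/ n = n./2.*2.+1.
  by have := odd_double_half n; case: (odd n) => <-; [right|left];
    rewrite ?add0n ?add1n /= ?uphalf_double ?doubleK.
split.
- rewrite /cH (_ : _ + _ = innerH z (c *: EH R k.*2 + s *: EH R k.*2.+1)).
    apply: functional_ext => n; case: (par n) => ->.
      rewrite (SE _).1 innerHBl innerHDr !innerHZl !innerHZr !EH_orthonormal ?eqSS ?dd ?ee ?eo.
      by case: eqP => [->|_]; rewrite !mulr0 ?subr0 ?addr0.
    rewrite (SE _).2 innerHDl innerHDr !innerHZl !innerHZr !EH_orthonormal ?eqSS ?dd ?ee ?eo.
    by case: eqP => [->|_]; rewrite !mulr0 ?addr0 ?add0r.
  by rewrite innerHDr !innerHZr.
- rewrite /cH (_ : _ + _ = innerH z (- s *: EH R k.*2 + c *: EH R k.*2.+1)).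
    apply: functional_ext => n; case: (par n) => ->.
      rewrite (SE _).1 innerHBl innerHDr !innerHZl !innerHZr !EH_orthonormal ?eqSS ?dd ?ee ?eo.
      by case: eqP => [->|_]; rewrite !mulr0 ?sub0r ?addr0 ?mulNr ?subr0 ?oppr0.
    rewrite (SE _).2 innerHDl innerHDr !innerHZl !innerHZr !EH_orthonormal ?eqSS ?dd ?ee ?eo.
    by case: eqP => [->|_]; rewrite !mulr0 ?addr0 ?add0r.
  by rewrite innerHDr !innerHZr.
Qed.

Definition pair_mass z n := cH n./2.*2 z ^+ 2 + cH n./2.*2.+1 z ^+ 2.

Lemma group_coord_le t z n : cH n (S t z) ^+ 2 <= pair_mass z n.
Proof.
have E : pair_mass (S t z) n = pair_mass z n.
  rewrite /pair_mass; have [-> ->] := group_coord t n./2 z.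
  have := cos2Dsin2 (freq n./2 * t); move: (cos _) (sin _) => c s cs.
  by rewrite -[RHS]mul1r -cs; ring.
rewrite -E /pair_mass -{1}(odd_double_half n).
by case: (odd n); rewrite ?add0n ?add1n ?lerDl ?lerDr sqr_ge0.
Qed.

Lemma sum_pairs (a : nat -> R) N :
  \sum_(i < N.*2) a i = \sum_(k < N) (a k.*2 + a k.*2.+1).
Proof.
elim: N => [|N IH]; first by rewrite !big_ord0.
by rewrite doubleS !big_ord_recr /= IH addrA.
Qed.

Lemma pair_mass_sum z N : \sum_(i < N) pair_mass z i <= 2 * Hnorm z ^+ 2.
Proof.
have pm0 n : 0 <= pair_mass z n by rewrite addr_ge0 ?sqr_ge0.
apply: (@le_trans _ _ (\sum_(i < N.*2) pair_mass z i)).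
  have NN : (N <= N.*2)%N by rewrite -addnn leq_addr.
  rewrite -!(big_mkord xpredT (pair_mass z)) [leRHS](big_cat_nat (leq0n N) NN) /=.
  by rewrite lerDl sumr_ge0.
apply: (@le_trans _ _ (2 * \sum_(i < N.*2) cH i z ^+ 2)); last by rewrite ler_wpM2l // bessel.
rewrite (sum_pairs (fun i => cH i z ^+ 2)) sum_pairs mulr_sumr; apply: ler_sum => k _.
by rewrite /pair_mass doubleK /= uphalf_double; lra.
Qed.

End group.

(** * The moment generating function of the mild solution *)

Section variance_of_convolution.
Variable R : realType.
Local Notation leb := (@lebesgue_measure R).

(* [2 (x cos p - y sin p)^2 = x^2 + y^2 + (x^2 - y^2) cos 2p - 2 x y sin 2p], and the
   oscillating terms have bounded primitives. *)
Lemma integral_rotation_sqr (x y om T : R) : 1 <= om -> 0 < T ->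
  exists2 I : R, (\int[leb]_(r in `[0%R,
    T]) ((x * cos (om * (T - r)) - y * sin (om * (T - r))) ^+ 2)%:E = I%:E)%E
    & `|I - T / 2 * (x ^+ 2 + y ^+ 2)| <= x ^+ 2 + y ^+ 2.
Proof.
move=> om1 T0; have om0 : om != 0 by rewrite gt_eqF // (lt_le_trans _ om1).
pose G s := (x ^+ 2 + y ^+ 2) / 2 * s + ((x ^+ 2 - y ^+ 2) / (4 * om) * sin (2 * om * s)
  + x * y / (2 * om) * cos (2 * om * s)).
have dG (s : R) : is_derive s 1 G ((x * cos (om * s) - y * sin (om * s)) ^+ 2).
  have d1 := is_deriveZ ((x ^+ 2 + y ^+ 2) / 2) (is_derive_id s (1 : R)).
  have d2 := is_deriveZ ((x ^+ 2 - y ^+ 2) / (4 * om)) (is_derive_sin_scale (2 * om) s).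
  have d3 := is_deriveZ (x * y / (2 * om)) (is_derive_cos_scale (2 * om) s).
  have := is_deriveD d1 (is_deriveD d2 d3); move/is_derive_eq; apply.
  rewrite -![_ *: _]/(_ * _) (_ : 2 * om * s = om * s + om * s); last by ring.
  rewrite cosD sinD; have := cos2Dsin2 (om * s); move: (cos _) (sin _) => c s' cs.
  have -> : (x ^+ 2 + y ^+ 2) / 2 * 1 = (x ^+ 2 + y ^+ 2) / 2 * (c ^+ 2 + s' ^+ 2) by rewrite cs.
  by field.
pose F r := - G (T - r).
have dF (r : R) : is_derive r 1 F ((x * cos (om * (T - r)) - y * sin (om * (T - r))) ^+ 2).
  have dT : is_derive r 1 (fun r => T - r) (- 1 : R).
    have := is_deriveB (is_derive_cst T r 1) (is_derive_id r (1 : R)).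
    by move/is_derive_eq; apply; rewrite sub0r.
  have := is_deriveN (@is_derive1_comp _ G (fun r : R => T - r) r _ _ (dG (T - r)) dT).
  by move/is_derive_eq; apply; rewrite mulrN1 opprK.
have cf : continuous (fun r : R => (x * cos (om * (T - r)) - y * sin (om * (T - r))) ^+ 2).
  have cT : continuous (fun r : R => om * (T - r)).
    by move=> r; apply: cvgMr; apply: cvgB; [exact: cvg_cst|exact: cvg_id].
  move=> r; apply: (@continuous_comp _ _ _ (fun r : R => x * cos (om * (T - r)) - y * sin (om *
    (T - r))) (fun z : R => z ^+ 2)); last exact: exprn_continuous.
  apply: cvgB; apply: cvgMr; apply: continuous_comp; first exact: cT.
  - exact: continuous_cos.
  - exact: cT.
  - exact: continuous_sin.
exists (F T - F 0).
  rewrite (@continuous_FTC2 _ _ F) //.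
  - exact: continuous_subspaceT.
  - split.
    + by move=> r _; exact: ex_derive.
    + by apply: cvg_at_right_filter; exact: (is_derive_continuous dF).
    + by apply: cvg_at_left_filter; exact: (is_derive_continuous dF).
  - by move=> r _; rewrite derive1E; exact: derive_val.
have -> : F T - F 0 - T / 2 * (x ^+ 2 + y ^+ 2)
  = om^-1 * ((x ^+ 2 - y ^+ 2) / 4 * sin (2 * om * T) + x * y / 2 * (cos (2 * om * T) - 1)).
  by rewrite /F /G subrr subr0 !mulr0 sin0 cos0; field.
rewrite normrM gtr0_norm ?invr_gt0 ?(lt_le_trans _ om1) //.
have omV : om^-1 <= 1 by rewrite invf_le1 // (lt_le_trans _ om1).
apply: (@le_trans _ _ (1 * (x ^+ 2 + y ^+ 2))); last by rewrite mul1r.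
apply: ler_pM => //; first by rewrite invr_ge0 (le_trans _ om1).
have := sin_le1 (2 * om * T); have := sin_geN1 (2 * om * T).
have := cos_le1 (2 * om * T); have := cos_geN1 (2 * om * T).
move: (cos _) (sin _) => c s c1 c2 s1 s2.
apply: le_trans (ler_normD _ _) _; rewrite !normrM.
have ns : `|s| <= 1 by rewrite ler_norml s1.
have nc : `|c - 1| <= 2 by rewrite ler_norml; lra.
rewrite (ger0_norm (_ : 0 <= 4^-1)) // (ger0_norm (_ : 0 <= 2^-1)) //.
have h1 : `|x ^+ 2 - y ^+ 2| <= x ^+ 2 + y ^+ 2.
  by rewrite ler_norml; have := sqr_ge0 x; have := sqr_ge0 y; lra.
have h2 : `|x| * `|y| <= (x ^+ 2 + y ^+ 2) / 2.
  rewrite -(real_normK (num_real x)) -(real_normK (num_real y)).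
  by have := sqr_ge0 (`|x| - `|y|); move: `|x| `|y| => a b; nra.
have h3 : `|x ^+ 2 - y ^+ 2| / 4 * `|s| <= (x ^+ 2 + y ^+ 2) / 4 * 1.
  by apply: ler_pM => //; rewrite ler_pM2r.
have h4 : `|x| * `|y| / 2 * `|c - 1| <= (x ^+ 2 + y ^+ 2) / 2 / 2 * 2.
  by apply: ler_pM => //; rewrite ler_pM2r.
by have := sqr_ge0 x; have := sqr_ge0 y; lra.
Qed.

Lemma nneseries_compare (I q : nat -> R) (t Q : R) : 0 <= t -> (forall k, 0 <= I k) ->
  (forall k, `|I k - t * q k| <= q k) -> \sum_(k < n) q k @[n --> \oo] --> Q ->
  exists2 V : R, (\sum_(k <oo) (I k)%:E = V%:E)%E & `|V - t * Q| <= Q.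
Proof.
move=> t0 I0 Iq qQ.
have q0 k : 0 <= q k := le_trans (normr_ge0 _) (Iq k).
have qle n : \sum_(k < n) q k <= Q.
  rewrite -(cvg_lim _ qQ) //; apply: nondecreasing_cvgn_le; last by apply/cvg_ex; exists Q.
  by apply/nondecreasing_seqP => m; rewrite big_ord_recr /= lerDl.
have Ile n : `|\sum_(k < n) I k - t * \sum_(k < n) q k| <= \sum_(k < n) q k.
  rewrite mulr_sumr -sumrB; apply: le_trans (ler_norm_sum _ _ _) _; exact: ler_sum.
have Icvg : cvgn (fun n => \sum_(k < n) I k).
  apply: nondecreasing_is_cvgn; first by apply/nondecreasing_seqP => m;
    rewrite big_ord_recr /= lerDl.
  exists ((t + 1) * Q) => _ [n _ <-].
  have := Ile n; rewrite ler_norml => /andP[_ h].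
  have : (t + 1) * \sum_(k < n) q k <= (t + 1) * Q by rewrite ler_wpM2l // addr_ge0.
  lra.
exists (limn (fun n => \sum_(k < n) I k)).
  apply/cvg_lim => //; rewrite (_ : (fun n => _) = EFin \o (fun n => \sum_(k < n) I k)).
    by apply: cvg_EFin => //; exact: nearW.
  by apply/funext => n /=; rewrite sumEFin big_mkord.
have c : `|\sum_(k < n) I k - t * \sum_(k < n) q k| @[n --> \oo] --> `|limn (fun n => \sum_(k <
  n) I k) - t * Q|.
  by apply: cvg_norm; apply: cvgB; [exact: Icvg|exact: cvgMr].
rewrite -(cvg_lim _ c) //; apply: limr_le; first by apply/cvg_ex; eexists; exact: c.
by apply: nearW => n; exact: le_trans (Ile n) (qle n).
Qed.

End variance_of_convolution.

Section mild_mgf.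
Context d (Omega : measurableType d) (R : realType).
Variables (P : probability Omega R) (F : R -> set (set Omega)) (alpha : R) (eta : nat -> R).
Variables (b : nat -> R -> Omega -> R) (W : R -> Omega -> U0 R).
Variables (Q Qhalf : U0 R -> U0 R) (S : R -> H0 R -> H0 R).
Hypothesis HF : usual_filtration P F.
Hypothesis HW : wiener_process P F eta b W.
Hypothesis eta_ge0 : forall k, 0 <= eta k.
Hypothesis Q_e : forall k, Q (e R k) = eta k *: e R k.
Hypothesis QhalfQ : sqrt_op Qhalf Q.
Hypothesis HS : schrodinger_group S.

Lemma group_embed_e xi k t :
  innerH xi (S t (realpart_embed (Qhalf (e R k)))) =
  Num.sqrt (eta k) * cH k.*2 xi * cos (k.+1%:R ^+ 2 * t) - Num.sqrt (eta k) * cH k.*2.+1 xi * sin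
    (k.+1%:R ^+ 2 * t).
Proof.
have -> : realpart_embed (Qhalf (e R k)) = Num.sqrt (eta k) *: EH R k.*2.
  rewrite (Qhalf_e eta_ge0 Q_e QhalfQ) EH_even /realpart_embed.
  transitivity (Num.sqrt (eta k) *: e R k, Num.sqrt (eta k) *: (0 : U0 R)); last by [].
  by rewrite scaler0.
rewrite (groupZ HS) (group_EH HS k t).1 innerHZr innerHBr !innerHZr /cH; ring.
Qed.

Lemma qform_pairs xi :
  \sum_(k < n) ((Num.sqrt (eta k) * cH k.*2 xi) ^+ 2 + (Num.sqrt (eta k) * cH k.*2.+1 xi) ^+ 2)
    @[n --> \oo] --> qform Qhalf xi.
Proof.
pose z := complexify Qhalf xi.
have zc n : cH n z = Num.sqrt (etaH eta n) * cH n xi by exact: (cH_QH eta_ge0 Q_e QhalfQ).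
have h := @cvg_comp _ _ _ (muln 2)
  (fun N => \sum_(i < N) cH i z ^+ 2) _ _ _ (@cvg_mulnl 2 (ltn0Sn 1)) (@parseval R z).
rewrite (_ : (fun n => _) = (fun N => \sum_(i < N) cH i z ^+ 2) \o muln 2); first exact: h.
apply/funext => n /=; rewrite mul2n (sum_pairs (fun i => cH i z ^+ 2)); apply: eq_bigr => k _.
by rewrite !zc /etaH doubleK /= uphalf_double.
Qed.

Lemma mild_variance xi T : 0 < T -> exists2 V : R,
  sqr_mass T (fun k r => innerH xi (S (T - r) (realpart_embed (Qhalf (e R k))))) = V%:E &
  `|V - T / 2 * qform Qhalf xi| <= qform Qhalf xi.
Proof.
move=> T0.
pose x k := Num.sqrt (eta k) * cH k.*2 xi; pose y k := Num.sqrt (eta k) * cH k.*2.+1 xi.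
have freq1 k : 1 <= k.+1%:R ^+ 2 :> R by rewrite exprn_ege1 // ler1n.
pose J k : \bar R := (\int[@lebesgue_measure R]_(r in `[0%R,
  T]) ((x k * cos (k.+1%:R ^+ 2 * (T - r)) - y k * sin (k.+1%:R ^+ 2 * (T - r))) ^+ 2)%:E)%E.
pose I k := fine (J k).
have IE k : J k = (I k)%:E /\ `|I k - T / 2 * (x k ^+ 2 + y k ^+ 2)| <= x k ^+ 2 + y k ^+ 2.
  by have [Ik h1 h2] := integral_rotation_sqr (x k) (y k) (freq1 k) T0; rewrite /I /J h1.
have [|k|k|V VE VB] := @nneseries_compare R I (fun k => x k ^+ 2
  + y k ^+ 2) (T / 2) (qform Qhalf xi) _ _ _ (qform_pairs (xi := xi)).
- by rewrite divr_ge0 // ltW.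
- by rewrite -lee_fin -(IE k).1; apply: integral_ge0 => r _; rewrite lee_fin sqr_ge0.
- exact: (IE k).2.
exists V => //; rewrite -VE; apply: eq_eseriesr => k _; rewrite -(IE k).1.
by apply: eq_integral => r _; rewrite group_embed_e.
Qed.

Lemma qform_swap (z : H0 R) : qform Qhalf (z.2, - z.1) = qform Qhalf z.
Proof.
by rewrite /qform !Hnorm2E /= -scaleN1r (QhalfZ QhalfQ) scaleN1r normrN addrC.
Qed.

Lemma innerH_imul (z y : H0 R) : innerH z (imul y) = innerH (z.2, - z.1) y.
Proof. by rewrite /innerH /= innerNr innerNl addrC. Qed.

Lemma mild_mgf u0 u T zeta : mild_solution P alpha Qhalf S W u0 u -> 1 <= T ->
  exists w : R, (\int[P]_x (expR (innerH zeta (u T x)))%:E = (expR w)%:E)%E /\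
    `|w - (innerH zeta (S T u0) + alpha ^+ 2 * T / 4 * qform Qhalf zeta)|
      <= alpha ^+ 2 / 2 * qform Qhalf zeta.
Proof.
move=> sol T1; have T0 : 0 < T := lt_le_trans ltr01 T1.
have [uE [Y SI uY]] := sol T (ltW T0).
set xi : H0 R := (zeta.2, - zeta.1).
have [V VE VB] := mild_variance xi T0.
have mPhi (k : nat) : measurable_fun setT (fun r : R => innerH xi (S (T - r)
  (realpart_embed (Qhalf (e R k))))).
  apply: continuous_measurable_fun => r.
  rewrite (_ : (fun r => _) = (fun r => Num.sqrt (eta k) * cH k.*2 xi * cos (k.+1%:R ^+ 2 * (T -
    r)) - Num.sqrt (eta k) * cH k.*2.+1 xi * sin (k.+1%:R ^+ 2 * (T - r)))).
    have cT : continuous (fun r : R => k.+1%:R ^+ 2 * (T - r)).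
      by move=> {}r; apply: cvgMr; apply: cvgB; [exact: cvg_cst|exact: cvg_id].
    apply: cvgB; apply: cvgMr; apply: continuous_comp; first exact: cT.
    - exact: continuous_cos.
    - exact: cT.
    - exact: continuous_sin.
  by apply/funext => r'; rewrite group_embed_e.
have [mY gY] := stochastic_gaussian HF HW eta_ge0 Q_e QhalfQ mPhi VE SI.
have mu_ : measurable_fun setT (fun w => innerH zeta (u T w)).
  rewrite (_ : (fun w => _) = (fun z => innerH z zeta) \o u T); last by apply/funext => w /=;
    rewrite innerHC.
  by apply: random_element_continuous => //; exact: innerH_continuous.
have maY : measurable_fun setT (fun w => alpha * innerH xi (Y w)) by exact: measurable_funM.
exists (innerH zeta (S T u0) + alpha ^+ 2 * V / 2); split.
  transitivity (\int[P]_w (expR (innerH zeta (S T u0) + alpha * innerH xi (Y w)))%:E)%E.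
    apply: ae_eq_integral => //.
    - by apply/measurable_EFinP; exact: measurableT_comp.
    - by apply/measurable_EFinP; apply: measurableT_comp => //; exact: measurable_funD.
    apply: (@filterS _ (almost_everywhere P) _ _ _ _ uY) => w /= uw _.
    by rewrite uw innerHDr innerHZr innerH_imul.
  by rewrite integral_expRD // gY -EFinM -expRD.
have -> : innerH zeta (S T u0) + alpha ^+ 2 * V / 2 - (innerH zeta (S T u0)
  + alpha ^+ 2 * T / 4 * qform Qhalf zeta) =
    alpha ^+ 2 / 2 * (V - T / 2 * qform Qhalf zeta) by field.
rewrite normrM ger0_norm ?divr_ge0 ?sqr_ge0 // ler_wpM2l ?divr_ge0 ?sqr_ge0 //.
by rewrite -qform_swap.
Qed.

End mild_mgf.

Theorem theorem3p9 (R : realType) (d : measure_display)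
    (Omega : measurableType d) (P : probability Omega R)
    (F : R -> set (set Omega)) (alpha : R) (eta : nat -> R)
    (Q Qhalf : U0 R -> U0 R) (b : nat -> R -> Omega -> R)
    (W : R -> Omega -> U0 R) (Sg : R -> H0 R -> H0 R)
    (u0 : H0 R) (u : R -> Omega -> H0 R) :
  0 < alpha ->
  (forall k, 0 <= eta k) ->
  (forall k, eta k.+1 <= eta k) ->
  nonneg_sym_op Q ->
  (forall k, Q (e R k) = eta k *: e R k) ->
  sqrt_op Qhalf Q ->
  hilbert_schmidt_U1 Qhalf ->
  usual_filtration P F ->
  wiener_process P F eta b W ->
  schrodinger_group Sg ->
  inH10C u0 ->
  mild_solution P alpha Qhalf Sg W u0 u ->
  good_rate_function (rate alpha Qhalf) /\
  satisfies_LDP P (fun T w => T^-1 *: u T w) (rate alpha Qhalf).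
Proof.
move=> alpha0 eta0 _ _ Qe QhQ HS1 HF HW HS _ sol.
have mu_u T : 1 <= T -> random_element (u T).
  by move=> T1; have [] := sol T (le_trans ler01 T1).
have mgf T zeta := mild_mgf HF HW eta0 Qe QhQ HS zeta sol (T := T).
have bbS := pair_mass_sum u0; have bbg T n (_ : 1 <= T) := group_coord_le HS T u0 n.
split; [|split].
- exact: (rate_good eta0 Qe QhQ HS1 alpha0 mu_u bbg bbS mgf).
- move=> G oG; exact: (LDP_lower eta0 Qe QhQ HS1 alpha0 mu_u bbg bbS mgf oG).
- move=> C cC; exact: (LDP_upper eta0 Qe QhQ HS1 alpha0 mu_u bbg bbS mgf cC).
Qed.
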